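(* Let $c\in\mathbb{C}$ with $\operatorname{Re}(c)>0$ and $\operatorname{Im}(c)>0$, let $H_c$ be the complex harmonic oscillator on $L^2(\mathbb{R})$, and let $\lambda_n=c^{1/2}(2n+1)$, $n=0,1,\ldots$. For all $0<\delta<1$ and all $m=0,1,\ldots$ there exists $\varepsilon>0$ such that $$\operatorname{Spec}_\varepsilon(H_c)\subset\left[S(0,\arg(c))+(\lambda_{m+1}-\delta c^{1/2})\right]\cup\bigcup_{n=0}^m\{z\in\mathbb{C}: |z-\lambda_n|<\delta\}.$$
   Context: For $c\in\mathbb{C}$ with $\operatorname{Re}(c)>0$, the complex harmonic oscillator $H_c f(x)=-f''(x)+c\,x^2f(x)$ is the m-sectorial operator on $L^2(\mathbb{R})$ associated with the closed m-sectorial form $$Q_c(f,g)=\int_{\mathbb{R}} f'\overline{g'}\,dx + c\int_{\mathbb{R}}x^2 f\overline{g}\,dx$$ with form domain $W^{1,2}(\mathbb{R})\cap\{f\in L^2(\mathbb{R}):\int x^2|f(x)|^2dx<\infty\}$. Its spectrum is $\{\lambda_n:n=0,1,\ldots\}$ (with $c^{1/2}$ the principal root). For $\varepsilon>0$ the $\varepsilon$-pseudospectrum is $$\operatorname{Spec}_\varepsilon(H_c)=\operatorname{Spec}(H_c)\cup\{z\in\mathbb{C}:\|(H_c-z)^{-1}\|\ge 1/\varepsilon\}.$$ Also $S(0,\arg(c))=\{z\in\mathbb{C}:0<\arg z<\arg(c)\}$ is the open angular sector, and $S+w$ denotes the translate of the set $S$ by $w\in\mathbb{C}$. *)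

(* Defs.v *)
(* MathComp-Analysis: the real line is an arbitrary [R : realType], the complex
   plane is [R[i]] (mathcomp real_closed). *)
From HB Require Import structures.
From mathcomp Require Import all_boot all_order all_algebra.
From mathcomp Require Import all_classical all_reals all_analysis.
From mathcomp Require Import complex.

Set Implicit Arguments.
Unset Strict Implicit.
Unset Printing Implicit Defensive.

Import Order.TTheory GRing.Theory Num.Theory.
Import numFieldNormedType.Exports.

Local Open Scope classical_set_scope.
Local Open Scope ring_scope.
Local Open Scope complex_scope.

Section ComplexL2.
Variable R : realType.

Local Notation mu := (@lebesgue_measure R).
Local Notation fct := (R -> R[i]).

(* Elements of L^2(R) are represented by functions; equality in L^2 is
   [ae_eq mu setT]. *)
Definition L2 : set fct :=
  [set f : fct | (@complex.Re R \o f) \in Lfun mu 2%:E /\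
                  (@complex.Im R \o f) \in Lfun mu 2%:E].

(* Meaningful when the real and imaginary parts are integrable, which is the
   case at every use below. *)
Definition Cintegral (f : fct) : R[i] :=
  (\int[mu]_x complex.Re (f x)) +i* (\int[mu]_x complex.Im (f x)).

Definition L2inner (f g : fct) : R[i] := Cintegral (fun x => f x * (g x)^*).

Definition L2norm (f : fct) : R :=
  Num.sqrt (\int[mu]_x ComplexField.Normc.normc (f x) ^+ 2).

Definition test_function (phi : R -> R) : Prop :=
  (forall n x, derivable (derive1n n phi) x 1) /\
  (exists M : R, forall x, M < `|x| -> phi x = 0).

(* Real-valued test functions suffice, by linearity. *)
Definition is_weak_derivative (f g : fct) : Prop :=
  forall phi, test_function phi ->
    Cintegral (fun x => f x * (derive1 phi x)%:C) =
    - Cintegral (fun x => g x * (phi x)%:C).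

Definition W12 : set fct :=
  [set f : fct | L2 f /\ exists g, L2 g /\ is_weak_derivative f g].

(* Unique up to a.e. equality for f in [W12]. *)
Definition weak_derivative (f : fct) : fct :=
  xget (cst 0) [set g : fct | L2 g /\ is_weak_derivative f g].

(* A partial operator in L^2(R); only the values on [op_dom] matter, and they
   matter only up to a.e. equality. *)
Record operator := Operator { op_dom : set fct; op_app : fct -> fct }.

(* The operator associated with a sesquilinear form (Kato's first
   representation theorem): f is in its domain, with value h, when f is in the
   form domain and Q f g = <h, g> for all g in the form domain. *)
Definition form_operator (D : set fct) (Q : fct -> fct -> R[i]) : operator :=
  let represents f h := L2 h /\ forall g, D g -> Q f g = L2inner h g in
  Operator [set f : fct | D f /\ exists h, represents f h]
           (fun f => xget (cst 0) [set h : fct | represents f h]).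

Definition op_shift (T : operator) (z : R[i]) (f : fct) : fct :=
  fun x => op_app T f x - z * f x.

(* (T - z)^-1 *)
Definition resolvent (T : operator) (z : R[i]) (h : fct) : fct :=
  xget (cst 0) [set f : fct | op_dom T f /\ ae_eq mu setT (op_shift T z f) h].

Definition opnorm (A : fct -> fct) : \bar R :=
  ereal_sup [set (L2norm (A h))%:E | h in [set h : fct | L2 h /\ L2norm h <= 1]].

Definition resolvent_set (T : operator) : set R[i] :=
  [set z : R[i] | [/\ (forall f1 f2, op_dom T f1 -> op_dom T f2 ->
                  ae_eq mu setT (op_shift T z f1) (op_shift T z f2) ->
                  ae_eq mu setT f1 f2),
               (forall h, L2 h ->
                  exists f, op_dom T f /\ ae_eq mu setT (op_shift T z f) h) &
               (opnorm (resolvent T z) < +oo)%E]].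

Definition Spec (T : operator) : set R[i] := ~` resolvent_set T.

Definition pseudospectrum (eps : R) (T : operator) : set R[i] :=
  Spec T `|` [set z : R[i] | (eps^-1%:E <= opnorm (resolvent T z))%E].

Definition ho_form_domain : set fct :=
  W12 `&` [set f : fct | L2 f /\
    (\int[mu]_x (x ^+ 2 * ComplexField.Normc.normc (f x) ^+ 2)%:E < +oo)%E].

Definition ho_form (c : R[i]) (f g : fct) : R[i] :=
  Cintegral (fun x => weak_derivative f x * (weak_derivative g x)^*) +
  c * Cintegral (fun x => (x ^+ 2)%:C * f x * (g x)^*).

Definition harmonic_oscillator (c : R[i]) : operator :=
  form_operator ho_form_domain (ho_form c).

(* [sqrtc] is the principal square root: its real part is nonnegative. *)
Definition ho_eigenvalue (c : R[i]) (n : nat) : R[i] :=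
  sqrtc c * (2 * n + 1)%:R.

(* Principal argument, in ]-pi, pi]; unspecified at 0. *)
Definition Arg (z : R[i]) : R :=
  get [set t | - pi < t <= pi /\ z = `|z| * (cos t +i* sin t)].

Definition sector (a b : R) : set R[i] :=
  [set z : R[i] | z != 0 /\ a < Arg z < b].

Definition translate (S : set R[i]) (w : R[i]) : set R[i] :=
  [set s + w | s in S].

End ComplexL2.

(* Main.v *)
(* Let [q] be the square root of [c], [P = - i d/dx] and [X] the multiplication by
   [x], so that [H_c = P^2 + q^2 X^2] and [|Im q| < Re q].  It suffices to bound the
   resolvent uniformly for the [z] outside the sector and the discs.

   On the core of the products [p(x) exp(- q x^2 / 2)], [p] a polynomial, [H_c - z]
   is surjective unless [z] is an eigenvalue, and [|f| <= M |(H_c - z) f|] is derived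
   from [[X, P] = i] alone.  For [z] large in a half-plane [Im z <= K] one tests
   against [f], [X^2 f] and [X P f]; a half-plane [Im (z / c) >= - K] is reduced to
   this case by exchanging [(P, X)] with [(X, - P)]; for bounded [z] the creation
   operator shifts [z] by [2 q] until [Re (z / q) <= 0].

   The core is dense: a function orthogonal to it has vanishing moments against all
   [exp(- w x^2)], [w > 0], hence against all [exp(- w (x - y)^2)], hence, by
   polynomials in the latter, against the indicator of every segment.  Density and
   the closedness of the form extend the bound to the resolvent; injectivity of
   [H_c - z] follows by duality with the core of the adjoint oscillator. *)
Require Import Defs.
From HB Require Import structures.
From mathcomp Require Import all_boot all_order all_algebra.
From mathcomp Require Import all_classical all_reals all_analysis.
From mathcomp Require Import measurable_realfun complex.
From mathcomp Require Import ring lra.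
Set Implicit Arguments.
Unset Strict Implicit.
Unset Printing Implicit Defensive.
Import Order.TTheory GRing.Theory Num.Theory.
Import numFieldNormedType.Exports.
Local Open Scope classical_set_scope.
Local Open Scope ring_scope.
Local Open Scope complex_scope.

(** The numerical range of [H_c] lies in the closed sector between the directions 1 and [c], so
    pairing [(H_c - z) f] with [f] settles the [z] at a distance from that sector. It says nothing
    about the strips along the two edges, nor about [z] near the first eigenvalues. [H_c] is not
    normal and its eigenfunctions are not orthogonal, so that expansions in them give no norm bound;
    commutators replace them. In the strip along the real axis the gain is a positive commutator:
    the imaginary part of the pairing of [(H_c - z) f] with [X P f] contains [Re z |f|^2 / 2]. In a
    bounded region finitely many eigenvalues matter, and each use of the creation operator removes
    one.

    The a priori bounds need only a vector space with a semi-definite form and two symmetric maps,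
    so that on the core they are polynomial algebra, free of domain questions.

    [Re c > 0] becomes [|Im q| < Re q]. Besides coercivity, this lets the phase of
    [exp(- q x^2 / 2)] be expanded in powers under its modulus in the density proof. *)

Notation Re := complex.Re.
Notation Im := complex.Im.
Notation normc := ComplexField.Normc.normc.

(** * Real and imaginary parts, modulus *)

Section ComplexParts.
Variable R : rcfType.
Implicit Types (x y : R[i]) (a b : R).

Lemma ReD x y : Re (x + y) = Re x + Re y. Proof. by case: x y => ? ? []. Qed.
Lemma ImD x y : Im (x + y) = Im x + Im y. Proof. by case: x y => ? ? []. Qed.
Lemma ReN x : Re (- x) = - Re x. Proof. by case: x. Qed.
Lemma ImN x : Im (- x) = - Im x. Proof. by case: x. Qed.
Lemma ReM x y : Re (x * y) = Re x * Re y - Im x * Im y.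
Proof. by case: x y => ? ? []. Qed.
Lemma ImM x y : Im (x * y) = Re x * Im y + Im x * Re y.
Proof. by case: x y => ? ? []. Qed.
Lemma ReJ x : Re x^* = Re x. Proof. by case: x. Qed.
Lemma ImJ x : Im x^* = - Im x. Proof. by case: x. Qed.
Definition ReImE := (ReD, ImD, ReN, ImN, ReM, ImM, ReJ, ImJ).

Lemma complexP x y : Re x = Re y -> Im x = Im y -> x = y.
Proof. by case: x y => ? ? [? ?] /= -> ->. Qed.

Lemma ReV x : Re x^-1 = Re x / (Re x ^+ 2 + Im x ^+ 2). Proof. by case: x. Qed.
Lemma ImV x : Im x^-1 = - Im x / (Re x ^+ 2 + Im x ^+ 2).
Proof. by case: x => a b /=; rewrite mulNr. Qed.

Lemma normc_ge0 x : 0 <= normc x. Proof. by case: x => a b; exact: sqrtr_ge0. Qed.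

Lemma normc_sqr x : normc x ^+ 2 = Re x ^+ 2 + Im x ^+ 2.
Proof. by case: x => a b /=; rewrite sqr_sqrtr// addr_ge0 ?sqr_ge0. Qed.

Lemma normr_Re_le x : `|Re x| <= normc x.
Proof.
rewrite -(ler_pXn2r (_ : 0 < 2)%N) ?nnegrE ?normc_ge0//.
by rewrite normc_sqr real_normK ?num_real// lerDl sqr_ge0.
Qed.

Lemma normr_Im_le x : `|Im x| <= normc x.
Proof.
rewrite -(ler_pXn2r (_ : 0 < 2)%N) ?nnegrE ?normc_ge0//.
by rewrite normc_sqr real_normK ?num_real// lerDr sqr_ge0.
Qed.

Lemma normcE' x : normc x = Num.sqrt (Re x ^+ 2 + Im x ^+ 2).
Proof. by case: x. Qed.

Lemma normcJ' x : normc x^* = normc x.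
Proof. by rewrite !normcE' !ReImE sqrrN. Qed.

Lemma normc_real a : normc a%:C = `|a|.
Proof. by rewrite normcE' /= expr0n addr0 sqrtr_sqr. Qed.

Lemma normc_eq0' x : (normc x == 0) = (x == 0).
Proof.
by apply/eqP/eqP => [/ComplexField.Normc.eq0_normc//|->]; exact: ComplexField.Normc.normc0.
Qed.

Lemma normc_gt0 x : (0 < normc x) = (x != 0).
Proof. by rewrite lt_neqAle normc_ge0 andbT eq_sym normc_eq0'. Qed.

Lemma mul_realCJ a x y : a%:C * x * y^* = x * (a%:C * y)^*.
Proof. by apply: complexP; rewrite !ReImE /=; ring. Qed.

Lemma normc_le_sum x : normc x <= `|Re x| + `|Im x|.
Proof.
rewrite -(ler_pXn2r (_ : 0 < 2)%N) ?nnegrE ?normc_ge0 ?addr_ge0//.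
rewrite normc_sqr sqrrD !real_normK ?num_real//.
have : 0 <= `|Re x| * `|Im x| by rewrite mulr_ge0.
lra.
Qed.

(** The discriminant argument, stated for numbers because it serves twice: with the squared norms of
    two vectors, and with [A] the excess of a squared distance over its infimum. *)
Lemma cauchy_schwarz_scalar (A B : R) (w : R[i]) : 0 <= A -> 0 <= B ->
  (forall t : R[i], 0 <= A - 2 * Re (t^* * w) + normc t ^+ 2 * B) ->
  normc w <= Num.sqrt A * Num.sqrt B.
Proof.
move=> A0 B0 H.
rewrite -(ler_pXn2r (_ : 0 < 2)%N) ?nnegrE ?normc_ge0 ?mulr_ge0 ?sqrtr_ge0//.
rewrite exprMn !sqr_sqrtr//.
have Hs (s : R) : 0 <= A - 2 * s * normc w ^+ 2 + s ^+ 2 * normc w ^+ 2 * B.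
  have := H (s%:C * w); rewrite !normc_sqr !ReImE /=.
  by congr (0 <= _); ring.
have w0 : 0 <= normc w ^+ 2 by rewrite sqr_ge0.
move: B0; rewrite le_eqVlt => /predU1P[B0|B0]; last first.
  have := mulr_ge0 (ltW B0) (Hs B^-1).
  rewrite -subr_ge0; congr (0 <= _); field; exact: lt0r_neq0.
rewrite -B0 mulr0.
(* When [B] vanishes the expression is affine in the parameter, and this value makes it negative
   unless [w] vanishes too. *)
have := Hs ((A + 1) / normc w ^+ 2); rewrite -B0 mulr0 addr0.
have [->|wn0] := eqVneq (normc w ^+ 2) 0; first by rewrite lexx.
rewrite -mulrA divfK//; lra.
Qed.

End ComplexParts.

(** * Real inequalities behind the high-energy estimate *)

Section RealEstimates.
Variable R : rcfType.
Implicit Types (x y a b : R).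

Lemma le_of_sqr_le x y : 0 <= y -> x ^+ 2 <= y ^+ 2 -> x <= y.
Proof.
move=> y0 h; case: (lerP x 0) => [/le_trans->//|x0].
by rewrite -(ler_pXn2r (_ : 0 < 2)%N) ?nnegrE// ltW.
Qed.

Lemma le_of_sqr_le_mul x y : 0 <= x -> 0 <= y -> x ^+ 2 <= y * x -> x <= y.
Proof.
rewrite le_eqVlt => /predU1P[<-//|x0] y0.
by rewrite expr2 ler_pM2r.
Qed.

(* For [f] normalized and [lam = Re z] large, [eta], [x1], [p1], [x2] and [y] are
   the norms of [(H - z) f], [X f], [P f], [X (X f)] and [X (P f)].  The
   inequalities make [x2 * y] of order [lam ^ (3/4)], against [lam / 2]. *)
Lemma high_energy_unit (c2 nc K : R) : 0 < c2 -> 0 <= nc -> 0 <= K ->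
  exists L, 0 < L /\ forall lam eta x1 p1 x2 y : R,
    0 <= eta <= 1 -> 0 <= x1 -> 0 <= p1 -> 0 <= x2 -> 0 <= y -> L <= lam ->
    c2 * x1 ^+ 2 <= K + eta ->
    p1 ^+ 2 <= lam + eta ->
    c2 * x2 ^+ 2 <= K * x1 ^+ 2 + 2 * (p1 * x1) + eta * x2 ->
    y ^+ 2 <= lam * x1 ^+ 2 + 2 * (p1 * x1) + eta * x2 ->
    lam / 2 <= K * (p1 * x1) + nc * (x2 * y) + eta * y -> False.
Proof.
move=> c20 nc0 K0.
(* With [r = lam ^ (1/4)] the constants are such that [x1 <= al], [p1 <= 2 r^2], [x2 <= be r] and
   [y <= ga r^2]. The last hypothesis then gives [r^4 / 2 <= G r^3], against [r >= 2 G + 1]. *)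
pose al := (K + 1) / c2 + 1.
have al1 : 1 <= al by rewrite lerDr divr_ge0// ?ltW//; lra.
have al0 : 0 <= al by exact: le_trans al1.
have Ka0 : 0 <= K * al by rewrite mulr_ge0.
have Kaa0 : 0 <= K * al ^+ 2 by rewrite mulr_ge0 ?sqr_ge0.
pose be := (K * al ^+ 2 + 4 * al + 1) / c2 + 1.
have be1 : 1 <= be by rewrite lerDr divr_ge0// ?ltW//; lra.
have be0 : 0 <= be by exact: le_trans be1.
pose ga := al ^+ 2 + 4 * al + be + 1.
have al2 : 0 <= al ^+ 2 by rewrite sqr_ge0.
have ga1 : 1 <= ga by rewrite /ga; lra.
have ga0 : 0 <= ga by exact: le_trans ga1.
pose G := 2 * (K * al) + nc * (be * ga) + ga.
have nbg : 0 <= nc * (be * ga) by rewrite !mulr_ge0.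
have G0 : 1 <= G by rewrite /G; lra.
exists ((2 * G + 1) ^+ 4); split; first by rewrite exprn_gt0//; lra.
move=> lam eta x1 p1 x2 y /andP[e0 e1] x10 p10 x20 y0 Llam h1 h2 h3 h4 h5.
have lam0 : 0 <= lam by apply: le_trans Llam; rewrite exprn_ge0//; lra.
pose r := Num.sqrt (Num.sqrt lam).
have r0 : 0 <= r by rewrite sqrtr_ge0.
have r4 : lam = r ^+ 4.
  by rewrite (_ : 4%N = (2 * 2)%N)// exprM !sqr_sqrtr// sqrtr_ge0.
have rG : 2 * G + 1 <= r.
  by rewrite -(ler_pXn2r (_ : 0 < 4)%N) ?nnegrE -?r4//; lra.
have r1 : 1 <= r by lra.
have r2 : 1 <= r ^+ 2 by rewrite exprn_ege1.
have rr : r <= r ^+ 2 by rewrite expr2 ler_peMr.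
have rr3 : r ^+ 2 <= r ^+ 3 by rewrite exprS ler_peMl// ?sqr_ge0.
have rr4 : r ^+ 2 <= r ^+ 4 by rewrite (_ : r ^+ 4 = r ^+ 2 * r ^+ 2) ?ler_peMr ?sqr_ge0//; ring.
have x1a : x1 <= al.
  have h : c2 * x1 ^+ 2 <= c2 * (al - 1).
    rewrite (_ : c2 * (al - 1) = K + 1); first lra.
    by rewrite /al; field; exact: lt0r_neq0.
  rewrite ler_pM2l// in h.
  apply: le_of_sqr_le => //.
  have : al <= al ^+ 2 by rewrite expr2 ler_peMr.
  lra.
have x1a2 : x1 ^+ 2 <= al ^+ 2 by rewrite ler_pXn2r ?nnegrE.
have p1r : p1 <= 2 * r ^+ 2.
  apply: le_of_sqr_le; first by lra.
  rewrite exprMn -exprM; rewrite r4 in h2.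
  by lra.
have px : p1 * x1 <= 2 * (r ^+ 2 * al) by rewrite mulrA ler_pM.
have ra2 : al <= r ^+ 2 * al by rewrite ler_peMl.
have x2b : x2 <= be * r.
  (* If [x2 > be r], then also [x2 >= r], so each term on the right of the quadratic inequality is
     at most a multiple of [r x2]; [be] makes the left side exceed their sum by [c2 r x2]. *)
  rewrite leNgt; apply/negP => x2r.
  have x2r' : r <= x2 by apply: le_trans (ltW x2r); rewrite ler_peMl.
  have s1 : c2 * (be * r) * x2 <= c2 * x2 ^+ 2.
    by rewrite -mulrA ler_pM2l// expr2 ler_wpM2r// ltW.
  have s2 : c2 * (be * r) * x2 = (K * al ^+ 2 + 4 * al + 1) * (r * x2) + c2 * (r * x2).
    by rewrite /be; field; exact: lt0r_neq0.
  have s3 : r ^+ 2 <= r * x2 by rewrite expr2 ler_wpM2l.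
  have s4 : x2 <= r * x2 by rewrite ler_peMl.
  have s5 : 0 < c2 * (r * x2) by rewrite !mulr_gt0//; lra.
  have s6 : eta * x2 <= x2 by rewrite ler_piMl.
  have s7 : K * x1 ^+ 2 <= K * al ^+ 2 * r ^+ 2.
    by apply: (@le_trans _ _ (K * al ^+ 2)); rewrite ?ler_wpM2l// ler_peMr.
  have s8 : (K * al ^+ 2 + 4 * al) * r ^+ 2 <= (K * al ^+ 2 + 4 * al) * (r * x2).
    by rewrite ler_wpM2l//; lra.
  nra.
have yg : y <= ga * r ^+ 2.
  apply: le_of_sqr_le; first by rewrite mulr_ge0// ?sqr_ge0.
  apply: (le_trans h4).
  have t1 : lam * x1 ^+ 2 <= r ^+ 4 * al ^+ 2 by rewrite r4 ler_wpM2l// exprn_ge0.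
  have t2 : eta * x2 <= be * r ^+ 4.
    apply: (@le_trans _ _ x2); first by rewrite ler_piMl.
    by apply: (le_trans x2b); rewrite ler_wpM2l//; lra.
  have t3 : r ^+ 2 * al <= r ^+ 4 * al by rewrite ler_wpM2r.
  have t4 : ga * r ^+ 4 <= (ga * r ^+ 2) ^+ 2.
    rewrite exprMn -exprM ler_wpM2r ?exprn_ge0//.
    by rewrite expr2 ler_peMr.
  have r40 : 0 <= r ^+ 4 by rewrite exprn_ge0.
  apply: le_trans t4; rewrite /ga.
  lra.
have u1 : K * (p1 * x1) <= 2 * (K * al) * r ^+ 3.
  apply: (@le_trans _ _ (K * (2 * (r ^+ 2 * al)))); first by rewrite ler_wpM2l.
  rewrite (_ : K * _ = 2 * (K * al) * r ^+ 2); last by ring.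
  by rewrite ler_wpM2l// mulr_ge0.
have u2 : nc * (x2 * y) <= nc * (be * ga) * r ^+ 3.
  rewrite (_ : nc * (be * ga) * r ^+ 3 = nc * ((be * r) * (ga * r ^+ 2))); last by ring.
  by rewrite ler_wpM2l// ler_pM.
have u3 : eta * y <= ga * r ^+ 3.
  apply: (@le_trans _ _ y); first by rewrite ler_piMl.
  by apply: (le_trans yg); rewrite ler_wpM2l.
have r3 : 0 < r ^+ 3 by rewrite exprn_gt0//; lra.
have : r ^+ 4 / 2 <= G * r ^+ 3.
  by rewrite -r4 /G; lra.
rewrite exprS => h.
have : r / 2 * r ^+ 3 <= G * r ^+ 3 by lra.
rewrite ler_pM2r//; lra.
Qed.

(** The inequalities are homogeneous of degree two in the norms. If [eta < N], dividing by [N] gives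
    a normalized configuration with [eta / N <= 1], which is impossible. *)
Lemma high_energy_real (c2 nc K : R) : 0 < c2 -> 0 <= nc -> 0 <= K ->
  exists L, 0 < L /\ forall lam N eta x1 p1 x2 y : R,
    0 <= N -> 0 <= eta -> 0 <= x1 -> 0 <= p1 -> 0 <= x2 -> 0 <= y -> L <= lam ->
    c2 * x1 ^+ 2 <= K * N ^+ 2 + eta * N ->
    p1 ^+ 2 <= lam * N ^+ 2 + eta * N ->
    c2 * x2 ^+ 2 <= K * x1 ^+ 2 + 2 * (p1 * x1) + eta * x2 ->
    y ^+ 2 <= lam * x1 ^+ 2 + 2 * (p1 * x1) + eta * x2 ->
    lam * N ^+ 2 / 2 <= K * (p1 * x1) + nc * (x2 * y) + eta * y -> N <= eta.
Proof.
move=> c20 nc0 K0; have [L [L0 HL]] := high_energy_unit c20 nc0 K0.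
exists L; split=> // lam N eta x1 p1 x2 y N0 e0 x10 p10 x20 y0 Llam h1 h2 h3 h4 h5.
rewrite leNgt; apply/negP => eN.
have Np : 0 < N by exact: le_lt_trans eN.
have N2 : 0 < N ^+ 2 by rewrite exprn_gt0.
have tr (a b a' b' : R) : a <= b -> a' * N ^+ 2 = a -> b' * N ^+ 2 = b -> a' <= b'.
  by rewrite -(ler_pM2r N2 a') => ? -> ->.
have e1 : 0 <= eta / N <= 1 by rewrite divr_ge0// ler_pdivrMr// mul1r ltW.
by apply: (HL lam (eta / N) (x1 / N) (p1 / N) (x2 / N) (y / N) e1 _ _ _ _ Llam
  (tr _ _ _ _ h1 _ _) (tr _ _ _ _ h2 _ _) (tr _ _ _ _ h3 _ _)
  (tr _ _ _ _ h4 _ _) (tr _ _ _ _ h5 _ _)); rewrite ?divr_ge0//;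
  field; rewrite ?lt0r_neq0 ?pnatr_eq0.
Qed.
End RealEstimates.

(** * A priori bounds for an abstract oscillator *)

Section HermitianForm.
Variables (R : rcfType) (V : lmodType R[i]) (ip : V -> V -> R[i]).

(** Only semi-definite: the form is applied to functions, not to classes modulo null sets, so
    nonzero vectors may have norm zero. *)
Definition hermitian_form : Prop :=
  [/\ forall f g h, ip (f + g) h = ip f h + ip g h,
      forall a f g, ip (a *: f) g = a * ip f g,
      forall f g, ip g f = (ip f g)^* &
      forall f, 0 <= Re (ip f f)].

Hypothesis ipP : hermitian_form.

Definition hnorm f := Num.sqrt (Re (ip f f)).

Lemma ipDl f g h : ip (f + g) h = ip f h + ip g h. Proof. by case: ipP. Qed.
Lemma ipZl a f g : ip (a *: f) g = a * ip f g. Proof. by case: ipP. Qed.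
Lemma ipC f g : ip g f = (ip f g)^*. Proof. by case: ipP. Qed.
Lemma ipDr f g h : ip f (g + h) = ip f g + ip f h.
Proof. by rewrite ipC ipDl rmorphD /= -!ipC. Qed.
Lemma ipZr a f g : ip f (a *: g) = a^* * ip f g.
Proof. by rewrite ipC ipZl rmorphM /= -ipC. Qed.
Lemma ipNl f g : ip (- f) g = - ip f g.
Proof. by rewrite -scaleN1r ipZl mulN1r. Qed.
Lemma ipNr f g : ip f (- g) = - ip f g.
Proof. by rewrite ipC ipNl rmorphN /= -ipC. Qed.
Lemma ipBl f g h : ip (f - g) h = ip f h - ip g h.
Proof. by rewrite ipDl ipNl. Qed.

Lemma hnorm_ge0 f : 0 <= hnorm f. Proof. exact: sqrtr_ge0. Qed.
Lemma hnorm_sqr f : hnorm f ^+ 2 = Re (ip f f).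
Proof. by rewrite sqr_sqrtr//; case: ipP. Qed.
Lemma ip_self f : ip f f = (hnorm f ^+ 2)%:C.
Proof.
apply: complexP; rewrite hnorm_sqr//=.
have := congr1 (@complex.Im R) (ipC f f); rewrite ImJ => /eqP.
by rewrite -addr_eq0 -mulr2n mulrn_eq0 => /eqP.
Qed.

Lemma cauchy_schwarz f g : normc (ip f g) <= hnorm f * hnorm g.
Proof.
apply: cauchy_schwarz_scalar; rewrite -?hnorm_sqr ?sqr_ge0// => t.
case: ipP => _ _ _ /(_ (f - t *: g)).
rewrite -scaleNr ipDl !ipDr !ipZl !ipZr (ip_self f) (ip_self g) (ipC f g).
by rewrite !ReImE /= normc_sqr; congr (0 <= _); ring.
Qed.

Lemma Re_ip_le f g : Re (ip f g) <= hnorm f * hnorm g.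
Proof.
exact: le_trans (le_trans (ler_norm _) (normr_Re_le _)) (cauchy_schwarz f g).
Qed.
Lemma normr_Re_ip_le f g : `|Re (ip f g)| <= hnorm f * hnorm g.
Proof. exact: le_trans (normr_Re_le _) (cauchy_schwarz f g). Qed.
Lemma normr_Im_ip_le f g : `|Im (ip f g)| <= hnorm f * hnorm g.
Proof. exact: le_trans (normr_Im_le _) (cauchy_schwarz f g). Qed.

Lemma hnormZ a f : hnorm (a *: f) = normc a * hnorm f.
Proof.
rewrite /hnorm ipZl ipZr ip_self mulrA.
have -> : Re (a * a^* * (hnorm f ^+ 2)%:C) = normc a ^+ 2 * hnorm f ^+ 2.
  by rewrite normc_sqr !ReImE /=; ring.
by rewrite -exprMn /= !sqrtr_sqr !ger0_norm ?mulr_ge0 ?normc_ge0 ?hnorm_ge0.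
Qed.

Lemma hnormN f : hnorm (- f) = hnorm f.
Proof. by rewrite /hnorm ipNl ipNr opprK. Qed.

Lemma hnormD f g : hnorm (f + g) <= hnorm f + hnorm g.
Proof.
apply: le_of_sqr_le; first by rewrite addr_ge0 ?hnorm_ge0.
rewrite hnorm_sqr ipDl !ipDr (ipC f g) !ReImE -!hnorm_sqr sqrrD.
have := Re_ip_le f g; lra.
Qed.

Section Oscillator.
Variables P X : {linear V -> V}.
Hypothesis P_sym : forall f g, ip (P f) g = ip f (P g).
Hypothesis X_sym : forall f g, ip (X f) g = ip f (X g).
Hypothesis comm : forall f, X (P f) - P (X f) = 'i *: f.

Definition oscillator (c : R[i]) f := P (P f) + c *: X (X f).

(** The commutation relation paired with [f]. In the high-energy estimate it is applied to [f] and
    to [P f], and both resulting terms have the favourable sign. *)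
Lemma Im_ipXP f : Im (ip (X f) (P f)) = - hnorm f ^+ 2 / 2.
Proof.
have h : ip f f * 'i = ip (P f) (X f) - ip (X f) (P f).
  by rewrite mulrC -ipZl -comm ipBl X_sym (P_sym (X f)).
have := congr1 (@complex.Im R) h; rewrite (ipC (X f)) ip_self !ReImE /=; lra.
Qed.

(** Makes [|P f|^2 + |X f|^2] dominate [|f|^2], so that the ladder can work with the energy
    alone. *)
Lemma uncertainty f : hnorm f ^+ 2 <= hnorm (P f) ^+ 2 + hnorm (X f) ^+ 2.
Proof.
have := normr_Im_ip_le (X f) (P f).
rewrite Im_ipXP ler_norml => /andP[h _].
have := sqr_ge0 (hnorm (P f) - hnorm (X f)); rewrite sqrrB.
lra.
Qed.

Lemma ip_oscillator c f : ip (oscillator c f) f =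
  (hnorm (P f) ^+ 2)%:C + c * (hnorm (X f) ^+ 2)%:C.
Proof. by rewrite ipDl ipZl P_sym X_sym !ip_self. Qed.

Lemma bound_of_Re_ge f h (k : R[i]) :
  hnorm f ^+ 2 <= Re (k * ip h f) -> hnorm f <= normc k * hnorm h.
Proof.
move=> le_f; apply: le_of_sqr_le_mul; rewrite ?mulr_ge0 ?normc_ge0 ?hnorm_ge0//.
apply: (le_trans le_f); rewrite -ipZl -hnormZ; exact: Re_ip_le.
Qed.

(** The numerical range of the oscillator lies in the half-plane [Re >= 0], from which [z] is at
    distance at least 1. *)
Lemma low_energy (c z : R[i]) f : 0 <= Re c -> Re z <= -1 ->
  hnorm f <= hnorm (oscillator c f - z *: f).
Proof.
move=> c0 z1; rewrite -[leRHS]mul1r -(ComplexField.Normc.normc1 R).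
apply: bound_of_Re_ge; rewrite mul1r ipBl ip_oscillator ipZl ip_self !ReImE /=.
have := sqr_ge0 (hnorm f); have := sqr_ge0 (hnorm (P f)).
have := mulr_ge0 c0 (sqr_ge0 (hnorm (X f))).
nra.
Qed.

(** The numerical range again, in the imaginary direction. The sign [s] is a parameter because the
    estimates serve both [c], in the upper half-plane, and [c^-1], in the lower one. *)
Lemma Im_below (s : R) (c z : R[i]) f : s ^+ 2 = 1 -> 0 < s * Im c ->
  s * Im z <= -1 -> hnorm f <= hnorm (oscillator c f - z *: f).
Proof.
move=> s2 c0 z1.
have <- : normc (0 -i* s) * hnorm (oscillator c f - z *: f) =
    hnorm (oscillator c f - z *: f).
  by rewrite /= expr0n add0r sqrrN s2 sqrtr1 mul1r.
apply: bound_of_Re_ge; rewrite ipBl ip_oscillator ipZl ip_self !ReImE /=.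
have := sqr_ge0 (hnorm f).
have := mulr_ge0 (ltW c0) (sqr_ge0 (hnorm (X f))).
nra.
Qed.

(** One [P] is moved to the other side and commuted past both factors: [P X^2 = X^2 P - 2 i X]. *)
Lemma ip_PP_XX f : ip (P (P f)) (X (X f)) =
  (hnorm (X (P f)) ^+ 2)%:C + 2 * 'i * ip (P f) (X f).
Proof.
have PX g : P (X g) = X (P g) - 'i *: g by rewrite -comm opprB addrC subrK.
rewrite P_sym PX PX linearB linearZ /= -X_sym -ip_self.
rewrite -addrA ipDr ipDr X_sym !ipNr !ipZr -!X_sym.
by apply: complexP; rewrite !ReImE /=; ring.
Qed.

(** Here [z] may lie deep inside the numerical range. The decisive test vector is [X (P f)]: the
    imaginary part of its pairing with [(H - z) f] contains [|P f|^2 / 2 + Re z |f|^2 / 2]. The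
    remaining terms are of lower order once [X f], [P f], [X (X f)] and [X (P f)] are bounded by
    testing against [f] and [X (X f)]. *)
Lemma high_energy (s : R) (c : R[i]) (K : R) :
  s ^+ 2 = 1 -> 0 <= Re c -> 0 < s * Im c -> 0 <= K ->
  exists L, 0 < L /\ forall z f, L <= Re z -> `|Im z| <= K ->
    hnorm f <= hnorm (oscillator c f - z *: f).
Proof.
move=> s2 c1 c2 K0.
have [L [L0 HL]] := high_energy_real c2 (normc_ge0 c) K0.
exists L; split=> // z f Lz zK; set h := oscillator c f - z *: f.
have szK : s * Im z <= K.
  apply: le_trans zK; apply: (le_trans (ler_norm _)); rewrite normrM.
  by rewrite -sqrtr_sqr s2 sqrtr1 mul1r.
have Re_le k g : normc k = 1 -> Re (k * ip h g) <= hnorm h * hnorm g.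
  move=> k1; rewrite -ipZl -[hnorm h]mul1r -k1 -hnormZ; exact: Re_ip_le.
have ns : normc (0 -i* s) = 1 by rewrite /= expr0n add0r sqrrN s2 sqrtr1.
have n1 : normc (1 : R[i]) = 1 by rewrite ComplexField.Normc.normc1.
have ni : normc (0 -i* 1 : R[i]) = 1 by rewrite /= expr0n add0r sqrrN expr1n sqrtr1.
have hf : ip h f = (hnorm (P f) ^+ 2)%:C + c * (hnorm (X f) ^+ 2)%:C - z * (hnorm f ^+ 2)%:C.
  by rewrite ipBl ip_oscillator ipZl ip_self.
have hXX : ip h (X (X f)) = (hnorm (X (P f)) ^+ 2)%:C + 2 * 'i * ip (P f) (X f)
    + c * (hnorm (X (X f)) ^+ 2)%:C - z * (hnorm (X f) ^+ 2)%:C.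
  by rewrite ipBl ipDl !ipZl ip_PP_XX -[ip f _]X_sym !ip_self.
have hXP : ip h (X (P f)) = ip (P (P f)) (X (P f)) + c * ip (X (X f)) (X (P f))
    - z * ip (X f) (P f).
  by rewrite ipBl ipDl !ipZl -[ip f _]X_sym.
have PXre : `|Re (ip (P f) (X f))| <= hnorm (P f) * hnorm (X f) by exact: normr_Re_ip_le.
have PXim : Im (ip (P f) (X f)) = hnorm f ^+ 2 / 2 by rewrite (ipC (X f)) ImJ Im_ipXP; lra.
have N0 := hnorm_ge0 f; have X0 := hnorm_ge0 (X f); have P0 := hnorm_ge0 (P f).
have H0 := hnorm_ge0 h; have XX0 := hnorm_ge0 (X (X f)).
have XP0 := hnorm_ge0 (X (P f)).
have PX0 : 0 <= hnorm (P f) * hnorm (X f) by rewrite mulr_ge0.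
have N20 := sqr_ge0 (hnorm f); have X20 := sqr_ge0 (hnorm (X f)).
have XX20 := sqr_ge0 (hnorm (X (X f))); have XP20 := sqr_ge0 (hnorm (X (P f))).
have KN : s * Im z * hnorm f ^+ 2 <= K * hnorm f ^+ 2 by rewrite ler_wpM2r.
have KX : s * Im z * hnorm (X f) ^+ 2 <= K * hnorm (X f) ^+ 2 by rewrite ler_wpM2r.
have sRe : `|s * Re (ip (P f) (X f))| <= hnorm (P f) * hnorm (X f).
  by rewrite normrM -sqrtr_sqr s2 sqrtr1 mul1r.
(* The five premises come from the imaginary and real parts against [f], the imaginary and real
   parts against [X (X f)], and the imaginary part against [X (P f)]. *)
apply: (HL (Re z) _ _ (hnorm (X f)) (hnorm (P f)) (hnorm (X (X f))) (hnorm (X (P f)))) => //.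
- have := Re_le _ f ns; rewrite hf !ReImE /=.
  nra.
- have := Re_le _ f n1; rewrite hf !ReImE /=.
  have := mulr_ge0 c1 X20; nra.
- have := Re_le _ (X (X f)) ns; rewrite hXX !ReImE /=.
  move: sRe; rewrite ler_norml => /andP[sR1 sR2].
  have s2P : s * s * hnorm (X (P f)) ^+ 2 = hnorm (X (P f)) ^+ 2 by rewrite -expr2 s2 mul1r.
  nra.
- have := Re_le _ (X (X f)) n1; rewrite hXX !ReImE /= PXim.
  have := mulr_ge0 c1 XX20.
  have := normr_Im_ip_le (P f) (X f); rewrite PXim ler_norml => /andP[_].
  nra.
- have Im_c : `|Im (c * ip (X (X f)) (X (P f)))| <=
      normc c * (hnorm (X (X f)) * hnorm (X (P f))).
    apply: le_trans (normr_Im_le _) _.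
    by rewrite ComplexField.Normc.normcM ler_wpM2l ?normc_ge0 ?cauchy_schwarz.
  have Im_z : `|Im z * Re (ip (X f) (P f))| <= K * (hnorm (P f) * hnorm (X f)).
    by rewrite normrM [leRHS]mulrCA mulrCA [_ * hnorm (X f)]mulrC ler_pM ?normr_Re_ip_le.
  have Im_PP : Im (ip (P (P f)) (X (P f))) = hnorm (P f) ^+ 2 / 2.
    by rewrite (ipC (X (P f))) ImJ Im_ipXP mulNr opprK.
  have ReN_i (w : R[i]) : Re (0 -i* 1 * w) = Im w by rewrite ReM /=; ring.
  have := Re_le _ (X (P f)) ni; rewrite hXP ReN_i.
  rewrite !ImD ImN Im_PP (ImM z) Im_ipXP.
  move: Im_c Im_z; rewrite !ler_norml => /andP[? ?] /andP[? ?].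
  have := sqr_ge0 (hnorm (P f)).
  lra.
Qed.
End Oscillator.
End HermitianForm.

(** * Far half-planes and the ladder of eigenvalues *)

Section Oscillator.
Variables (R : rcfType) (V : lmodType R[i]) (ip : V -> V -> R[i]).
Hypothesis ipP : hermitian_form ip.
Variables P X : {linear V -> V}.
Hypothesis P_sym : forall f g, ip (P f) g = ip f (P g).
Hypothesis X_sym : forall f g, ip (X f) g = ip f (X g).
Hypothesis comm : forall f, X (P f) - P (X f) = 'i *: f.
Local Notation nrm := (hnorm ip).
Local Notation H := (oscillator P X).

Lemma far_half_plane_bound (s : R) (c : R[i]) (K : R) :
  s ^+ 2 = 1 -> 0 <= Re c -> 0 < s * Im c -> 0 <= K ->
  exists rho, 0 < rho /\ forall z f, s * Im z <= K -> rho <= normc z ->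
    nrm f <= nrm (H c f - z *: f).
Proof.
move=> s2 c1 c2 K0.
have K1 : 0 <= K + 1 by lra.
have [L [L0 HL]] := high_energy ipP P_sym X_sym comm s2 c1 c2 K1.
(* When [Re z > -1], [s Im z > -1] and [Re z < L], one has [|Re z| + |Im z| <= (L + 1) + (K + 1)],
   which [|z| >= rho] excludes. *)
exists (L + K + 3); split=> [|z f zK rz]; first lra.
have [z1|z1] := lerP (Re z) (-1); first exact: (low_energy ipP P_sym X_sym).
have [z2|z2] := lerP (s * Im z) (-1).
  exact: (Im_below ipP P_sym X_sym _ s2 c2).
have zi : `|Im z| <= K + 1.
  have -> : `|Im z| = `|s * Im z| by rewrite normrM -[`|s|]sqrtr_sqr s2 sqrtr1 mul1r.
  by rewrite ler_norml; apply/andP; split; lra.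
have [z3|z3] := lerP L (Re z); first exact: HL.
have zr : `|Re z| <= L + 1 by rewrite ler_norml; apply/andP; split; lra.
have := normc_le_sum z; lra.
Qed.

Section Ladder.
Variables (q : R[i]) (e : V).
Hypothesis q0 : 0 < Re q.
(** Annihilation and creation operators. Unless [q] is real they are not adjoint to each other: the
    adjoint of [lower] is [- i P + q^* X]. *)
Let lower f := 'i *: P f + q *: X f.
Let raise f := - 'i *: P f + q *: X f.
Hypothesis lower_e : lower e = 0.
Hypothesis osc_e : H (q ^+ 2) e = q *: e.
Hypothesis lower_raise : forall f, lower (raise f) = H (q ^+ 2) f + q *: f.
Hypothesis osc_raise : forall f,
  H (q ^+ 2) (raise f) = raise (H (q ^+ 2) f + (q *+ 2) *: f).
Hypothesis decomposition : forall f, exists b k, f = b *: e + raise k.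

Let osc_linear a f g : H (q ^+ 2) (a *: f + g) = a *: H (q ^+ 2) f + H (q ^+ 2) g.
Proof.
rewrite /oscillator !linearD !linearZ /= ?scalerDr !scalerA (mulrC (q ^+ 2)).
by rewrite addrACA.
Qed.
Let raise_linear a f g : raise (a *: f + g) = a *: raise f + raise g.
Proof.
rewrite /raise !linearD !linearZ /= ?scalerDr !scalerA !(mulrC a).
by rewrite addrACA.
Qed.
Let lower_linear a f g : lower (a *: f + g) = a *: lower f + lower g.
Proof.
rewrite /lower !linearD !linearZ /= ?scalerDr !scalerA !(mulrC a).
by rewrite addrACA.
Qed.

Let energy f := Num.sqrt (nrm (P f) ^+ 2 + nrm (X f) ^+ 2).
(** In [q^-1 H = q^-1 P^2 + q X^2] both coefficients have positive real part; the smaller one is the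
    coercivity constant of the rotated oscillator. *)
Let kappa := Num.min (Re q^-1) (Re q).

Let energy_ge0 f : 0 <= energy f. Proof. exact: sqrtr_ge0. Qed.
Let energy_sqr f : energy f ^+ 2 = nrm (P f) ^+ 2 + nrm (X f) ^+ 2.
Proof. by rewrite sqr_sqrtr// addr_ge0 ?sqr_ge0. Qed.

Let q_neq0 : q != 0. Proof. by apply: contraTneq q0 => ->; rewrite ltxx. Qed.
Let nq0 : 0 < normc q. Proof. by rewrite normc_gt0. Qed.

Let kappa_gt0 : 0 < kappa.
Proof.
rewrite lt_min q0 andbT ReV divr_gt0//.
by rewrite -normc_sqr exprn_gt0.
Qed.

Let P_le f : nrm (P f) <= energy f.
Proof.
by apply: le_of_sqr_le => //; rewrite energy_sqr lerDl sqr_ge0.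
Qed.
Let X_le f : nrm (X f) <= energy f.
Proof.
by apply: le_of_sqr_le => //; rewrite energy_sqr lerDr sqr_ge0.
Qed.
Let id_le f : nrm f <= energy f.
Proof.
apply: le_of_sqr_le => //; rewrite energy_sqr; exact: (uncertainty ipP P_sym X_sym comm).
Qed.

Let normc_Ni : normc (- 'i : R[i]) = 1.
Proof. by rewrite normcE' /= oppr0 expr0n add0r sqrrN expr1n sqrtr1. Qed.

Let raise_le f : nrm (raise f) <= (1 + normc q) * energy f.
Proof.
apply: le_trans (hnormD ipP _ _) _; rewrite !(hnormZ ipP) mulrDl lerD//.
  by rewrite normc_Ni !mul1r.
by rewrite ler_wpM2l ?normc_ge0.
Qed.

Let energy_osc f :
  kappa * energy f ^+ 2 <= Re (q^-1 * ip (H (q ^+ 2) f) f).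
Proof.
rewrite (ip_oscillator ipP P_sym X_sym) energy_sqr.
rewrite (mulrDr kappa) (mulrDr q^-1) ReD [q^-1 * (q ^+ 2 * _)]mulrA.
rewrite expr2 mulKf//; apply: lerD; rewrite ReM /= mulr0 subr0 ler_wpM2r ?sqr_ge0//.
  by rewrite ge_min lexx.
by rewrite ge_min lexx orbT.
Qed.

(** Inverts [raise] with a bound. After rotation by [q^-1], [lower (raise u) = (H + q) u] is
    coercive in [u]; in the pairing of [lower h] with [u] the operator passes to [u] as its adjoint,
    which obeys the same energy bound as [raise]. *)
Let energy_lower h u : lower h = lower (raise u) ->
  energy u <= (1 + normc q) / (normc q * kappa) * nrm h.
Proof.
move=> hu; have nq := normc_ge0 q;
have nh := hnorm_ge0 ip h.
apply: le_of_sqr_le_mul => //; first by rewrite mulr_ge0// divr_ge0// ?addr_ge0// mulr_ge0// ltW.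
rewrite -(ler_pM2l (_ : 0 < normc q * kappa)) ?mulr_gt0//.
rewrite -[leLHS]mulrA; apply: le_trans (ler_wpM2l nq (energy_osc u)) _.
have le1 : Re (q^-1 * ip (H (q ^+ 2) u) u) <= Re (q^-1 * ip (lower h) u).
  rewrite hu lower_raise (ipDl ipP (H (q ^+ 2) u)) mulrDr ReD (ipZl ipP q) mulKf//.
  by rewrite (ip_self ipP) lerDl sqr_ge0.
apply: le_trans (ler_wpM2l nq le1) _.
have -> : ip (lower h) u = ip h (- 'i *: P u + q^* *: X u).
  rewrite (ipDl ipP) (ipDr ipP) !(ipZl ipP) !(ipZr ipP) P_sym X_sym.
  by congr (_ * _ + _ * _); apply: complexP; rewrite !ReImE /= ?oppr0 ?opprK.
apply: (@le_trans _ _ (nrm h * nrm (- 'i *: P u + q^* *: X u))).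
  apply: le_trans (cauchy_schwarz ipP _ _).
  rewrite -[leRHS](mulVKf (lt0r_neq0 nq0)) ler_wpM2l// -ComplexField.Normc.normcV.
  rewrite -ComplexField.Normc.normcM.
  exact: le_trans (ler_norm _) (normr_Re_le _).
rewrite (_ : _ * kappa * _ = nrm h * ((1 + normc q) * energy u)); last first.
  by field; rewrite !lt0r_neq0.
rewrite ler_wpM2l//.
apply: le_trans (hnormD ipP _ _) _; rewrite !(hnormZ ipP) mulrDl lerD//.
  by rewrite normc_Ni !mul1r.
by rewrite normcJ' ler_wpM2l ?normc_ge0.
Qed.

Let energy_resolvent (z : R[i]) (rho : R) f : normc z <= rho ->
  energy f <= (nrm (H (q ^+ 2) f - z *: f) + rho * nrm f) / (normc q * kappa).
Proof.
move=> zr; have nq := normc_ge0 q.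
have rho0 : 0 <= rho by exact: le_trans (normc_ge0 _) zr.
set u := _ - _; have nu := hnorm_ge0 ip u; have nf := hnorm_ge0 ip f.
apply: le_of_sqr_le_mul => //.
  by rewrite divr_ge0 ?addr_ge0 ?mulr_ge0// ltW.
rewrite mulrAC ler_pdivlMr ?mulr_gt0// mulrC -mulrA.
apply: le_trans (ler_wpM2l nq (energy_osc f)) _.
have -> : H (q ^+ 2) f = u + z *: f by rewrite subrK.
apply: (@le_trans _ _ (normc (ip (u + z *: f) f))).
  rewrite -[leRHS](mulVKf (lt0r_neq0 nq0)) ler_wpM2l// -ComplexField.Normc.normcV.
  rewrite -ComplexField.Normc.normcM.
  exact: le_trans (ler_norm _) (normr_Re_le _).
apply: le_trans (cauchy_schwarz ipP _ _) _; apply: ler_pM; rewrite ?hnorm_ge0//.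
apply: le_trans (hnormD ipP _ _) _; rewrite lerD2l (hnormZ ipP).
by rewrite ler_wpM2r.
Qed.

(** The start of the ladder: subtracting [z / q] with nonpositive real part preserves the coercivity
    of [q^-1 H], so no distance to the spectrum is involved. *)
Lemma base_bound (z : R[i]) f : Re (z / q) <= 0 ->
  nrm f <= (normc q * kappa)^-1 * nrm (H (q ^+ 2) f - z *: f).
Proof.
move=> zq; set u := _ - _; have nf := hnorm_ge0 ip f.
apply: le_of_sqr_le_mul => //.
  by rewrite mulr_ge0 ?hnorm_ge0 ?invr_ge0 ?mulr_ge0// ltW.
rewrite -(ler_pM2l kappa_gt0).
have f2 : nrm f ^+ 2 <= energy f ^+ 2 by rewrite ler_pXn2r ?nnegrE.
apply: le_trans (ler_wpM2l (ltW kappa_gt0) f2) _.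
apply: le_trans (energy_osc f) _.
have -> : H (q ^+ 2) f = u + z *: f by rewrite subrK.
rewrite (ipDl ipP u) mulrDr ReD (ipZl ipP) (ip_self ipP) mulrA (ReM (q^-1 * z)) /=.
rewrite mulr0 subr0 (mulrC q^-1 z).
have : Re (z / q) * nrm f ^+ 2 <= 0 by rewrite mulr_le0_ge0 ?sqr_ge0.
have -> : kappa * ((normc q * kappa)^-1 * nrm u * nrm f) = (normc q)^-1 * (nrm u * nrm f).
  by field; rewrite !lt0r_neq0.
have : Re (q^-1 * ip u f) <= (normc q)^-1 * (nrm u * nrm f).
  apply: le_trans (ler_norm _) _; apply: le_trans (normr_Re_le _) _.
  rewrite ComplexField.Normc.normcM ComplexField.Normc.normcV.
  by rewrite ler_wpM2l ?invr_ge0 ?normc_ge0 ?(cauchy_schwarz ipP).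
lra.
Qed.

(* Since [H \o raise = raise \o (H + 2 q)], writing [f = b e + raise k] turns the
   equation for [f] at [z] into one for [k] at [z - 2 q]. *)
Lemma ladder_bound (N : nat) (delta rho : R) : 0 < delta -> 0 <= rho ->
  exists M, 0 <= M /\ forall z, normc z <= rho -> Re (z / q) <= (2 * N)%:R ->
    (forall n, delta <= normc (z - q * (2 * n + 1)%:R)) ->
    forall f, nrm f <= M * nrm (H (q ^+ 2) f - z *: f).
Proof.
have nq := normc_ge0 q.
elim: N delta rho => [|N IH] delta rho d0 r0.
  exists (normc q * kappa)^-1; split.
    by rewrite invr_ge0 mulr_ge0// ltW.
  by move=> z _ zq _ f; exact: base_bound.
pose rho' := rho + 2 * normc q.
have r'0 : 0 <= rho' by rewrite addr_ge0// mulr_ge0.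
have [M' [M'0 HM']] := IH _ _ d0 r'0.
pose C1 := (1 + normc q) / (normc q * kappa).
have C10 : 0 <= C1 by rewrite divr_ge0// ?addr_ge0// mulr_ge0// ltW.
pose C2 := 1 + (1 + normc q) * C1.
have C20 : 0 <= C2 by rewrite addr_ge0// mulr_ge0// addr_ge0.
pose C3 := (1 + rho' * M') / (normc q * kappa).
have C30 : 0 <= C3.
  by rewrite divr_ge0 ?addr_ge0 ?mulr_ge0// ltW.
exists (C2 / delta + (1 + normc q) * (C3 * C1)); split.
  apply: addr_ge0; first exact: divr_ge0 (ltW d0).
  by apply: mulr_ge0; [rewrite addr_ge0|exact: mulr_ge0].
move=> z zr zq zn f; set h := _ - _.
have nh := hnorm_ge0 ip h.
have [b [k fbk]] := decomposition f.
pose z' := z - q *+ 2.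
pose u := H (q ^+ 2) k - z' *: k.
have hE : h = (b * (q - z)) *: e + raise u.
  have raiseD a : raise (H (q ^+ 2) k + a *: k) = raise (H (q ^+ 2) k) + a *: raise k.
    by rewrite addrC raise_linear addrC.
  rewrite /h fbk osc_linear osc_raise osc_e /u -!scaleNr !raiseD /z'.
  move: (raise (H (q ^+ 2) k)) (raise k) => v w.
  rewrite !scaleNr scalerDr !scalerA mulrBr !scalerBl opprB (mulrC b z) opprD.
  by rewrite [LHS]addrACA -[v + _ + _]addrA.
have z'r : normc z' <= rho'.
  apply: le_trans (le_normcD _ _) _; rewrite lerD//.
  by rewrite normcN normcMn mulr_natl.
have ku : nrm k <= M' * nrm u.
  apply: HM' => //.
    rewrite /z' mulrBl mulrnAl divff// ReD ReN /=.
    by move: zq; rewrite mulnS natrD; lra.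
  (* Eigenvalue [n] seen from [z'] is eigenvalue [n + 1] seen from [z]. *)
  move=> n; rewrite (_ : z' - _ = z - q * (2 * n.+1 + 1)%:R) ?zn//.
  rewrite /z' mulnS !natrD; ring.
(* [lower] kills the component along [e], so [u] is controlled by [h] before anything is known about
   [b]. *)
have Eu : energy u <= C1 * nrm h.
  apply: energy_lower; by rewrite hE lower_linear lower_e scaler0 add0r.
have nu : nrm u <= C1 * nrm h by apply: le_trans Eu.
have Ek : energy k <= C3 * nrm u.
  apply: le_trans (energy_resolvent k z'r) _; rewrite -/u.
  rewrite [leRHS]mulrAC ler_wpM2r//; first by rewrite invr_ge0 mulr_ge0// ltW.
  by rewrite (mulrDl 1) mul1r lerD2l -mulrA ler_wpM2l.
(* [b e] is recovered from [b (q - z) e = h - raise u]; the distance from [z] to the lowest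
   eigenvalue [q] is used at this place. *)
have ben : nrm (b *: e) <= C2 / delta * nrm h.
  have : nrm ((b * (q - z)) *: e) <= C2 * nrm h.
    rewrite (_ : _ *: e = h - raise u); last by rewrite hE addrK.
    apply: le_trans (hnormD ipP _ _) _; rewrite (hnormN ipP) (mulrDl 1) mul1r lerD2l.
    by rewrite -mulrA; apply: le_trans (raise_le u) _; rewrite ler_wpM2l// addr_ge0.
  rewrite mulrC -scalerA (hnormZ ipP) => hb.
  rewrite mulrAC ler_pdivlMr// mulrC; apply: le_trans hb.
  rewrite ler_wpM2r ?hnorm_ge0//.
  have := zn 0; rewrite muln0 add0n mulr1 -normcN opprB.
  by [].
rewrite {1}fbk; apply: le_trans (hnormD ipP _ _) _; rewrite mulrDl lerD//.
apply: le_trans (raise_le k) _; rewrite -(mulrA _ (C3 * C1)) -(mulrA C3 C1) ler_wpM2l// ?addr_ge0//.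
by apply: le_trans Ek _; rewrite ler_wpM2l.
Qed.
End Ladder.
End Oscillator.

(** * The uniform bound off the sector and the discs *)

Section Region.
Variables (R : realType) (V : lmodType R[i]) (ip : V -> V -> R[i]).
Hypothesis ipP : hermitian_form ip.
Variables P X : {linear V -> V}.
Hypothesis P_sym : forall f g, ip (P f) g = ip f (P g).
Hypothesis X_sym : forall f g, ip (X f) g = ip f (X g).
Hypothesis comm : forall f, X (P f) - P (X f) = 'i *: f.
Local Notation nrm := (hnorm ip).
Local Notation H := (oscillator P X).

(* [c^-1 H = X^2 + c^-1 P^2] is an oscillator for the canonical pair [(X, - P)]. *)
Lemma far_half_plane_bound_dual (c : R[i]) (K : R) :
  0 < Re c -> 0 < Im c -> 0 <= K ->
  exists rho, 0 < rho /\ forall z f, - K <= Im (z / c) -> rho <= normc z ->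
    normc c * nrm f <= nrm (H c f - z *: f).
Proof.
move=> c1 c2 K0.
have c0 : c != 0 by apply: contraTneq c1 => ->; rewrite ltxx.
have nc0 : 0 < normc c by rewrite normc_gt0.
have d0 : 0 < Re c ^+ 2 + Im c ^+ 2 by rewrite -normc_sqr exprn_gt0.
have s2 : (-1 : R) ^+ 2 = 1 by rewrite sqrrN expr1n.
have Rei : 0 <= Re c^-1 by rewrite ReV divr_ge0// ltW.
have Imi : 0 < -1 * Im c^-1 by rewrite mulN1r ImV mulNr opprK divr_gt0.
have XP_comm f : (\- P) (X f) - X ((\- P) f) = 'i *: f.
  by rewrite /= linearN opprK addrC comm.
have NP_sym f g : ip ((\- P) f) g = ip f ((\- P) g).
  by rewrite /= (ipNl ipP) (ipNr ipP) P_sym.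
have [rho [r0 Hr]] := far_half_plane_bound ipP X_sym NP_sym XP_comm s2 Rei Imi K0.
exists (rho * normc c); split=> [|z f zK zr]; first exact: mulr_gt0.
have -> : H c f - z *: f = c *: (oscillator X (\- P) c^-1 f - (z / c) *: f).
  rewrite scalerBr scalerDr !scalerA divff// scale1r mulrC divfK//.
  by rewrite /= linearN opprK [X in X - _]addrC.
rewrite (hnormZ ipP) ler_pM2l// Hr//; first by rewrite mulN1r lerNl.
by rewrite ComplexField.Normc.normcM ComplexField.Normc.normcV ler_pdivlMr.
Qed.

Variables (q : R[i]) (e : V).
Hypothesis Re_q : 0 < Re q.
Hypothesis Im_q : 0 < Im q.
Let lower f := 'i *: P f + q *: X f.
Let raise f := - 'i *: P f + q *: X f.
Hypothesis lower_e : lower e = 0.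
Hypothesis osc_e : H (q ^+ 2) e = q *: e.
Hypothesis lower_raise : forall f, lower (raise f) = H (q ^+ 2) f + q *: f.
Hypothesis osc_raise : forall f,
  H (q ^+ 2) (raise f) = raise (H (q ^+ 2) f + (q *+ 2) *: f).
Hypothesis decomposition : forall f, exists b k, f = b *: e + raise k.
Hypothesis Re_q2 : 0 < Re (q ^+ 2).

Let Im_q2 : 0 < Im (q ^+ 2).
Proof. by rewrite expr2 ImM mulrC -mulr2n pmulrn_lgt0// mulr_gt0. Qed.

(** [w] is the vertex of the translated sector, whose complement is the union of the two
    half-planes. Besides the bound there is a distance [d] to all eigenvalues: those with [n > m]
    lie on the axis of direction [q] inside the sector, at least [delta q] beyond the vertex, hence
    away from both edges. *)
Lemma region_bound (delta : R) (m : nat) : 0 < delta < 1 ->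
  let w := q * (2 * m.+1 + 1)%:R - delta%:C * q in
  exists M d : R, [/\ 0 <= M, 0 < d &
   forall z, Im z <= Im w \/ Im (w / q ^+ 2) <= Im (z / q ^+ 2) ->
    (forall n, (n <= m)%N -> delta <= normc (z - q * (2 * n + 1)%:R)) ->
    (forall n, d <= normc (z - q * (2 * n + 1)%:R)) /\
    forall f, nrm f <= M * nrm (H (q ^+ 2) f - z *: f)].
Proof.
move=> /andP[dl0 dl1] w; set c := q ^+ 2.
have q0 : q != 0 by apply: contraTneq Re_q => ->; rewrite ltxx.
have c0 : c != 0 by rewrite expf_neq0.
have nq : 0 < normc q by rewrite normc_gt0.
have nc : 0 < normc c by rewrite normc_gt0.
have natC n : (n%:R : R[i]) = (n%:R)%:C by rewrite rmorph_nat.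
have kq (k : R) : Im (k%:C * q) = k * Im q by rewrite ImM /= mul0r addr0.
have lam n : q * (2 * n + 1)%:R = (2 * n%:R + 1)%:C * q.
  by rewrite mulrC natC natrD natrM.
have wE : w = (2 * m.+1%:R + 1 - delta)%:C * q.
  by rewrite /w lam -mulrBl rmorphB.
have m1 : 0 <= m.+1%:R :> R by rewrite ler0n.
have qic : q / c = q^-1 by rewrite /c expr2 invfM mulrA divff// mul1r.
have Imqi : 0 < - Im q^-1.
  by rewrite ImV mulNr opprK divr_gt0// -normc_sqr exprn_gt0.
have kqc (k : R) : Im (k%:C * q / c) = k * Im q^-1.
  by rewrite -mulrA qic ImM /= mul0r addr0.
have w0 : 0 <= Im w by rewrite wE kq mulr_ge0// ?(ltW Im_q)//; lra.
have w1 : 0 <= - Im (w / c).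
  by rewrite wE kqc -mulrN mulr_ge0 ?(ltW Imqi)//; lra.
have [rho1 [r1 H1]] := far_half_plane_bound ipP P_sym X_sym comm
  (expr1n R 2) (ltW Re_q2) (eq_ind_r (fun x => 0 < x) Im_q2 (mul1r _)) w0.
have [rho2 [r2 H2]] := far_half_plane_bound_dual Re_q2 Im_q2 w1.
pose rho := rho1 + rho2.
have rho0 : 0 <= rho by rewrite addr_ge0 ?ltW.
(* The last two terms bound from below the distance of the eigenvalues with [n > m] to the edge of
   direction 1 and to the edge of direction [c]; the latter uses [q / c = q^-1]. *)
pose d := Num.min delta (Num.min (delta * Im q) (delta * - Im q^-1 * normc c)).
have d0 : 0 < d by rewrite !lt_min dl0 !mulr_gt0.
(* For [|z| < rho] one has [Re (z / q) <= rho / |q| <= N <= 2 N], so [N] rungs of the ladder are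
   enough. *)
pose N := Num.bound (rho / normc q).
have [M [M0 HM]] := ladder_bound ipP P_sym X_sym comm Re_q lower_e osc_e
  lower_raise osc_raise decomposition N d0 rho0.
exists (M + 1 + (normc c)^-1), d; split=> //.
  by rewrite !addr_ge0 ?invr_ge0 ?ler01 ?(ltW nc).
move=> z zw zn.
have zd n : d <= normc (z - q * (2 * n + 1)%:R).
  have [nm|mn] := leqP n m; first by apply: le_trans (zn _ nm); rewrite ge_min lexx.
  have mn' : m.+1%:R <= n%:R :> R by rewrite ler_nat.
  case: zw => zw.
    apply: le_trans (normr_Im_le _); rewrite -normrN; apply: le_trans (ler_norm _).
    apply: (@le_trans _ _ (delta * Im q)); first by rewrite /d !ge_min lexx orbT.
    rewrite wE kq in zw; rewrite lam ImD ImN kq opprD opprK addrC.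
    have := ler_wpM2r (ltW Im_q) mn'; lra.
  apply: (@le_trans _ _ (delta * - Im q^-1 * normc c)).
    by rewrite /d !ge_min lexx !orbT.
  rewrite -ler_pdivlMr// -ComplexField.Normc.normcV -ComplexField.Normc.normcM.
  apply: le_trans (normr_Im_le _); apply: le_trans (ler_norm _).
  rewrite wE kqc in zw; rewrite lam mulrBl ImD ImN kqc.
  have := ler_wpM2r (ltW Imqi) mn'; lra.
split=> // f; set h := _ - _.
have nh := hnorm_ge0 ip h.
have ic0 : 0 <= (normc c)^-1 by rewrite invr_ge0 ltW.
have bM k : 0 <= k -> nrm f <= k * nrm h -> k <= M + 1 + (normc c)^-1 ->
    nrm f <= (M + 1 + (normc c)^-1) * nrm h.
  by move=> k0 fk kM; apply: le_trans fk _; rewrite ler_wpM2r.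
have [zr|zr] := lerP rho (normc z).
  case: zw => zw.
    apply: (bM 1) => //; last by lra.
    by rewrite mul1r; apply: H1; rewrite ?mul1r//; apply: le_trans zr; rewrite lerDl ltW.
  apply: (bM (normc c)^-1) => //; last by lra.
  rewrite mulrC ler_pdivlMr// mulrC; apply: H2; first by rewrite opprK.
  by apply: le_trans zr; rewrite lerDr ltW.
apply: (bM M) => //; last by lra.
apply: HM => //; first exact: ltW.
apply: le_trans (ler_norm _) _; apply: le_trans (normr_Re_le _) _.
rewrite ComplexField.Normc.normcM ComplexField.Normc.normcV.
apply: (@le_trans _ _ (rho / normc q)).
  by rewrite ler_wpM2r ?invr_ge0 ?ltW.
apply: (@le_trans _ _ N%:R); last by rewrite ler_nat leq_pmull.
by apply: ltW; apply: archi_boundP; rewrite divr_ge0// ltW.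
Qed.

End Region.

(** * Density in a complete space *)

Section HalfPowers.
Variable R : realType.

Lemma half_pow_gt0 n : 0 < 2^-1 ^+ n :> R.
Proof. by rewrite exprn_gt0// invr_gt0. Qed.

Lemma half_pow_ge0 n : 0 <= 2^-1 ^+ n :> R.
Proof. exact: ltW (half_pow_gt0 n). Qed.

Lemma half_pow_le (e : R) : 0 < e -> exists n, 2^-1 ^+ n <= e.
Proof.
move=> e0; pose n := Num.bound e^-1; exists n.
have en : e^-1 < n%:R by apply: archi_boundP; rewrite invr_ge0 ltW.
rewrite exprVn -[e]invrK lef_pV2 ?posrE ?invr_gt0 ?exprn_gt0//.
by apply: (le_trans (ltW en)); rewrite -natrX ler_nat ltnW// ltn_expl.
Qed.

Lemma le0_of_half_pow (x C : R) : (forall n, x <= C * 2^-1 ^+ n) -> x <= 0.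
Proof.
move=> xC; rewrite leNgt; apply/negP => x0.
have C0 : 0 < C by have := xC 0%N; rewrite expr0 mulr1; exact: lt_le_trans.
have [n nx] := @half_pow_le (x / C / 2) (divr_gt0 (divr_gt0 x0 C0) (ltr0Sn _ 1)).
have := xC n; rewrite leNgt => /negP; apply.
rewrite mulrC -ltr_pdivlMr//; apply: le_lt_trans nx _.
have : 0 < x / C by rewrite divr_gt0.
lra.
Qed.

End HalfPowers.

Section Density.
Variables (R : realType) (V : lmodType R[i]) (ip : V -> V -> R[i]).
Hypothesis ipP : hermitian_form ip.
Local Notation nrm := (hnorm ip).

(** Completeness for sequences with geometric increments, with an explicit rate for the limit; the
    limits of vectors constructed below are taken along such sequences. *)
Definition rapidly_complete := forall u : nat -> V,
  (forall n, nrm (u n.+1 - u n) <= 2^-1 ^+ n) ->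
  exists f, forall n, nrm (f - u n) <= 2 * 2^-1 ^+ n.

Hypothesis completeV : rapidly_complete.
Variables (W : lmodType R[i]) (iota : {linear W -> V}).
Hypothesis orthogonal0 : forall v, (forall w, ip v (iota w) = 0) -> nrm v = 0.

Lemma parallelogram f g :
  nrm (f - g) ^+ 2 = 2 * nrm f ^+ 2 + 2 * nrm g ^+ 2 - nrm (f + g) ^+ 2.
Proof.
rewrite !(hnorm_sqr ipP) !(ipDl ipP) !(ipDr ipP) !(ipNl ipP) !(ipNr ipP).
by rewrite !ReImE; ring.
Qed.

(** The projection argument. A minimizing sequence for the distance from [v] to the range of [iota]
    is rapidly Cauchy by the parallelogram law, and [v] minus its limit is orthogonal to the range,
    hence null. The limit need not lie in the range, so the conclusion is an approximation. *)
Lemma dense_of_orthogonal v (eps : R) : 0 < eps -> exists w, nrm (v - iota w) <= eps.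
Proof.
move=> eps0.
pose S := [set nrm (v - iota w) ^+ 2 | w in [set: W]].
have S0 : has_inf S.
  split; first by exists (nrm (v - iota 0) ^+ 2); exists 0.
  by exists 0 => _ [w _ <-]; rewrite sqr_ge0.
pose d := inf S.
have dle w : d <= nrm (v - iota w) ^+ 2.
  by apply: ge_inf; [case: S0|exists w].
(* [eta n] is [4 ^ (- (n + 1))]: the parallelogram law bounds the squared increment by
   [2 eta_n + 2 eta_(n+1) <= 4 eta_n], the square of [2 ^ (- n)]. *)
pose eta n : R := (2^-1 ^+ n.+1) ^+ 2.
have eta0 n : 0 < eta n by rewrite exprn_gt0// half_pow_gt0.
have /choice[w wP] : forall n, exists w, nrm (v - iota w) ^+ 2 <= d + eta n.
  move=> n; have [_ [w _ <-] wd] := @inf_adherent _ _ (eta n) (eta0 n) S0.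
  by exists w; exact: ltW.
have etaS n : eta n.+1 <= eta n.
  rewrite ler_pXn2r ?nnegrE ?half_pow_ge0//.
  rewrite [leLHS]exprS ler_piMl ?half_pow_ge0//; lra.
have rapid n : nrm (iota (w n.+1) - iota (w n)) <= 2^-1 ^+ n.
  apply: le_of_sqr_le; first exact: ltW (half_pow_gt0 _ _).
  have -> : iota (w n.+1) - iota (w n) = (v - iota (w n)) - (v - iota (w n.+1)).
    by rewrite opprB [RHS]addrC addrA subrK.
  rewrite parallelogram.
  have -> : v - iota (w n) + (v - iota (w n.+1)) =
      2 *: (v - iota (2^-1 *: (w n + w n.+1))).
    rewrite linearZ linearD /= scalerBr scalerA divff ?pnatr_eq0// scale1r.
    by rewrite scaler_nat mulr2n opprD addrACA.
  rewrite (hnormZ ipP) exprMn.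
  have -> : normc (2 : R[i]) ^+ 2 = 4.
    by rewrite normc_sqr (_ : (2 : R[i]) = 2%:C) /= ?rmorph_nat// expr0n addr0; ring.
  have := dle (2^-1 *: (w n + w n.+1)); have := wP n; have := wP n.+1.
  have := etaS n.
  have : 4 * eta n = (2^-1 ^+ n) ^+ 2 by rewrite /eta [2^-1 ^+ n.+1]exprS exprMn; field.
  lra.
have [s sP] := completeV rapid.
have orth : nrm (v - s) = 0.
  apply: orthogonal0 => w'.
  apply/eqP; rewrite -normc_eq0' eq_le normc_ge0 andbT.
  apply: (@le0_of_half_pow _ _ (3 * nrm (iota w'))) => n.
  have -> : v - s = (v - iota (w n)) - (s - iota (w n)).
    by rewrite opprB addrA subrK.
  rewrite (ipBl ipP).
  apply: le_trans (le_normcD _ _) _; rewrite normcN.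
  have h1 : normc (ip (v - iota (w n)) (iota w')) <= 2^-1 ^+ n * nrm (iota w').
    have B0 : 0 <= Re (ip (iota w') (iota w')) by case: ipP.
    have A0 : 0 <= nrm (v - iota (w n)) ^+ 2 - d by rewrite subr_ge0.
    apply: (@le_trans _ _ (Num.sqrt (nrm (v - iota (w n)) ^+ 2 - d) * nrm (iota w'))).
      (* That [d] is a lower bound at each [w n + t w'] is the required quadratic inequality in [t];
         the excess over [d] replaces a squared norm. *)
      apply: cauchy_schwarz_scalar => // t.
      have := dle (w n + t *: w'); rewrite linearD linearZ /= opprD addrA.
      move: (v - iota (w n)) => a.
      rewrite -scaleNr !(hnorm_sqr ipP) (ipDl ipP) !(ipDr ipP) !(ipZl ipP) !(ipZr ipP).
      rewrite !(ip_self ipP (iota w')) (ipC ipP _ (iota w')).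
      rewrite -subr_ge0 !ReImE /= normc_sqr; congr (0 <= _); ring.
    rewrite ler_wpM2r ?hnorm_ge0//.
    rewrite -[leRHS]ger0_norm ?half_pow_ge0// -sqrtr_sqr ler_wsqrtr//.
    have := wP n; have : eta n <= (2^-1 ^+ n) ^+ 2; last lra.
    rewrite ler_pXn2r ?nnegrE ?half_pow_ge0//.
    rewrite [leLHS]exprS ler_piMl ?half_pow_ge0//; lra.
  have h2 : normc (ip (s - iota (w n)) (iota w')) <= 2 * 2^-1 ^+ n * nrm (iota w').
    apply: le_trans (cauchy_schwarz ipP _ _) _.
    by rewrite ler_wpM2r ?hnorm_ge0.
  lra.
have [n nP] := @half_pow_le _ (eps / 2) (divr_gt0 eps0 (ltr0Sn _ 1)).
exists (w n).
have -> : v - iota (w n) = (v - s) + (s - iota (w n)) by rewrite addrA subrK.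
apply: le_trans (hnormD ipP _ _) _; rewrite orth add0r.
apply: le_trans (sP n) _; lra.
Qed.
End Density.

(** * The space of square integrable functions *)

Section SquareIntegrable.
Variable R : realType.
Local Notation mu := (@lebesgue_measure R).
Implicit Types f g u v : R -> R.

Lemma Lfun2P f : f \in Lfun mu 2%:E <->
  measurable_fun setT f /\ mu.-integrable setT (EFin \o (fun x => f x ^+ 2)).
Proof.
split=> [fL|[mf iF]].
  split; last exact: Lfun2_integrable_sqr.
  by move: fL; rewrite inE => /andP[]; rewrite inE.
rewrite inE; apply/andP; split; rewrite inE //= /finite_norm unlock poweR_lty//.
move/integrableP: iF => [_]; apply: le_lt_trans.
rewrite le_eqVlt; apply/orP; left; apply/eqP.
apply: eq_integral => x _ /=.
by rewrite powR_mulrn// real_normK ?num_real// ger0_norm ?sqr_ge0.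
Qed.

Lemma Lfun2_ext f g : f \in Lfun mu 2%:E -> f =1 g -> g \in Lfun mu 2%:E.
Proof. by move=> fL /funext <-. Qed.

Lemma integrable_ext f g : mu.-integrable setT (EFin \o f) -> f =1 g ->
  mu.-integrable setT (EFin \o g).
Proof. by move=> fL /funext <-. Qed.

Lemma integrable_add f g : mu.-integrable setT (EFin \o f) ->
  mu.-integrable setT (EFin \o g) ->
  mu.-integrable setT (EFin \o (fun x => f x + g x)).
Proof. by move=> fi gi; exact: (integrableD measurableT fi gi). Qed.

Lemma integrable_sub f g : mu.-integrable setT (EFin \o f) ->
  mu.-integrable setT (EFin \o g) ->
  mu.-integrable setT (EFin \o (fun x => f x - g x)).
Proof. by move=> fi gi; exact: (integrableB measurableT fi gi). Qed.

Lemma integrable_scale a f : mu.-integrable setT (EFin \o f) ->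
  mu.-integrable setT (EFin \o (fun x => a * f x)).
Proof. by move=> fi; exact: (integrableZl measurableT a fi). Qed.

Lemma Lfun2_measurable f : f \in Lfun mu 2%:E -> measurable_fun setT f.
Proof. by move=> /Lfun2P[]. Qed.

Lemma Lfun2_dominated f g : measurable_fun setT f -> g \in Lfun mu 2%:E ->
  (forall x, `|f x| <= `|g x|) -> f \in Lfun mu 2%:E.
Proof.
move=> mf /Lfun2P[mg ig] fg; apply/Lfun2P; split => //.
apply: le_integrable ig => //.
  by apply/measurable_EFinP; apply: measurable_funX.
move=> x _ /=; rewrite lee_fin !ger0_norm ?sqr_ge0//.
by rewrite -[f x ^+ 2]real_normK ?num_real// -[g x ^+ 2]real_normK ?num_real// ler_pXn2r ?nnegrE.
Qed.

Lemma Lfun2D f g : f \in Lfun mu 2%:E -> g \in Lfun mu 2%:E ->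
  (fun x => f x + g x) \in Lfun mu 2%:E.
Proof.
have p1 : (1 <= 2%:E :> \bar R)%E by rewrite lee_fin; lra.
have [_ LD] := Lfun_addr_closed mu p1; exact: LD.
Qed.

Lemma Lfun2Z a f : f \in Lfun mu 2%:E -> (fun x => a * f x) \in Lfun mu 2%:E.
Proof.
move=> fL; have p1 : (1 <= 2 :> R) by lra.
by apply: (Lfun2_ext (Lfun_scale a p1 fL)) => x /=; rewrite mulrC.
Qed.

Lemma Lfun2_mul_integrable f g : f \in Lfun mu 2%:E -> g \in Lfun mu 2%:E ->
  mu.-integrable setT (EFin \o (fun x => f x * g x)).
Proof. by move=> fL gL; apply/Lfun1_integrable; exact: Lfun2_mul_Lfun1. Qed.

Lemma RintegralN' f : mu.-integrable setT (EFin \o f) ->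
  \int[mu]_x (- f x) = - \int[mu]_x f x.
Proof.
move=> fi; rewrite -mulN1r -RintegralZl//.
by apply: eq_Rintegral => x _; rewrite mulN1r.
Qed.

End SquareIntegrable.

(** * Integrals and inner products of complex functions *)

Section ComplexIntegral.
Variable R : realType.
Local Notation mu := (@lebesgue_measure R).
Local Notation fct := (R -> R[i]).
Implicit Types f g h : fct.

Definition Cintegrable f := mu.-integrable setT (EFin \o (fun x => Re (f x))) /\
  mu.-integrable setT (EFin \o (fun x => Im (f x))).

Lemma eq_Cintegral f g : f =1 g -> Cintegral f = Cintegral g.
Proof. by move=> /funext ->. Qed.

Lemma CintegralD f g : Cintegrable f -> Cintegrable g ->
  Cintegral (fun x => f x + g x) = Cintegral f + Cintegral g.
Proof.
move=> [f1 f2] [g1 g2]; apply: complexP; rewrite ?ReD ?ImD /= -RintegralD//.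
  by apply: eq_Rintegral => x _; rewrite ReD.
by apply: eq_Rintegral => x _; rewrite ImD.
Qed.

Lemma CintegrableZ a f : Cintegrable f -> Cintegrable (fun x => a * f x).
Proof.
move=> [f1 f2]; split.
  by apply: (integrable_ext (integrable_sub (integrable_scale (Re a) f1)
    (integrable_scale (Im a) f2))) => x /=; rewrite ReM.
by apply: (integrable_ext (integrable_add (integrable_scale (Re a) f2)
    (integrable_scale (Im a) f1))) => x /=; rewrite ImM.
Qed.

Lemma CintegralZ a f : Cintegrable f ->
  Cintegral (fun x => a * f x) = a * Cintegral f.
Proof.
move=> [f1 f2]; have iZ := @integrable_scale R.
apply: complexP; rewrite ?ReM ?ImM /= -?RintegralZl//.
  rewrite -RintegralB//; last 2 first.
  - exact: iZ f1.
  - exact: iZ f2.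
  by apply: eq_Rintegral => x _; rewrite ReM.
rewrite -RintegralD//; last 2 first.
- exact: iZ f2.
- exact: iZ f1.
by apply: eq_Rintegral => x _; rewrite ImM.
Qed.

Lemma CintegralJ f : Cintegrable f -> Cintegral (fun x => (f x)^*) = (Cintegral f)^*.
Proof.
move=> [f1 f2]; apply: complexP; rewrite ?ReJ ?ImJ /= -?RintegralN'//;
 by apply: eq_Rintegral => x _; rewrite ?ReJ ?ImJ.
Qed.

Lemma CintegralN f : Cintegrable f -> Cintegral (fun x => - f x) = - Cintegral f.
Proof.
by move=> fi; rewrite -mulN1r -CintegralZ//; apply: eq_Cintegral => x; rewrite mulN1r.
Qed.

Lemma CintegralB f g : Cintegrable f -> Cintegrable g ->
  Cintegral (fun x => f x - g x) = Cintegral f - Cintegral g.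
Proof.
move=> fi gi; rewrite CintegralD//; first by rewrite CintegralN.
rewrite (_ : (fun x => - g x) = (fun x => -1 * g x)); first exact: CintegrableZ.
by apply/funext => x; rewrite mulN1r.
Qed.

Lemma L2D f g : L2 f -> L2 g -> L2 (fun x => f x + g x).
Proof.
move=> [f1 f2] [g1 g2]; split.
  by apply: (Lfun2_ext (Lfun2D f1 g1)) => x /=; rewrite ReD.
by apply: (Lfun2_ext (Lfun2D f2 g2)) => x /=; rewrite ImD.
Qed.

Lemma L2Z a f : L2 f -> L2 (fun x => a * f x).
Proof.
move=> [f1 f2]; split.
  by apply: (Lfun2_ext (Lfun2D (Lfun2Z (Re a) f1) (Lfun2Z (- Im a) f2))) => x /=; rewrite ReM mulNr.
by apply: (Lfun2_ext (Lfun2D (Lfun2Z (Re a) f2) (Lfun2Z (Im a) f1))) => x /=; rewrite ImM.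
Qed.

Lemma L2J f : L2 f -> L2 (fun x => (f x)^*).
Proof.
move=> [f1 f2]; split.
  by apply: (Lfun2_ext f1) => x /=; rewrite ReJ.
by apply: (Lfun2_ext (Lfun2Z (-1) f2)) => x /=; rewrite ImJ mulN1r.
Qed.

Lemma L2_real (u : R -> R) : u \in Lfun mu 2%:E -> L2 (fun x => (u x)%:C).
Proof.
move=> uL; split; first exact: (Lfun2_ext uL).
by apply: (Lfun2_ext (Lfun2Z 0 uL)) => x /=; rewrite mul0r.
Qed.

Lemma L2_cst0 : L2 (fun _ : R => 0 : R[i]).
Proof.
apply: (@L2_real (cst 0)); apply/Lfun2P; split => //.
apply: (eq_integrable measurableT (cst 0%E)); last exact: integrable0.
by move=> x _ /=; rewrite expr0n.
Qed.

Lemma L2_mul f g : L2 f -> L2 g -> Cintegrable (fun x => f x * g x).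
Proof.
move=> [f1 f2] [g1 g2]; split.
  by apply: (integrable_ext (integrable_sub (Lfun2_mul_integrable f1 g1)
    (Lfun2_mul_integrable f2 g2))) => x /=; rewrite ReM.
by apply: (integrable_ext (integrable_add (Lfun2_mul_integrable f1 g2)
    (Lfun2_mul_integrable f2 g1))) => x /=; rewrite ImM.
Qed.

Lemma L2_mulJ f g : L2 f -> L2 g -> Cintegrable (fun x => f x * (g x)^*).
Proof. by move=> fL gL; apply: (L2_mul fL (L2J gL)). Qed.

Lemma L2innerDl f g h : L2 f -> L2 g -> L2 h ->
  L2inner (fun x => f x + g x) h = L2inner f h + L2inner g h.
Proof.
move=> fL gL hL; rewrite /L2inner -CintegralD//; [|exact: L2_mulJ..].
by apply: eq_Cintegral => x; rewrite mulrDl.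
Qed.

Lemma L2innerZl a f g : L2 f -> L2 g ->
  L2inner (fun x => a * f x) g = a * L2inner f g.
Proof.
move=> fL gL; rewrite /L2inner -CintegralZ//; [|exact: L2_mulJ..].
by apply: eq_Cintegral => x; rewrite mulrA.
Qed.

Lemma L2innerC f g : L2 f -> L2 g -> L2inner g f = (L2inner f g)^*.
Proof.
move=> fL gL; rewrite /L2inner -CintegralJ//; [|exact: L2_mulJ..].
by apply: eq_Cintegral => x; apply: complexP; rewrite !ReImE; ring.
Qed.

Lemma Re_L2inner_self f : Re (L2inner f f) = \int[mu]_x (normc (f x) ^+ 2).
Proof.
by rewrite /=; apply: eq_Rintegral => x _; rewrite normc_sqr !ReImE; ring.
Qed.

Lemma Re_L2inner_ge0 f : 0 <= Re (L2inner f f).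
Proof. by rewrite Re_L2inner_self; apply: Rintegral_ge0 => x _; rewrite sqr_ge0. Qed.

Lemma L2normE f : L2norm f = Num.sqrt (Re (L2inner f f)).
Proof. by rewrite Re_L2inner_self. Qed.

Lemma L2_sqr_integrable f : L2 f -> mu.-integrable setT (EFin \o (fun x => normc (f x) ^+ 2)).
Proof.
move=> fL; have [fi _] := L2_mulJ fL fL; apply: (integrable_ext fi) => x /=.
by rewrite normc_sqr !ReImE; ring.
Qed.

End ComplexIntegral.

(** * Square integrable functions as a module *)

Section L2Space.
Variable R : realType.
Local Notation fct := (R -> R[i]^o).

Definition L2fun : {pred fct} := fun f : fct => `[< @L2 R f >].

Fact L2fun_submod_closed : submod_closed L2fun.
Proof.
split; first by apply/asboolP; exact: L2_cst0.
move=> a f g /asboolP fL /asboolP gL; apply/asboolP.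
by apply: (L2D (L2Z a fL) gL).
Qed.

HB.instance Definition _ := GRing.isSubmodClosed.Build _ _ L2fun L2fun_submod_closed.

(** Functions rather than classes, in keeping with the definitions: equality of elements is
    pointwise, while equality in L^2 is a vanishing norm of the difference. *)
Record L2T := MkL2T { L2val :> fct; _ : L2val \in L2fun }.
HB.instance Definition _ := [isSub of L2T for L2val].
HB.instance Definition _ := [Choice of L2T by <:].
HB.instance Definition _ := [SubChoice_isSubLmodule of L2T by <:].

Lemma L2TP (f : L2T) : @L2 R f. Proof. by case: f => f /= /asboolP. Qed.

Definition toL2 (f : R -> R[i]) (fL : L2 f) : L2T := MkL2T (asboolT fL).

Definition L2ip (f g : L2T) : R[i] := L2inner f g.

Lemma L2ipP : hermitian_form L2ip.
Proof.
split.
- by move=> f g h; apply: L2innerDl; exact: L2TP.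
- by move=> a f g; exact (L2innerZl a (L2TP f) (L2TP g)).
- by move=> f g; apply: L2innerC; exact: L2TP.
- by move=> f; exact: Re_L2inner_ge0.
Qed.

Lemma L2normT (f : L2T) : L2norm f = hnorm L2ip f.
Proof. by rewrite L2normE. Qed.

End L2Space.

(** * Completeness of L^2 *)

Section Completeness.
Variable R : realType.
Local Notation mu := (@lebesgue_measure R).
Implicit Types f g : R -> R.

Definition sqint f : \bar R := (\int[mu]_x ((f x) ^+ 2)%:E)%E.

Lemma fatou_sqint (h : nat -> R -> R) f (K : R) :
  (forall m, measurable_fun setT (h m)) ->
  (forall x, h m x @[m --> \oo] --> f x) ->
  (\forall m \near \oo, (sqint (h m) <= K%:E)%E) ->
  measurable_fun setT f /\ (sqint f <= K%:E)%E.
Proof.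
move=> mh hf hK.
have mf : measurable_fun setT f by apply: measurable_fun_cvg => // x _; exact: hf.
split=> //.
have mh2 m : measurable_fun setT (fun x => ((h m x) ^+ 2)%:E).
  by apply/measurable_EFinP; exact: measurable_funX.
have := fatou mu measurableT mh2; have h0 : forall n x, setT x -> (0 <= (h n x ^+ 2)%:E)%E.
  by move=> n x _; rewrite lee_fin sqr_ge0.
move=> /(_ h0).
have -> : (\int[mu]_x limn_einf (fun n => ((h n x) ^+ 2)%:E) = sqint f)%E.
  apply: eq_integral => x _.
  have hx : ((h n x) ^+ 2)%:E @[n --> \oo] --> ((f x) ^+ 2)%:E.
    by apply: cvg_EFin; [exact: nearW|apply: cvgM; exact: hf].
  by have [-> _] := cvg_limn_einf_sup hx.
move=> /le_trans; apply.
rewrite limn_einf_lim; apply: lime_le; first exact: is_cvg_einfs.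
near=> m; apply: (@le_trans _ _ (sqint (h m))); last by near: m.
by apply: ereal_inf_lbound; exists m => //=.
Unshelve. all: by end_near. Qed.

Lemma Lfun2_sqint f : f \in Lfun mu 2%:E <->
  measurable_fun setT f /\ (sqint f < +oo)%E.
Proof.
have eqa : (\int[mu]_x `|((f x) ^+ 2)%:E| = sqint f)%E.
  by apply: eq_integral => x _ /=; rewrite ger0_norm ?sqr_ge0.
split=> [/Lfun2P[mf /integrableP[_]]|[mf fy]].
  by rewrite /= -eqa.
apply/Lfun2P; split=> //; apply/integrableP; split.
  by apply/measurable_EFinP; exact: measurable_funX.
by rewrite /= eqa.
Qed.

Lemma geometric_bound n : \sum_(0 <= k < n) (9 / 16) ^+ k <= 16 / 7 :> R.
Proof.
have -> : \sum_(0 <= k < n) (9 / 16) ^+ k = 16 / 7 * (1 - (9 / 16) ^+ n) :> R.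
  elim: n => [|n IH]; first by rewrite big_geq// expr0 subrr mulr0.
  by rewrite big_nat_recr//= IH exprS; field.
have : 0 <= (9 / 16) ^+ n :> R by rewrite exprn_ge0//; lra.
lra.
Qed.

(** The series of [(9/4)^n (u_(n+1) - u_n)^2] has a finite integral, its terms decaying like
    [(9/16)^n]. Where the sum is finite, increments are at most a multiple of [(2/3)^n], which is
    summable, so the sequence converges almost everywhere; Fatou's lemma gives the rate. *)
Lemma L2_real_complete (u : nat -> R -> R) :
  (forall n, u n \in Lfun mu 2%:E) ->
  (forall n, (sqint (fun x => u n.+1 x - u n x)%R <= ((2^-1 ^+ n) ^+ 2)%:E)%E) ->
  (forall n m, (n <= m)%N ->
    (sqint (fun x => u m x - u n x)%R <= ((2 * 2^-1 ^+ n) ^+ 2)%:E)%E) ->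
  exists f, f \in Lfun mu 2%:E /\
    forall n, (sqint (fun x => f x - u n x)%R <= ((2 * 2^-1 ^+ n) ^+ 2)%:E)%E.
Proof.
move=> uL u1 u2.
have mu_ n : measurable_fun setT (u n) by exact: Lfun2_measurable.
pose d n x := u n.+1 x - u n x.
have md n : measurable_fun setT (d n) by exact: measurable_funB.
pose S x := (\sum_(0 <= n <oo) ((9 / 4) ^+ n * (d n x) ^+ 2)%:E)%E.
have t0 n x : 0 <= (9 / 4) ^+ n * (d n x) ^+ 2 :> R.
  by rewrite mulr_ge0 ?sqr_ge0// exprn_ge0//; lra.
have mt n : measurable_fun setT (fun x => ((9 / 4) ^+ n * (d n x) ^+ 2)%:E).
  apply/measurable_EFinP; apply: measurable_funM => //.
  by apply: measurable_funX; exact: measurable_funB.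
have mS : measurable_fun setT S by apply: ge0_emeasurable_sum => // n x _ _; rewrite lee_fin.
have S0 x : (0 <= S x)%E by apply: nneseries_ge0 => n _ _; rewrite lee_fin.
have iS : (\int[mu]_x S x < +oo)%E.
  rewrite integral_nneseries//; last by move=> n x _; rewrite lee_fin.
  apply: (@le_lt_trans _ _ ((16 / 7)%:E)%E); last exact: ltry.
  apply: lime_le.
    by apply: is_cvg_nneseries => n _ _; apply: integral_ge0 => x _; rewrite lee_fin.
  apply: nearW => n.
  apply: (@le_trans _ _ (\sum_(0 <= k < n) ((9 / 16) ^+ k)%:E)%E); last first.
    by rewrite sumEFin lee_fin geometric_bound.
  apply: lee_sum => k _.
  under eq_integral do rewrite EFinM.
  have k0 : 0 <= (9 / 4) ^+ k :> R by rewrite exprn_ge0//; lra.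
  rewrite ge0_integralZl//; last 2 first.
  - by apply/measurable_EFinP; exact: (measurable_funX _ (md k)).
  - by move=> x _; rewrite lee_fin sqr_ge0.
  apply: le_trans (lee_wpmul2l _ (u1 k)) _; first by rewrite lee_fin.
  rewrite -EFinM lee_fin -exprM mulnC exprM -exprMn.
  by rewrite (_ : 9 / 4 * 2^-1 ^+ 2 = 9 / 16)//; field.
have iSS : mu.-integrable setT S.
  by apply/integrableP; split => //; under eq_integral do rewrite gee0_abs//.
pose D := [set x | (S x < +oo)%E].
have mD : measurable D.
  by rewrite -[D]setTI; exact: emeasurable_fun_infty_o.
have aeD : \forall x \ae mu, D x.
  have := integrable_ae measurableT iSS; apply: filterS => x /(_ I).
  by rewrite /D /= ge0_fin_numE.
(* Off [D] the sequence may diverge; setting it to 0 there gives convergence at every point, and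
   with it a measurable limit. *)
pose v n x := u n x * \1_D x.
have mv n : measurable_fun setT (v n) by apply: measurable_funM => //; exact: measurable_indic.
have cv x : cvgn (fun n => v n x).
  have [Dx|Dx] := pselect (D x); last first.
    rewrite (_ : (fun n => v n x) = cst 0); first exact: is_cvg_cst.
    by apply/funext => n; rewrite /v indicE memNset//= mulr0.
  have vE n : v n x = u n x by rewrite /v indicE mem_set// mulr1.
  rewrite (_ : (fun n => v n x) = u^~ x); last by apply/funext.
  have Sfin : S x = (fine (S x))%:E by rewrite fineK// ge0_fin_numE.
  have s0 : 0 <= fine (S x) by rewrite fine_ge0.
  have dn n : `|d n x| <= Num.sqrt (fine (S x)) * (2 / 3) ^+ n.
    have r0 : 0 < (9 / 4) ^+ n :> R by rewrite exprn_gt0//; lra.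
    have r1 : 0 <= (2 / 3) ^+ n :> R by rewrite exprn_ge0//; lra.
    rewrite -(ler_pXn2r (_ : 0 < 2)%N) ?nnegrE ?mulr_ge0 ?sqrtr_ge0//.
    rewrite real_normK ?num_real// exprMn sqr_sqrtr// -exprM mulnC exprM.
    rewrite (_ : (2 / 3) ^+ 2 = (9 / 4)^-1 :> R); last by field.
    rewrite exprVn ler_pdivlMr// mulrC -lee_fin -Sfin.
    apply: le_trans (nneseries_lim_ge n.+1 _); last by move=> k _ _; rewrite lee_fin.
    rewrite big_nat_recr//= leeDr// sume_ge0// => k _.
    by rewrite lee_fin.
  have uE : u^~ x = (fun n => u 0%N x + series (d^~ x) n).
    by apply/funext => n; rewrite [LHS](eq_sum_telescope (u^~ x)).
  rewrite uE; apply: is_cvgD; first exact: is_cvg_cst.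
  apply: normed_cvg.
  apply: (@series_le_cvg _ _ (geometric (Num.sqrt (fine (S x))) (2 / 3))) => //.
  - by move=> n; exact: normr_ge0.
  - by move=> n; apply: mulr_ge0; [exact: sqrtr_ge0|apply: exprn_ge0; lra].
  - by apply: is_cvg_geometric_series; rewrite ger0_norm; lra.
pose f x := limn (fun n => v n x).
have fv x : v n x @[n --> \oo] --> f x by exact: cv.
have le_uv n m x : (v m x - v n x) ^+ 2 <= (u m x - u n x) ^+ 2.
  by rewrite /v -mulrBl exprMn ler_piMr ?sqr_ge0//.
have mf : measurable_fun setT f by apply: (@measurable_fun_cvg _ _ _ _ v) => // x _; exact: fv.
have mfu n : measurable_fun setT (fun x => f x - u n x) by exact: measurable_funB.
have mfv n : measurable_fun setT (fun x => f x - v n x) by exact: measurable_funB.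
have mvv n m : measurable_fun setT (fun x => v m x - v n x) by exact: measurable_funB.
have muu n m : measurable_fun setT (fun x => u m x - u n x) by exact: measurable_funB.
have key n : (sqint (fun x => f x - u n x)%R <= ((2 * 2^-1 ^+ n) ^+ 2)%:E)%E.
  have -> : sqint (fun x => f x - u n x)%R = sqint (fun x => f x - v n x)%R.
    apply: ae_eq_integral => //.
    - by apply/measurable_EFinP; exact: (measurable_funX _ (mfu n)).
    - by apply/measurable_EFinP; exact: (measurable_funX _ (mfv n)).
    - move: aeD; apply: filterS; first exact: (ae_filter_ringOfSetsType mu).
      by move=> x Dx _; rewrite /v indicE mem_set// mulr1.
  have [] := @fatou_sqint (fun m x => v m x - v n x) (fun x => f x - v n x)
    ((2 * 2^-1 ^+ n) ^+ 2) => //.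
  - by move=> x; apply: cvgB; [exact: fv|exact: cvg_cst].
  - near=> m; apply: le_trans (u2 n m _); last by near: m; exact: nbhs_infty_ge.
    apply: ge0_le_integral => //.
    + by move=> x _; rewrite lee_fin sqr_ge0.
    + by apply/measurable_EFinP; exact: (measurable_funX _ (mvv n m)).
    + by apply/measurable_EFinP; exact: (measurable_funX _ (muu n m)).
    + by move=> x _; rewrite lee_fin.
exists f; split => //.
have fu0 : (fun x => f x - u 0%N x) \in Lfun mu 2%:E.
  apply/Lfun2_sqint; split; first exact: measurable_funB.
  by apply: le_lt_trans (key 0%N) _; exact: ltry.
by apply: (Lfun2_ext (Lfun2D fu0 (uL 0%N))) => x /=; rewrite subrK.
Unshelve. all: by end_near. Qed.

Lemma sqint_Rintegral f : f \in Lfun mu 2%:E ->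
  sqint f = (\int[mu]_x ((f x) ^+ 2))%:E.
Proof.
move=> /Lfun2_sqint[_ fy]; rewrite /Rintegral fineK// ge0_fin_numE//.
by apply: integral_ge0 => x _; rewrite lee_fin sqr_ge0.
Qed.

Lemma hnorm_sqr_parts (f : L2T R) : hnorm (@L2ip R) f ^+ 2 =
  \int[mu]_x (Re (f x)) ^+ 2 + \int[mu]_x (Im (f x)) ^+ 2.
Proof.
have [f1 f2] := L2TP f; rewrite (hnorm_sqr (@L2ipP R)) Re_L2inner_self.
have /Lfun2P[_ i1] := f1; have /Lfun2P[_ i2] := f2.
by rewrite -RintegralD//; apply: eq_Rintegral => x _; rewrite normc_sqr.
Qed.

Lemma sqint_Re_le (f : L2T R) :
  (sqint (fun x => Re (f x)) <= (hnorm (@L2ip R) f ^+ 2)%:E)%E.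
Proof.
have [f1 f2] := L2TP f; rewrite hnorm_sqr_parts sqint_Rintegral// lee_fin lerDl.
by apply: Rintegral_ge0 => x _; rewrite sqr_ge0.
Qed.

Lemma sqint_Im_le (f : L2T R) :
  (sqint (fun x => Im (f x)) <= (hnorm (@L2ip R) f ^+ 2)%:E)%E.
Proof.
have [f1 f2] := L2TP f; rewrite hnorm_sqr_parts sqint_Rintegral// lee_fin lerDr.
by apply: Rintegral_ge0 => x _; rewrite sqr_ge0.
Qed.

Lemma L2_rapid_sum (V : lmodType R[i]) (ip : V -> V -> R[i]) (u : nat -> V) :
  hermitian_form ip -> (forall n, hnorm ip (u n.+1 - u n) <= 2^-1 ^+ n) ->
  forall n m, (n <= m)%N -> hnorm ip (u m - u n) <= 2 * 2^-1 ^+ n.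
Proof.
move=> ipP uu n m /subnK <-; set k := (m - n)%N.
(* The factor [1 - 2 ^ (- k)] makes the induction on [k] close. *)
suff : hnorm ip (u (k + n)%N - u n) <= 2 * (1 - 2^-1 ^+ k) * 2^-1 ^+ n.
  move=> /le_trans; apply; have := half_pow_ge0 R k; have := half_pow_ge0 R n; nra.
elim: k => [|k IH].
  by rewrite add0n subrr expr0 subrr mulr0 mul0r /hnorm (ip_self ipP) -[0 : V](scale0r 0)
     (hnormZ ipP) ComplexField.Normc.normc0 mul0r expr0n sqrtr0.
rewrite -(subrK (u (k + n)%N) (u (k.+1 + n)%N)) -addrA.
apply: le_trans (hnormD ipP _ _) _; rewrite addSn.
apply: le_trans (lerD (uu _) IH) _.
rewrite exprD exprS; have := half_pow_ge0 R k; have := half_pow_ge0 R n; nra.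
Qed.

Lemma L2_rapidly_complete : rapidly_complete (@L2ip R).
Proof.
move=> u uu; have ipP := @L2ipP R.
have uu2 := L2_rapid_sum ipP uu.
pose rea n x := Re (u n x); pose ima n x := Im (u n x).
have reaB n m x : rea m x - rea n x = Re ((u m - u n) x) by rewrite ReD ReN.
have imaB n m x : ima m x - ima n x = Im ((u m - u n) x) by rewrite ImD ImN.
have sqr_le (f : L2T R) K : 0 <= K -> hnorm (@L2ip R) f <= K ->
    hnorm (@L2ip R) f ^+ 2 <= K ^+ 2.
  by move=> K0 fK; rewrite ler_pXn2r ?nnegrE ?hnorm_ge0.
have [||n m nm|f [fL fu]] := @L2_real_complete rea.
- by move=> n; have [] := L2TP (u n).
- move=> n; under eq_fun do rewrite reaB.
  apply: le_trans (sqint_Re_le _) _; rewrite lee_fin sqr_le ?half_pow_ge0//.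
- under eq_fun do rewrite reaB.
  apply: le_trans (sqint_Re_le _) _; rewrite lee_fin sqr_le ?uu2// mulr_ge0 ?half_pow_ge0//.
have [||n m nm|g [gL gu]] := @L2_real_complete ima.
- by move=> n; have [] := L2TP (u n).
- move=> n; under eq_fun do rewrite imaB.
  apply: le_trans (sqint_Im_le _) _; rewrite lee_fin sqr_le ?half_pow_ge0//.
- under eq_fun do rewrite imaB.
  apply: le_trans (sqint_Im_le _) _; rewrite lee_fin sqr_le ?uu2// mulr_ge0 ?half_pow_ge0//.
have hL : L2 (fun x => f x +i* g x) by split.
exists (toL2 hL); set h := toL2 hL.
have hu n : hnorm (@L2ip R) (h - u n) <= 4 * 2^-1 ^+ n.
  have n0 := half_pow_ge0 R n.
  apply: le_of_sqr_le; first by rewrite mulr_ge0.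
  have reE x : Re ((h - u n) x) = f x - rea n x by rewrite ReD ReN.
  have imE x : Im ((h - u n) x) = g x - ima n x by rewrite ImD ImN.
  have rL : (fun x => f x - rea n x) \in Lfun mu 2%:E.
    by have [+ _] := L2TP (h - u n) => /Lfun2_ext; apply.
  have iL : (fun x => g x - ima n x) \in Lfun mu 2%:E.
    by have [_ +] := L2TP (h - u n) => /Lfun2_ext; apply.
  rewrite hnorm_sqr_parts; under eq_Rintegral do rewrite reE.
  under [X in _ + X]eq_Rintegral do rewrite imE.
  have := fu n; have := gu n; rewrite !sqint_Rintegral// !lee_fin.
  have : 0 <= (2^-1 ^+ n) ^+ 2 :> R by rewrite sqr_ge0.
  rewrite !exprMn; lra.
(* Treating real and imaginary parts separately loses a factor in the rate. The stated constant 2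
   returns by passing through [u (k + n)] and letting [k] grow. *)
move=> n; rewrite -subr_le0; apply: (@le0_of_half_pow _ _ 4) => k.
rewrite lerBlDr; have -> : h - u n = (h - u (k + n)%N) + (u (k + n)%N - u n).
  by rewrite addrA subrK.
apply: le_trans (hnormD ipP _ _) _.
apply: lerD; last by apply: uu2; rewrite leq_addl.
apply: le_trans (hu _) _; rewrite ler_wpM2l// exprD ler_piMr ?half_pow_ge0//.
by apply: exprn_ile1; lra.
Qed.
End Completeness.

(** * Polynomials times Gaussians *)

Section SmoothFunctions.
Variable R : realType.
Implicit Types f g : R -> R.

Lemma rderiv_ext f g (x a b : R) : is_derive x (1 : R) f a -> f =1 g -> a = b ->
  is_derive x (1 : R) g b.
Proof. by move=> fa /funext <- <-. Qed.

Lemma rderivD f g (x a b : R) : is_derive x (1 : R) f a -> is_derive x (1 : R) g b ->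
  is_derive x (1 : R) (fun y => f y + g y) (a + b).
Proof. by move=> fa gb; exact: (rderiv_ext (is_deriveD fa gb)). Qed.

Lemma rderivN f (x a : R) : is_derive x (1 : R) f a ->
  is_derive x (1 : R) (fun y => - f y) (- a).
Proof. by move=> fa; exact: (rderiv_ext (is_deriveN fa)). Qed.

Lemma rderivM f g (x a b : R) : is_derive x (1 : R) f a -> is_derive x (1 : R) g b ->
  is_derive x (1 : R) (fun y => f y * g y) (a * g x + f x * b).
Proof.
move=> fa gb; apply: (rderiv_ext (is_deriveM fa gb)) => //.
by rewrite /GRing.scale /=; ring.
Qed.

Lemma rderivX n f (x a : R) : is_derive x (1 : R) f a ->
  is_derive x (1 : R) (fun y => f y ^+ n) (n%:R * f x ^+ n.-1 * a).
Proof.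
move=> fa; apply: (rderiv_ext (is_deriveX n fa)) => //.
by move=> y; rewrite exprfctE.
Qed.

Lemma rderiv_comp f g (x a b : R) : is_derive (g x : R) (1 : R) f a ->
  is_derive x (1 : R) g b -> is_derive x (1 : R) (fun y => f (g y)) (a * b).
Proof. by move=> fa gb; exact: (rderiv_ext (is_derive1_comp fa gb)). Qed.

(** The functions [s^(-k) exp(-1/s)] extended by 0: the usual ingredient of smooth bumps, indexed by
    [k] so that derivatives stay in the family. *)
Definition flat (k : nat) (s : R) : R :=
  if 0 < s then s^-1 ^+ k * expR (- s^-1) else 0.

(** [exp t] is the [k.+1]-st power of [exp (t / k.+1)], which exceeds [t / k.+1]. *)
Lemma exprn_expR_le k (t : R) : 0 <= t -> t ^+ k.+1 * expR (- t) <= k.+1%:R ^+ k.+1.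
Proof.
move=> t0; rewrite expRN ler_pdivrMr ?expR_gt0//.
have -> : expR t = expR (t / k.+1%:R) ^+ k.+1.
  by rewrite -expRM_natl mulrC divfK ?pnatr_eq0.
rewrite -exprMn ler_pXn2r ?nnegrE ?mulr_ge0 ?expR_ge0//.
rewrite mulrC -ler_pdivrMr ?ltr0n//.
by apply: le_trans (expR_ge1Dx _); rewrite lerDr.
Qed.

Lemma flat_ge0 k s : 0 <= flat k s.
Proof.
by rewrite /flat; case: ifPn => // s0; rewrite mulr_ge0 ?expR_ge0// exprn_ge0// invr_ge0 ltW.
Qed.

Lemma flat_le k s : flat k s <= k.+1%:R ^+ k.+1 * `|s|.
Proof.
rewrite /flat; case: ifPn => [s0|_]; last by rewrite mulr_ge0 ?exprn_ge0.
rewrite gtr0_norm// -ler_pdivrMr//.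
have -> : s^-1 ^+ k * expR (- s^-1) / s = s^-1 ^+ k.+1 * expR (- s^-1).
  by rewrite exprS; ring.
by apply: exprn_expR_le; rewrite invr_ge0 ltW.
Qed.

Lemma is_derive_flat k (s : R) : is_derive s (1 : R) (flat k) (flat k.+2 s - k%:R * flat k.+1 s).
Proof.
have [s0|s0|->] := ltgtP s 0.
- have -> : flat k.+2 s - k%:R * flat k.+1 s = 0.
    by rewrite /flat ltNge (ltW s0) /= mulr0 subr0.
  apply: near_eq_is_derive (is_derive_cst 0 s 1).
  near=> x; rewrite /flat ltNge ltW//.
  by near: x; exact: lt_nbhsl.
- apply: (@near_eq_is_derive R R^o R^o (fun x : R => x^-1 ^+ k * expR (- x^-1))).
    near=> x; rewrite /flat ifT//.
    by near: x; exact: lt_nbhsr.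
  have sn0 : id s != 0 :> R by rewrite /= gt_eqF.
  have d1 := is_deriveV sn0 (is_derive_id s 1).
  have d2 := rderivX k d1.
  have d3 := rderiv_comp (is_derive_expR _) (rderivN d1).
  apply: (rderiv_ext (rderivM d2 d3)) => //.
  rewrite /flat s0 /= /GRing.scale /= -exprVn.
  clear d2; case: k => [|k]; first by rewrite expr0; ring.
  by rewrite /= !exprS; ring.
(* At 0 the difference quotient from the right is [flat k.+1 h], bounded by a multiple of [h]. *)
- have cv : h^-1 *: (flat k (h *: (1 : R) + 0) - flat k 0) @[h --> (0 : R)^'] --> (0 : R).
    have f0 : flat k 0 = 0 by rewrite /flat ltxx.
    apply: (@squeeze_cvgr _ _ _ _ (fun=> 0) (fun h => k.+2%:R ^+ k.+2 * `|h|)).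
    + near=> h; rewrite /GRing.scale /= mulr1 addr0 f0 subr0.
      have [h0|h0] := lerP h 0; first by rewrite /flat ltNge h0 /= mulr0 lexx mulr_ge0 ?exprn_ge0.
      apply/andP; split; first by rewrite mulr_ge0 ?flat_ge0// invr_ge0 ltW.
      apply: le_trans (flat_le _ _); rewrite /flat h0 exprS; rewrite le_eqVlt mulrA eqxx//.
    + exact: cvg_cst.
    + rewrite -[X in _ --> X](mulr0 (k.+2%:R ^+ k.+2)).
      apply: cvgM; first exact: cvg_cst.
      rewrite -[X in _ --> X](@normr0 _ R); apply: cvg_norm.
      exact: cvg_within.
  have -> : flat k.+2 0 - k%:R * flat k.+1 0 = 0 :> R.
    by rewrite /flat ltxx mulr0 subr0.
  split; first by apply/cvg_ex; exists 0; exact: cv.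
  exact/cvg_lim.
Unshelve. all: by end_near. Qed.

(* Closed under differentiation, which makes its members smooth. *)
Inductive smooth_expr : (R -> R) -> Prop :=
| SE_cst (c : R) : smooth_expr (fun=> c)
| SE_id : smooth_expr (fun x => x)
| SE_add f g : smooth_expr f -> smooth_expr g -> smooth_expr (fun x => f x + g x)
| SE_mul f g : smooth_expr f -> smooth_expr g -> smooth_expr (fun x => f x * g x)
| SE_exp f : smooth_expr f -> smooth_expr (fun x => expR (f x))
| SE_cos f : smooth_expr f -> smooth_expr (fun x => cos (f x))
| SE_sin f : smooth_expr f -> smooth_expr (fun x => sin (f x))
| SE_flat k f : smooth_expr f -> smooth_expr (fun x => flat k (f x)).

Lemma SE_opp f : smooth_expr f -> smooth_expr (fun x => - f x).
Proof.
move=> sf; rewrite (_ : (fun x => - f x) = (fun x => -1 * f x)).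
  by apply: SE_mul => //; exact: SE_cst.
by apply/funext => x; rewrite mulN1r.
Qed.

Lemma smooth_expr_derive f : smooth_expr f ->
  exists g, smooth_expr g /\ forall x : R, is_derive x (1 : R) f (g x).
Proof.
elim=> {f} [c| |f g _ [f' [sf df]] _ [g' [sg dg]]
  |f g sf0 [f' [sf df]] sg0 [g' [sg dg]]|f sf0 [f' [sf df]]|f sf0 [f' [sf df]]
  |f sf0 [f' [sf df]]|k f sf0 [f' [sf df]]].
- by exists (fun=> 0); split; [exact: SE_cst|move=> x; exact: is_derive_cst].
- by exists (fun=> 1); split; [exact: SE_cst|move=> x; exact: is_derive_id].
- exists (fun x => f' x + g' x); split; first exact: SE_add.
  by move=> x; exact: rderivD.
- exists (fun x => f' x * g x + f x * g' x); split; last by move=> x; exact: rderivM.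
  by apply: SE_add; exact: SE_mul.
- exists (fun x => expR (f x) * f' x); split; first by apply: SE_mul => //; exact: SE_exp.
  by move=> x; exact: rderiv_comp (is_derive_expR _) (df x).
- exists (fun x => - sin (f x) * f' x); split.
    by apply: SE_mul => //; apply: SE_opp; exact: SE_sin.
  by move=> x; exact: rderiv_comp (is_derive_cos _) (df x).
- exists (fun x => cos (f x) * f' x); split; first by apply: SE_mul => //; exact: SE_cos.
  by move=> x; exact: rderiv_comp (is_derive_sin _) (df x).
- exists (fun x => (flat k.+2 (f x) - k%:R * flat k.+1 (f x)) * f' x); split.
    apply: SE_mul => //; apply: SE_add; first exact: SE_flat.
    by apply: SE_opp; apply: SE_mul; [exact: SE_cst|exact: SE_flat].
  by move=> x; exact: rderiv_comp (is_derive_flat k _) (df x).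
Qed.

Lemma derive1_of f g : (forall x : R, is_derive x (1 : R) f (g x)) -> derive1 f = g.
Proof. by move=> fg; apply/funext => x; rewrite derive1E; exact: derive_val. Qed.

Lemma smooth_expr_derivable f n x : smooth_expr f -> derivable (derive1n n f) x 1.
Proof.
move=> sf.
have : smooth_expr (derive1n n f).
  elim: n => [|n IH]; first by [].
  have [g [sg dg]] := smooth_expr_derive IH.
  by rewrite derive1nS (derive1_of dg).
by move=> /smooth_expr_derive[g [_ dg]]; exact: ex_derive.
Qed.

Lemma rderiv_continuous f g : (forall x : R, is_derive x (1 : R) f (g x)) -> continuous f.
Proof.
move=> fg x; apply: differentiable_continuous.
by apply/derivable1_diffP; exact: ex_derive.
Qed.

Lemma smooth_expr_continuous f : smooth_expr f -> continuous f.
Proof. by move=> /smooth_expr_derive[g [_ dg]]; exact: rderiv_continuous dg. Qed.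

Lemma smooth_expr_measurable f : smooth_expr f -> measurable_fun setT f.
Proof. by move=> sf; apply: continuous_measurable_fun; exact: smooth_expr_continuous. Qed.

Lemma SE_exprn f n : smooth_expr f -> smooth_expr (fun x => f x ^+ n).
Proof.
move=> sf; elim: n => [|n IH]; first exact: SE_cst.
rewrite (_ : (fun x => f x ^+ n.+1) = (fun x => f x * f x ^+ n)); first exact: SE_mul.
by apply/funext => x; rewrite exprS.
Qed.

End SmoothFunctions.

(** * Gaussian bounds *)

Section Gaussian.
Variable R : realType.
Local Notation mu := (@lebesgue_measure R).

Definition gauss (a x : R) : R := expR (- (a * x ^+ 2)).

Lemma gauss_ge0 a x : 0 <= gauss a x. Proof. exact: expR_ge0. Qed.

Lemma smooth_gauss a : smooth_expr (gauss a).
Proof.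
apply: SE_exp; apply: SE_opp; apply: SE_mul; first exact: SE_cst.
exact: (SE_exprn 2 (@SE_id R)).
Qed.

Lemma gauss_integrable a : 0 < a -> mu.-integrable setT (EFin \o gauss a).
Proof.
(* The normal density of variance [1 / (2 a)] is proportional to [exp(- a x^2)]. *)
move=> a0; pose s := Num.sqrt (a^-1 / 2).
have s0 : 0 < s by rewrite sqrtr_gt0 divr_gt0 ?invr_gt0.
have pk0 := normal_peak_gt0 (lt0r_neq0 s0).
apply: (integrable_ext (integrable_scale (normal_peak s)^-1 (integrable_normal_pdf 0 s))) => x.
rewrite normal_pdfE ?lt0r_neq0// mulrA mulVf ?lt0r_neq0// mul1r /normal_fun /gauss.
congr expR; rewrite subr0 sqr_sqrtr ?ltW ?divr_gt0 ?invr_gt0//.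
by field; exact: lt0r_neq0.
Qed.

Lemma gauss_Lfun2 a : 0 < a -> gauss a \in Lfun mu 2%:E.
Proof.
move=> a0; apply/Lfun2P; split; first exact: smooth_expr_measurable (smooth_gauss a).
apply: (integrable_ext (gauss_integrable (mulr_gt0 a0 (ltr0Sn R 1)))) => x.
by rewrite /gauss -expRM_natl; congr expR; ring.
Qed.

(** Half of the Gaussian is spent, a quarter on the power and a quarter on the exponential; the
    latter by [b |x| <= b^2 / a + a x^2 / 4]. *)
Lemma poly_gauss_le k a b : 0 < a ->
  exists C, 0 <= C /\ forall x : R, `|x| ^+ k * expR (b * `|x|) * gauss a x <= C * gauss (a / 2) x.
Proof.
move=> a0.
(* From [e |x| <= e + e x^2 <= 1 + e x^2 <= exp(e x^2)], using [e <= 1], the [k]-th power costs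
   [exp(k e x^2)], and [k e <= a / 4]. *)
pose e := Num.min 1 (a / (4 * k.+1%:R)).
have k0 : 0 < k.+1%:R :> R by rewrite ltr0n.
have e0 : 0 < e by rewrite lt_min ltr01 divr_gt0 ?mulr_gt0.
have e1 : e <= 1 by rewrite ge_min lexx.
have ek : k%:R * e <= a / 4.
  apply: (@le_trans _ _ (k.+1%:R * e)); first by rewrite ler_wpM2r ?(ltW e0)// ler_nat.
  rewrite mulrC -ler_pdivlMr//; apply: (@le_trans _ _ (a / (4 * k.+1%:R))).
    by rewrite ge_min lexx orbT.
  by rewrite invfM mulrA.
have en0 : 0 <= (e^-1) ^+ k by rewrite exprn_ge0// invr_ge0 ltW.
exists ((e^-1) ^+ k * expR (b ^+ 2 / a)); split; first by rewrite mulr_ge0 ?expR_ge0.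
move=> x.
have x2 : 0 <= x ^+ 2 by rewrite sqr_ge0.
have h1 : `|x| ^+ k <= (e^-1) ^+ k * expR (a / 4 * x ^+ 2).
  apply: (@le_trans _ _ ((e^-1) ^+ k * expR (k%:R * (e * x ^+ 2)))); last first.
    by rewrite ler_wpM2l// ler_expR mulrA ler_wpM2r.
  rewrite expRM_natl -exprMn lerXn2r ?nnegrE ?normr_ge0//.
    by rewrite mulr_ge0 ?expR_ge0// invr_ge0 ltW.
  rewrite mulrC ler_pdivlMr//.
  apply: le_trans (expR_ge1Dx _).
  have : `|x| <= 1 + x ^+ 2.
    rewrite -(real_normK (num_real x)); have := sqr_ge0 (`|x| - 1).
    have := normr_ge0 x; nra.
  have := normr_ge0 x; nra.
have h2 : expR (b * `|x|) <= expR (b ^+ 2 / a) * expR (a / 4 * x ^+ 2).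
  rewrite -expRD ler_expR -(real_normK (num_real x)) -subr_ge0.
  have := mulr_ge0 (ltW a0) (sqr_ge0 (b / a - `|x| / 2)).
  by congr (0 <= _); field; exact: lt0r_neq0.
apply: (@le_trans _ _ ((e^-1) ^+ k * expR (a / 4 * x ^+ 2) *
    (expR (b ^+ 2 / a) * expR (a / 4 * x ^+ 2)) * gauss a x)).
  by rewrite ler_wpM2r ?gauss_ge0// ler_pM ?exprn_ge0 ?expR_ge0.
rewrite le_eqVlt; apply/orP; left; apply/eqP.
have -> : gauss (a / 2) x = expR (a / 4 * x ^+ 2) * expR (a / 4 * x ^+ 2) * gauss a x.
  by rewrite /gauss -!expRD; congr expR; field.
ring.
Qed.

Lemma poly_gauss_Lfun2 k a b (f : R -> R) : 0 < a -> measurable_fun setT f ->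
  (forall x, `|f x| <= `|x| ^+ k * expR (b * `|x|) * gauss a x) -> f \in Lfun mu 2%:E.
Proof.
move=> a0 mf fle; have [C [C0 CP]] := poly_gauss_le k b a0.
apply: (Lfun2_dominated mf (Lfun2Z C (gauss_Lfun2 (divr_gt0 a0 (ltr0Sn R 1))))) => x.
rewrite [leRHS]ger0_norm ?mulr_ge0 ?gauss_ge0//.
exact: le_trans (fle x) (CP x).
Qed.
End Gaussian.

(** * The core functions *)

Section Core.
Variable R : realType.
Variable q : R[i].

(** This is [exp(- q x^2 / 2)], written through its real and imaginary parts. *)
Definition cgauss (x : R) : R[i] :=
  (gauss (Re q / 2) x * cos (Im q / 2 * x ^+ 2))
  +i* (- (gauss (Re q / 2) x * sin (Im q / 2 * x ^+ 2))).

Definition core (p : {poly R[i]}) (x : R) : R[i] := p.[x%:C] * cgauss x.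

Definition cderiv (f g : R -> R[i]) := forall x : R,
  is_derive x (1 : R) (fun y => Re (f y)) (Re (g x)) /\
  is_derive x (1 : R) (fun y => Im (f y)) (Im (g x)).

Definition csmooth (f : R -> R[i]) :=
  smooth_expr (fun x => Re (f x)) /\ smooth_expr (fun x => Im (f x)).

Lemma csmoothM f g : csmooth f -> csmooth g -> csmooth (fun x => f x * g x).
Proof.
move=> [f1 f2] [g1 g2]; split.
  rewrite (_ : (fun x => _) = (fun x => Re (f x) * Re (g x) + - (Im (f x) * Im (g x)))).
    by apply: SE_add; [exact: SE_mul|apply: SE_opp; exact: SE_mul].
  by apply/funext => x; rewrite ReM.
rewrite (_ : (fun x => _) = (fun x => Re (f x) * Im (g x) + Im (f x) * Re (g x))).
  by apply: SE_add; exact: SE_mul.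
by apply/funext => x; rewrite ImM.
Qed.

Lemma csmoothD f g : csmooth f -> csmooth g -> csmooth (fun x => f x + g x).
Proof.
move=> [f1 f2] [g1 g2]; split.
  rewrite (_ : (fun x => _) = (fun x => Re (f x) + Re (g x))); first exact: SE_add.
  by apply/funext => x; rewrite ReD.
rewrite (_ : (fun x => _) = (fun x => Im (f x) + Im (g x))); first exact: SE_add.
by apply/funext => x; rewrite ImD.
Qed.

Lemma csmooth_cst c : csmooth (fun=> c).
Proof. by split; exact: SE_cst. Qed.

Lemma csmooth_real (f : R -> R) : smooth_expr f -> csmooth (fun x => (f x)%:C).
Proof. by move=> sf; split => //=; exact: SE_cst. Qed.

Lemma cderivM f g f' g' : cderiv f f' -> cderiv g g' ->
  cderiv (fun x => f x * g x) (fun x => f' x * g x + f x * g' x).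
Proof.
move=> df dg x; have [f1 f2] := df x; have [g1 g2] := dg x; split.
  apply: (rderiv_ext (rderivD (rderivM f1 g1) (rderivN (rderivM f2 g2)))) => [y|].
    by rewrite ReM.
  by rewrite !ReImE; ring.
apply: (rderiv_ext (rderivD (rderivM f1 g2) (rderivM f2 g1))) => [y|].
  by rewrite ImM.
by rewrite !ReImE; ring.
Qed.

Lemma cderivD f g f' g' : cderiv f f' -> cderiv g g' ->
  cderiv (fun x => f x + g x) (fun x => f' x + g' x).
Proof.
move=> df dg x; have [f1 f2] := df x; have [g1 g2] := dg x; split.
  by apply: (rderiv_ext (rderivD f1 g1)) => [y|]; rewrite ReD.
by apply: (rderiv_ext (rderivD f2 g2)) => [y|]; rewrite ImD.
Qed.

Lemma cderiv_cst c : cderiv (fun=> c) (fun=> 0).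
Proof. by move=> x; split; exact: is_derive_cst. Qed.

Lemma cderiv_real (f f' : R -> R) : (forall x : R, is_derive x (1 : R) f (f' x)) ->
  cderiv (fun x => (f x)%:C) (fun x => (f' x)%:C).
Proof. by move=> df x; split => //=; exact: is_derive_cst. Qed.

Lemma cderiv_ext f g g' : cderiv f g -> g =1 g' -> cderiv f g'.
Proof. by move=> fg /funext <-. Qed.

Lemma csmooth_horner p : csmooth (fun x => p.[x%:C]).
Proof.
elim/poly_ind: p => [|p c IH].
  by rewrite (_ : (fun x => _) = (fun=> 0)); [exact: csmooth_cst|apply/funext => x; rewrite horner0].
rewrite (_ : (fun x => _) = (fun x => p.[x%:C] * x%:C + c)).
  apply: csmoothD; last exact: csmooth_cst.
  by apply: csmoothM => //; apply: csmooth_real; exact: SE_id.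
by apply/funext => x; rewrite hornerMXaddC.
Qed.

Lemma cderiv_horner p : cderiv (fun x => p.[x%:C]) (fun x => p^`().[x%:C]).
Proof.
elim/poly_ind: p => [|p c IH].
  rewrite (_ : (fun x => _) = (fun=> 0)); last by apply/funext => x; rewrite horner0.
  by apply: (cderiv_ext (cderiv_cst 0)) => x; rewrite deriv0 horner0.
rewrite (_ : (fun x => _) = (fun x => p.[x%:C] * x%:C + c)); last first.
  by apply/funext => x; rewrite hornerMXaddC.
have did : cderiv (fun x => x%:C) (fun=> 1).
  by apply: (@cderiv_real id (fun=> 1)) => x; exact: is_derive_id.
apply: (cderiv_ext (cderivD (cderivM IH did) (cderiv_cst c))) => x.
by rewrite poly.derivD poly.derivM poly.derivX derivC !hornerE; ring.
Qed.

Lemma csmooth_cgauss : csmooth cgauss.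
Proof.
have s2 (b : R) : smooth_expr (fun x => b * x ^+ 2).
  by apply: SE_mul; [exact: SE_cst|exact: (SE_exprn 2 (@SE_id R))].
split => /=.
  by apply: SE_mul; [exact: smooth_gauss|apply: SE_cos].
by apply: SE_opp; apply: SE_mul; [exact: smooth_gauss|apply: SE_sin].
Qed.

Lemma csmooth_core p : csmooth (core p).
Proof. by apply: csmoothM; [exact: csmooth_horner|exact: csmooth_cgauss]. Qed.

Lemma cderiv_cgauss : cderiv cgauss (fun x => - (q * x%:C) * cgauss x).
Proof.
move=> x.
have d2 (b : R) : is_derive x (1 : R) (fun y => b * y ^+ 2) (b * (2 * x)).
  apply: (rderiv_ext (rderivM (is_derive_cst b x 1) (rderivX 2 (is_derive_id x 1)))) => //=.
  by ring.
have dg : is_derive x (1 : R) (gauss (Re q / 2)) (gauss (Re q / 2) x * - (Re q / 2 * (2 * x))).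
  exact: rderiv_comp (is_derive_expR _) (rderivN (d2 _)).
have dc := rderiv_comp (is_derive_cos _) (d2 (Im q / 2)).
have ds := rderiv_comp (is_derive_sin _) (d2 (Im q / 2)).
split.
  by apply: (rderiv_ext (rderivM dg dc)) => //; rewrite !ReImE /=; field.
by apply: (rderiv_ext (rderivN (rderivM dg ds))) => //; rewrite !ReImE /=; field.
Qed.

Lemma normc_cgauss x : normc (cgauss x) = gauss (Re q / 2) x.
Proof.
rewrite /= -[RHS]ger0_norm ?gauss_ge0// -sqrtr_sqr; congr Num.sqrt.
rewrite sqrrN !exprMn -mulrDr cos2Dsin2 mulr1//.
Qed.

Hypothesis q0 : 0 < Re q.

Lemma csmooth_measurable f : csmooth f ->
  measurable_fun setT (fun x => Re (f x)) /\ measurable_fun setT (fun x => Im (f x)).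
Proof. by move=> [f1 f2]; split; exact: smooth_expr_measurable. Qed.

Lemma L2_core p : L2 (core p).
Proof.
suff H k : L2 (core (p * 'X^k)) by have := H 0; rewrite expr0 mulr1.
elim/poly_ind: p k => [|p c IH] k.
  rewrite mul0r (_ : core 0 = (fun=> 0)); first exact: L2_cst0.
  by apply/funext => x; rewrite /core horner0 mul0r.
rewrite (_ : core _ = (fun x => core (p * 'X^(k.+1)) x + c * core ('X^k) x)); last first.
  by apply/funext => x; rewrite /core !hornerM hornerD hornerMX hornerC !hornerXn exprS; ring.
apply: L2D; first exact: IH.
apply: L2Z.
have [m1 m2] := csmooth_measurable (csmooth_core ('X^k)).
have q2 : 0 < Re q / 2 by rewrite divr_gt0.
have nle x : normc (core ('X^k) x) <= `|x| ^+ k * expR (0 * `|x|) * gauss (Re q / 2) x.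
  rewrite /core hornerXn ComplexField.Normc.normcM normc_cgauss mul0r expR0 mulr1.
  by rewrite -rmorphXn normc_real normrX.
split.
  by apply: (poly_gauss_Lfun2 q2 m1) => x; apply: le_trans (normr_Re_le _) (nle x).
by apply: (poly_gauss_Lfun2 q2 m2) => x; apply: le_trans (normr_Im_le _) (nle x).
Qed.

(** Differentiation of core functions, transported to their polynomial factors. *)
Definition pderiv (p : {poly R[i]}) := p^`() - q *: ('X * p).

Lemma cderiv_core p : cderiv (core p) (core (pderiv p)).
Proof.
apply: (cderiv_ext (cderivM (cderiv_horner p) cderiv_cgauss)) => x.
by rewrite /core /pderiv hornerD hornerN hornerZ hornerM hornerX; ring.
Qed.
End Core.

(** * Dominated convergence and compact supports *)

Section LimitsOfIntegrals.
Variable R : realType.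
Local Notation mu := (@lebesgue_measure R).
Local Notation fct := (R -> R[i]).

Lemma Rintegral_dominated_cvg (f : nat -> R -> R) (g h : R -> R) :
  (forall n, measurable_fun setT (f n)) ->
  (forall x, f n x @[n --> \oo] --> g x) ->
  mu.-integrable setT (EFin \o h) -> (forall n x, `|f n x| <= h x) ->
  \int[mu]_x f n x @[n --> \oo] --> \int[mu]_x g x.
Proof.
move=> mf fg ih fh.
have mf' n : measurable_fun (setT : set (measurableTypeR R)) (EFin \o f n).
  by apply/measurable_EFinP; exact: mf.
have mg : measurable_fun (setT : set (measurableTypeR R)) (EFin \o g).
  by apply/measurable_EFinP; apply: (@measurable_fun_cvg _ _ _ _ f) => // x _; exact: fg.
have [||ig _ cv] := dominated_convergence measurableT mf' mg _ ih.
- apply: aeW => x _; apply: cvg_EFin; [exact: nearW|exact: fg].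
- by apply: aeW => x n _; rewrite /= lee_fin.
apply: fine_cvg; rewrite fineK; first exact: cv.
exact: integrable_fin_num.
Qed.

Lemma Cintegral_dominated_cvg (f : nat -> fct) (g : fct) (h : R -> R) :
  (forall n, measurable_fun setT (fun x => Re (f n x)) /\
             measurable_fun setT (fun x => Im (f n x))) ->
  (forall x, Re (f n x) @[n --> \oo] --> Re (g x) /\
             Im (f n x) @[n --> \oo] --> Im (g x)) ->
  mu.-integrable setT (EFin \o h) -> (forall n x, normc (f n x) <= h x) ->
  Re (Cintegral (f n)) @[n --> \oo] --> Re (Cintegral g) /\
  Im (Cintegral (f n)) @[n --> \oo] --> Im (Cintegral g).
Proof.
move=> mf fg ih fh; split; apply: (@Rintegral_dominated_cvg _ _ h) => //.
- by move=> n; have [] := mf n.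
- by move=> x; have [] := fg x.
- by move=> n x; apply: le_trans (normr_Re_le _) _.
- by move=> n; have [] := mf n.
- by move=> x; have [] := fg x.
- by move=> n x; apply: le_trans (normr_Im_le _) _.
Qed.

Lemma normc_Lfun2 (f : fct) : L2 f -> (fun x => normc (f x)) \in Lfun mu 2%:E.
Proof.
move=> fL; have [f1 f2] := fL; apply/Lfun2P; split; last exact: L2_sqr_integrable.
rewrite (_ : (fun x => _) = (fun x => Num.sqrt (Re (f x) ^+ 2 + Im (f x) ^+ 2))).
  apply: (@measurableT_comp _ _ _ _ _ _ (@Num.sqrt R)) => //.
    by apply: continuous_measurable_fun; exact: sqrt_continuous.
  apply: measurable_funD; apply: measurable_funX; exact: Lfun2_measurable.
by apply/funext => x; rewrite normcE'.
Qed.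

Lemma L2inner_dominated_cvg (u : fct) (w : nat -> fct) (v : fct) (h : R -> R) :
  L2 u -> (forall n, L2 (w n)) ->
  (forall x, Re (w n x) @[n --> \oo] --> Re (v x) /\
             Im (w n x) @[n --> \oo] --> Im (v x)) ->
  h \in Lfun mu 2%:E -> (forall n x, normc (w n x) <= h x) ->
  Re (L2inner u (w n)) @[n --> \oo] --> Re (L2inner u v) /\
  Im (L2inner u (w n)) @[n --> \oo] --> Im (L2inner u v).
Proof.
move=> uL wL wv hL wh.
apply: (@Cintegral_dominated_cvg _ _ (fun x => normc (u x) * h x)).
- move=> n; have [/integrableP[m1 _] /integrableP[m2 _]] := L2_mulJ uL (wL n).
  by split; apply/measurable_EFinP.
- move=> x; have [w1 w2] := wv x; split.
    under eq_fun do rewrite ReM ReJ ImJ; rewrite ReM ReJ ImJ.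
    by apply: cvgB; apply: cvgM; rewrite //; [exact: cvg_cst|exact: cvg_cst|exact: cvgN].
  under eq_fun do rewrite ImM ReJ ImJ; rewrite ImM ReJ ImJ.
  by apply: cvgD; apply: cvgM; rewrite //; [exact: cvg_cst|exact: cvgN|exact: cvg_cst].
- by apply: Lfun2_mul_integrable => //; exact: normc_Lfun2.
- by move=> n x; rewrite ComplexField.Normc.normcM normcJ' ler_wpM2l ?normc_ge0.
Qed.

Lemma cvg_const_eq (u : nat -> R) (a b : R) : u n @[n --> \oo] --> a ->
  (forall n, u n = b) -> a = b.
Proof.
move=> ua ub; have ub' : u n @[n --> \oo] --> b.
  by rewrite (_ : u = cst b); [exact: cvg_cst|apply/funext].
exact: cvg_unique ua ub'.
Qed.

Lemma L2inner_eq0_limit (u : fct) (w : nat -> fct) (v : fct) (h : R -> R) :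
  L2 u -> (forall n, L2 (w n)) ->
  (forall x, Re (w n x) @[n --> \oo] --> Re (v x) /\
             Im (w n x) @[n --> \oo] --> Im (v x)) ->
  h \in Lfun mu 2%:E -> (forall n x, normc (w n x) <= h x) ->
  (forall n, L2inner u (w n) = 0) -> L2inner u v = 0.
Proof.
move=> uL wL wv hL wh u0; have [c1 c2] := L2inner_dominated_cvg uL wL wv hL wh.
by apply: complexP; [apply: cvg_const_eq c1 _ => n|apply: cvg_const_eq c2 _ => n]; rewrite u0.
Qed.

Lemma compact_support_integrable (f : R -> R) (M : R) : continuous f ->
  (forall x, M < `|x| -> f x = 0) ->
  mu.-integrable setT (EFin \o f) /\
  forall K, M <= K -> \int[mu]_x f x = \int[mu]_(x in `[- K, K]) f x.
Proof.
move=> cf f0.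
have fE K : M <= K -> f \_ `[- K, K] = f.
  move=> MK; apply/funext => x; rewrite patchE; case: ifPn => // /negP xK.
  rewrite f0//; apply: le_lt_trans MK _; rewrite ltNge; apply/negP => h; apply: xK.
  by rewrite inE /= in_itv /= -ler_norml.
split=> [|K MK]; last by rewrite [RHS]Rintegral_mkcond fE.
rewrite -(fE M)// (_ : EFin \o _ = (EFin \o f) \_ `[- M, M]); last first.
  by rewrite restrict_EFin.
have [mk _] := @integrable_mkcond _ _ _ mu `[- M, M] (EFin \o f) (measurable_itv _).
apply: mk.
apply: continuous_compact_integrable; first exact: segment_compact.
exact: continuous_subspaceT.
Qed.

Lemma integral_derivative_compact_support (f f' : R -> R) (M : R) :
  (forall x : R, is_derive x (1 : R) f (f' x)) -> continuous f' ->
  (forall x, M < `|x| -> f x = 0) -> \int[mu]_x f' x = 0.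
Proof.
move=> df cf' f0.
have f'0 x : M < `|x| -> f' x = 0.
  move=> Mx; have d0 : is_derive x (1 : R) f 0.
    apply: near_eq_is_derive (is_derive_cst (0 : R) x 1).
    near=> y; rewrite f0//.
    near: y; have : `|y| @[y --> x] --> `|x| by apply: cvg_norm; exact: cvg_id.
    by move=> /cvgr_gt/(_ _ Mx).
  by have := @derive_val _ _ _ _ _ _ _ (df x); rewrite (@derive_val _ _ _ _ _ _ _ d0).
pose K := `|M| + 1.
have MK : M < K by apply: le_lt_trans (ler_norm _) _; rewrite ltrDl.
have K0 : 0 < K by rewrite ltr_wpDl.
have [_ /(_ K (ltW MK)) ->] := compact_support_integrable cf' f'0.
have cf := rderiv_continuous df.
rewrite /Rintegral (@continuous_FTC2 _ _ f).
- by rewrite !f0 /= ?subrr ?normrN ?gtr0_norm.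
- lra.
- exact: continuous_subspaceT.
- split.
  + by move=> x _; exact: ex_derive.
  + by apply: cvg_at_right_filter; exact: cf.
  + by apply: cvg_at_left_filter; exact: cf.
- by move=> x _; rewrite derive1E derive_val.
Unshelve. all: by end_near. Qed.

End LimitsOfIntegrals.

(** * Weak derivatives and integration by parts *)

Section WeakDerivative.
Variable R : realType.
Local Notation mu := (@lebesgue_measure R).
Local Notation fct := (R -> R[i]).

Lemma test_function_derive (phi : R -> R) : test_function phi ->
  forall x : R, is_derive x (1 : R) phi (derive1 phi x).
Proof.
move=> [sphi _] x; split; first by have := sphi 0 x.
by rewrite derive1E.
Qed.

Lemma test_function_derive1 (phi : R -> R) : test_function phi ->
  test_function (derive1 phi).
Proof.
move=> tphi; have [sphi [M phi0]] := tphi; split.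
  by move=> n x; rewrite -derive1Sn; exact: sphi.
exists M => x Mx; rewrite derive1E; apply: derive_val.
apply: near_eq_is_derive (is_derive_cst (0 : R) x 1).
near=> y; rewrite phi0//.
near: y; have : `|y| @[y --> x] --> `|x| by apply: cvg_norm; exact: cvg_id.
by move=> /cvgr_gt/(_ _ Mx).
Unshelve. all: by end_near. Qed.

Lemma test_function_continuous (phi : R -> R) : test_function phi -> continuous phi.
Proof. by move=> /test_function_derive; exact: rderiv_continuous. Qed.

Lemma test_function_Lfun2 (phi : R -> R) : test_function phi -> phi \in Lfun mu 2%:E.
Proof.
move=> tphi; have [_ [M phi0]] := tphi.
have cphi := test_function_continuous tphi.
apply/Lfun2P; split; first exact: continuous_measurable_fun.
apply: (@compact_support_integrable _ (fun x => phi x ^+ 2) M _ _).1.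
  by move=> x; apply: cvgM; exact: cphi.
by move=> x Mx; rewrite phi0// expr0n.
Qed.

Lemma is_weak_derivative_cderiv (f f' : fct) : L2 f -> L2 f' -> cderiv f f' ->
  (continuous (fun x => Re (f' x))) -> (continuous (fun x => Im (f' x))) ->
  is_weak_derivative f f'.
Proof.
move=> fL f'L df cRe cIm phi tphi.
have dphi := test_function_derive tphi.
have cphi := test_function_continuous tphi.
have t'phi := test_function_derive1 tphi.
have c'phi := test_function_continuous t'phi.
have p1 := test_function_Lfun2 tphi; have p2 := test_function_Lfun2 t'phi.
have [_ [M phi0]] := tphi.
have parts (u u' : R -> R) : u \in Lfun mu 2%:E -> u' \in Lfun mu 2%:E ->
    (forall x : R, is_derive x (1 : R) u (u' x)) -> continuous u' ->
    \int[mu]_x (u x * derive1 phi x) = - \int[mu]_x (u' x * phi x).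
  move=> uL u'L du cu'; have cu := rderiv_continuous du.
  have := @integral_derivative_compact_support R (fun x => u x * phi x)
    (fun x => u' x * phi x + u x * derive1 phi x) M.
  move=> /(_ (fun x => rderivM (du x) (dphi x))) H.
  apply/eqP; rewrite -addr_eq0 addrC -RintegralD//; last 2 first.
  - exact: Lfun2_mul_integrable.
  - exact: Lfun2_mul_integrable.
  apply/eqP; apply: H.
    move=> x; apply: cvgD; apply: cvgM.
    + exact: cu'.
    + exact: cphi.
    + exact: cu.
    + exact: c'phi.
  by move=> x Mx; rewrite phi0// mulr0.
have [f1 f2] := fL; have [g1 g2] := f'L.
apply: complexP; rewrite ?ReN ?ImN /=.
  under eq_Rintegral do rewrite ReM /= mulr0 subr0.
  under [in RHS]eq_Rintegral do rewrite ReM /= mulr0 subr0.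
  by apply: parts => // x; have [] := df x.
under eq_Rintegral do rewrite ImM /= mulr0 add0r.
under [in RHS]eq_Rintegral do rewrite ImM /= mulr0 add0r.
by apply: parts => // x; have [] := df x.
Qed.

Lemma csmooth_continuous (f : fct) : csmooth f ->
  continuous (fun x => Re (f x)) /\ continuous (fun x => Im (f x)).
Proof. by move=> [f1 f2]; split; exact: smooth_expr_continuous. Qed.

Lemma core_weak_derivative (q : R[i]) p : 0 < Re q ->
  is_weak_derivative (core q p) (core q (pderiv q p)).
Proof.
move=> q0; have [c1 c2] := csmooth_continuous (csmooth_core q (pderiv q p)).
by apply: is_weak_derivative_cderiv => //; [exact: L2_core..|exact: cderiv_core].
Qed.

(** Test functions are real, so the inner product with [w] is split into the pairing with [Re w]
    minus [i] times the pairing with [Im w]. *)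
Lemma weak_derivative_pairing (g g' w w' : fct) (M : R) :
  L2 g -> L2 g' -> is_weak_derivative g g' ->
  csmooth w -> cderiv w w' -> L2 w -> L2 w' -> (forall x, M < `|x| -> w x = 0) ->
  L2inner g w' = - L2inner g' w.
Proof.
move=> gL g'L gg' [s1 s2] dw wL w'L w0.
have t1 : test_function (fun x => Re (w x)).
  split; first by move=> n x; exact: smooth_expr_derivable.
  by exists M => x Mx; rewrite w0.
have t2 : test_function (fun x => Im (w x)).
  split; first by move=> n x; exact: smooth_expr_derivable.
  by exists M => x Mx; rewrite w0.
have d1 : derive1 (fun x => Re (w x)) = fun x => Re (w' x).
  by apply: derive1_of => x; have [] := dw x.
have d2 : derive1 (fun x => Im (w x)) = fun x => Im (w' x).
  by apply: derive1_of => x; have [] := dw x.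
have L2re (h : fct) : L2 h -> L2 (fun x => (Re (h x))%:C).
  by move=> [h1 _]; exact: L2_real.
have L2im (h : fct) : L2 h -> L2 (fun x => (Im (h x))%:C).
  by move=> [_ h1]; exact: L2_real.
have split_inner (h v : fct) : L2 h -> L2 v -> L2inner h v =
    Cintegral (fun x => h x * (Re (v x))%:C) - 'i * Cintegral (fun x => h x * (Im (v x))%:C).
  move=> hL vL; have i1 := L2_mul hL (L2re _ vL); have i2 := L2_mul hL (L2im _ vL).
  rewrite -CintegralZ// -CintegralB//; last exact: CintegrableZ.
  by apply: eq_Cintegral => x; apply: complexP; rewrite !ReImE /=; ring.
rewrite !split_inner//.
have := gg' _ t1; rewrite d1 => ->.
have := gg' _ t2; rewrite d2 => ->.
by rewrite mulrN opprK opprD opprK addrC.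
Qed.

(** The bump [exp(-1 / ((n+1)^2 - x^2))] has no plateau, but it tends to 1 pointwise, and its
    derivative tends to 0 and is bounded by [8 |x|] uniformly in [n]. That is enough for dominated
    convergence against core functions. *)
Definition cutoff (n : nat) (x : R) : R := flat 0 (n.+1%:R ^+ 2 - x ^+ 2).
Definition cutoff' (n : nat) (x : R) : R :=
  flat 2 (n.+1%:R ^+ 2 - x ^+ 2) * - (2 * x).

Lemma is_derive_cutoff n (x : R) : is_derive x (1 : R) (cutoff n) (cutoff' n x).
Proof.
have d : is_derive x (1 : R) (fun y => n.+1%:R ^+ 2 + - y ^+ 2) (0 + - (2 * x ^+ 1 * 1)).
  exact: (rderivD (is_derive_cst _ x 1) (rderivN (rderivX 2 (is_derive_id x 1)))).
apply: (rderiv_ext (rderiv_comp (is_derive_flat 0 _) d)) => //.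
by rewrite /cutoff'; ring.
Qed.

Lemma smooth_cutoff n : smooth_expr (cutoff n).
Proof.
apply: (@SE_flat R 0 (fun x => n.+1%:R ^+ 2 - x ^+ 2)).
apply: SE_add; first exact: SE_cst.
by apply: SE_opp; exact: (SE_exprn 2 (@SE_id R)).
Qed.

Lemma cutoff_support n x : n.+1%:R < `|x| -> cutoff n x = 0.
Proof.
move=> nx; rewrite /cutoff /flat ltNge.
suff -> : n.+1%:R ^+ 2 - x ^+ 2 <= 0 by [].
by rewrite subr_le0 -(real_normK (num_real x)) ler_pXn2r ?nnegrE// ltW.
Qed.

Lemma cutoff_le1 n x : 0 <= cutoff n x <= 1.
Proof.
rewrite flat_ge0 /= /cutoff /flat; case: ifPn => // s0.
by rewrite expr0 mul1r -[leRHS]expR0 ler_expR oppr_le0 invr_ge0 ltW.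
Qed.

Lemma cutoff'_le n x : `|cutoff' n x| <= 8 * `|x|.
Proof.
rewrite /cutoff' normrM normrN normrM (ger0_norm (flat_ge0 _ _)) (ger0_norm (ler0n _ 2)).
suff f4 : flat 2 (n.+1%:R ^+ 2 - x ^+ 2) <= 4.
  by have := normr_ge0 x; nra.
rewrite /flat; case: ifPn => // s0.
apply: le_trans (@exprn_expR_le R 1 (n.+1%:R ^+ 2 - x ^+ 2)^-1 _) _; last lra.
by rewrite invr_ge0 ltW.
Qed.

Lemma inv_gap_le (n : nat) (x : R) : `|x| + 1 <= n.+1%:R ->
  0 < (n.+1%:R ^+ 2 - x ^+ 2)^-1 <= n.+1%:R^-1.
Proof.
move=> nx; have x0 := normr_ge0 x.
have gap : n.+1%:R <= n.+1%:R ^+ 2 - x ^+ 2.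
  rewrite -(real_normK (num_real x)); set N := n.+1%:R in nx *; nra.
have N0 : 0 < n.+1%:R :> R by rewrite ltr0n.
by rewrite invr_gt0 (lt_le_trans N0)//= lef_pV2 ?posrE// (lt_le_trans N0).
Qed.

Lemma eventually_large (x : R) : \forall n \near \oo, `|x| + 1 <= n.+1%:R :> R.
Proof.
near=> n; apply: (@le_trans _ _ n%:R); last by rewrite ler_nat.
near: n; exact: nbhs_infty_ger.
Unshelve. all: by end_near. Qed.

Lemma cvg_cutoff x : cutoff n x @[n --> \oo] --> (1 : R).
Proof.
apply: (@squeeze_cvgr _ _ _ _ (fun n => 1 - n.+1%:R^-1) (fun=> 1)).
- near=> n; have [/andP[_ ->]] := cutoff_le1 n x; rewrite andbT.
  have /andP[g0 g1] : 0 < (n.+1%:R ^+ 2 - x ^+ 2)^-1 <= n.+1%:R^-1.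
    by apply: inv_gap_le; near: n; exact: eventually_large.
  rewrite /cutoff /flat -invr_gt0 g0 expr0 mul1r.
  by apply: le_trans (expR_ge1Dx _); rewrite lerD2l lerN2.
- rewrite -[X in _ --> X]subr0; apply: cvgB; first exact: cvg_cst.
  exact: cvg_harmonic.
- exact: cvg_cst.
Unshelve. all: by end_near. Qed.

Lemma cvg_cutoff' x : cutoff' n x @[n --> \oo] --> (0 : R).
Proof.
rewrite -[X in _ --> X](mul0r (- (2 * x))); apply: cvgM; last exact: cvg_cst.
apply: (@squeeze_cvgr _ _ _ _ (fun=> 0) (fun n => n.+1%:R^-1)).
- near=> n; rewrite flat_ge0 /=.
  have /andP[g0 g1] : 0 < (n.+1%:R ^+ 2 - x ^+ 2)^-1 <= n.+1%:R^-1.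
    by apply: inv_gap_le; near: n; exact: eventually_large.
  rewrite /flat -invr_gt0 g0 /=; apply: (le_trans _ g1).
  have e1 : expR (- (n.+1%:R ^+ 2 - x ^+ 2)^-1) <= 1.
    by rewrite -[leRHS]expR0 ler_expR oppr_le0 ltW.
  apply: (@le_trans _ _ ((n.+1%:R ^+ 2 - x ^+ 2)^-1 ^+ 2)).
    by rewrite ler_piMr// exprn_ge0// ltW.
  have n1 : n.+1%:R^-1 <= 1 :> R by rewrite invf_le1 ?ltr0n// ler1n.
  by rewrite expr2 ler_piMr ?(ltW g0)//; exact: le_trans g1 n1.
- exact: cvg_cst.
- exact: cvg_harmonic.
Unshelve. all: by end_near. Qed.


(** Core functions are not compactly supported, hence not test functions; they are multiplied by the
    cutoffs and both sides pass to the limit. *)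
Lemma core_integration_by_parts (q : R[i]) p (g g' : fct) : 0 < Re q ->
  L2 g -> L2 g' -> is_weak_derivative g g' ->
  L2inner g (core q (pderiv q p)) = - L2inner g' (core q p).
Proof.
move=> q0 gL g'L gg'.
pose w n x := (cutoff n x)%:C * core q p x.
pose w' n x := (cutoff' n x)%:C * core q p x + (cutoff n x)%:C * core q (pderiv q p) x.
have cw n : csmooth (w n).
  by apply: csmoothM; [apply: csmooth_real; exact: smooth_cutoff|exact: csmooth_core].
have dw n : cderiv (w n) (w' n).
  apply: cderivM; last exact: cderiv_core.
  by apply: cderiv_real => x; exact: is_derive_cutoff.
have sw' n : csmooth (w' n).
  apply: csmoothD; apply: csmoothM; try exact: csmooth_core.
    apply: csmooth_real; apply: SE_mul.
      apply: SE_flat; apply: SE_add; first exact: SE_cst.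
      by apply: SE_opp; exact: (SE_exprn 2 (@SE_id R)).
    by apply: SE_opp; apply: SE_mul; [exact: SE_cst|exact: SE_id].
  by apply: csmooth_real; exact: smooth_cutoff.
pose h x := normc (core q p x).
have hL : h \in Lfun mu 2%:E by apply: normc_Lfun2; exact: L2_core.
(* The bound [8 |x|] on the derivative of the cutoff is absorbed by multiplying the polynomial by
   ['X], which stays in the core. *)
pose h' x := 8 * normc (core q ('X * p) x) + normc (core q (pderiv q p) x).
have h'L : h' \in Lfun mu 2%:E.
  by apply: Lfun2D; [apply: Lfun2Z|]; apply: normc_Lfun2; exact: L2_core.
have wh n x : normc (w n x) <= h x.
  rewrite ComplexField.Normc.normcM normc_real; have /andP[c0 c1] := cutoff_le1 n x.
  by rewrite ger0_norm// ler_piMl ?normc_ge0.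
have wh' n x : normc (w' n x) <= h' x.
  apply: le_trans (le_normcD _ _) _; apply: lerD.
    rewrite /core hornerM hornerX !ComplexField.Normc.normcM !normc_real.
    rewrite -!mulrA [leRHS]mulrA ler_wpM2r ?cutoff'_le//.
    by rewrite mulr_ge0 ?normc_ge0.
  rewrite ComplexField.Normc.normcM normc_real; have /andP[c0 c1] := cutoff_le1 n x.
  by rewrite ger0_norm// ler_piMl ?normc_ge0.
have L2_dom (v : fct) (k : R -> R) : csmooth v -> k \in Lfun mu 2%:E ->
    (forall x, normc (v x) <= k x) -> L2 v.
  move=> sv kL vk; have [m1 m2] := csmooth_measurable sv.
  have k0 x : `|k x| = k x by rewrite ger0_norm// (le_trans _ (vk x))// normc_ge0.
  split; [apply: (Lfun2_dominated m1 kL)|apply: (Lfun2_dominated m2 kL)] => x; rewrite k0.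
    exact: le_trans (normr_Re_le _) (vk x).
  exact: le_trans (normr_Im_le _) (vk x).
have wL n : L2 (w n) by exact: L2_dom (cw n) hL (wh n).
have w'L n : L2 (w' n) by exact: L2_dom (sw' n) h'L (wh' n).
have id n : L2inner g (w' n) = - L2inner g' (w n).
  apply: (weak_derivative_pairing (M := n.+1%:R)) => //.
  by move=> x nx; rewrite /w cutoff_support// mul0r.
have cvM (k : nat -> R) (l a : R) : k n @[n --> \oo] --> l -> k n * a @[n --> \oo] --> l * a.
  by move=> kl; apply: cvgM => //; exact: cvg_cst.
have cvg_ext (u v : nat -> R) (l l' : R) : v n @[n --> \oo] --> l' -> u =1 v -> l = l' ->
    u n @[n --> \oo] --> l by move=> vl /funext -> ->.
have cvw x : Re (w n x) @[n --> \oo] --> Re (core q p x) /\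
    Im (w n x) @[n --> \oo] --> Im (core q p x).
  split; apply: (cvg_ext _ _ _ _ (cvM _ _ _ (cvg_cutoff x))) => [n|].
  - by rewrite ReM /= mul0r subr0.
  - by rewrite mul1r.
  - by rewrite ImM /= mul0r addr0.
  - by rewrite mul1r.
have cvw' x : Re (w' n x) @[n --> \oo] --> Re (core q (pderiv q p) x) /\
    Im (w' n x) @[n --> \oo] --> Im (core q (pderiv q p) x).
  split; apply: (cvg_ext _ _ _ _ (cvgD (cvM _ _ _ (cvg_cutoff' x)) (cvM _ _ _ (cvg_cutoff x)))) => [n|].
  - by rewrite ReD (ReM (cutoff' n x)%:C) (ReM (cutoff n x)%:C) /= !mul0r !subr0.
  - by rewrite mul1r mul0r add0r.
  - by rewrite ImD (ImM (cutoff' n x)%:C) (ImM (cutoff n x)%:C) /= !mul0r !addr0.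
  - by rewrite mul1r mul0r add0r.
have [a1 a2] := L2inner_dominated_cvg gL w'L cvw' h'L wh'.
have [b1 b2] := L2inner_dominated_cvg g'L wL cvw hL wh.
have Reid n : Re (L2inner g (w' n)) = - Re (L2inner g' (w n)) by rewrite id ReN.
have Imid n : Im (L2inner g (w' n)) = - Im (L2inner g' (w n)) by rewrite id ImN.
apply: complexP; rewrite ?ReN ?ImN.
  exact: (cvg_unique _ a1 (cvg_ext _ _ _ _ (cvgN b1) Reid (erefl _))).
exact: (cvg_unique _ a2 (cvg_ext _ _ _ _ (cvgN b2) Imid (erefl _))).
Qed.

End WeakDerivative.

(** * Density of the core *)

Section ExponentialSeries.
Variable R : realType.

Definition exp_sum (J : nat) (t : R) : R := series (exp_coeff t) J.

Lemma cvg_exp_sum t : exp_sum J t @[J --> \oo] --> expR t.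
Proof. exact: is_cvg_series_exp_coeff. Qed.

Lemma exp_sum_le J t : `|exp_sum J t| <= expR `|t|.
Proof.
apply: (@le_trans _ _ (exp_sum J `|t|)).
  rewrite /exp_sum /series /=; apply: le_trans (ler_norm_sum _ _ _) _.
  by apply: ler_sum => i _; rewrite /exp_coeff /= normrM normrX normfV (ger0_norm (ler0n _ _)).
apply: (nondecreasing_cvgn_le (u_ := fun J => exp_sum J `|t|)); last exact: is_cvg_series_exp_coeff.
by apply: nondecreasing_series => i _ _; exact: exp_coeff_ge0.
Qed.

(** A partial sum of the exponential at a polynomial, kept as a polynomial so that the vanishing
    moments apply to it. *)
Definition exp_poly (J : nat) (p : {poly R}) : {poly R} :=
  \sum_(0 <= j < J) (j`!%:R^-1) *: p ^+ j.

Lemma horner_exp_poly J p x : (exp_poly J p).[x] = exp_sum J p.[x].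
Proof.
rewrite /exp_poly /exp_sum /series /= horner_sum; apply: eq_bigr => j _.
by rewrite hornerZ horner_exp mulrC.
Qed.

End ExponentialSeries.

Section GaussianMoments.
Variable R : realType.
Local Notation mu := (@lebesgue_measure R).
Variable f : R -> R.
Hypothesis fL : f \in Lfun mu 2%:E.

Definition orthogonal_moments (w : R) :=
  forall k, \int[mu]_x (f x * (x ^+ k * gauss w x)) = 0.

Lemma monomial_gauss_Lfun2 k w : 0 < w -> (fun x => x ^+ k * gauss w x) \in Lfun mu 2%:E.
Proof.
move=> w0; apply: (@poly_gauss_Lfun2 _ k w 0) => // [|x].
  apply: smooth_expr_measurable; apply: SE_mul; last exact: smooth_gauss.
  exact: (SE_exprn k (@SE_id R)).
by rewrite mul0r expR0 mulr1 normrM normrX (ger0_norm (gauss_ge0 _ _)).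
Qed.

Lemma poly_gauss_orthogonal w (r : {poly R}) : 0 < w -> orthogonal_moments w ->
  (fun x => r.[x] * gauss w x) \in Lfun mu 2%:E /\
  \int[mu]_x (f x * (r.[x] * gauss w x)) = 0.
Proof.
move=> w0 fw.
suff H k : (fun x => (r * 'X^k).[x] * gauss w x) \in Lfun mu 2%:E /\
    \int[mu]_x (f x * ((r * 'X^k).[x] * gauss w x)) = 0.
  by have := H 0%N; rewrite expr0 mulr1.
elim/poly_ind: r k => [|r c IH] k.
  have -> : (fun x => (0 * 'X^k : {poly R}).[x] * gauss w x) = (fun x => 0 * gauss w x).
    by apply/funext => x; rewrite mul0r horner0.
  split; first exact: Lfun2Z (gauss_Lfun2 w0).
  under eq_Rintegral do rewrite mul0r horner0 mul0r mulr0.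
  by rewrite Rintegral_cst// mul0r.
have [L1 I1] := IH k.+1.
have L2 := Lfun2Z c (monomial_gauss_Lfun2 k w0).
have E x : ((r * 'X + c%:P) * 'X^k).[x] * gauss w x =
    (r * 'X^(k.+1)).[x] * gauss w x + c * (x ^+ k * gauss w x).
  by rewrite !hornerM hornerD hornerMX hornerC !hornerXn exprS; ring.
split; first by apply: (Lfun2_ext (Lfun2D L1 L2)) => x; rewrite E.
under eq_Rintegral do rewrite E mulrDr (mulrCA _ c).
rewrite RintegralD//; last 2 first.
- exact: Lfun2_mul_integrable.
- by apply: integrable_scale; apply: Lfun2_mul_integrable => //; exact: monomial_gauss_Lfun2.
rewrite I1 add0r RintegralZl//; first by rewrite fw mulr0.
by apply: Lfun2_mul_integrable => //; exact: monomial_gauss_Lfun2.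
Qed.

(** The partial sums of the exponential are polynomials, so their integrals vanish. They are
    dominated by [|x|^k exp(|be| |x|)] times a Gaussian of parameter [w - |al|], which has to be
    positive. *)
Lemma moments_mul_exp w (al be : R) k : `|al| < w -> orthogonal_moments w ->
  \int[mu]_x (f x * (x ^+ k * gauss w x * expR (al * x ^+ 2 + be * x))) = 0.
Proof.
move=> alw fw; have w0 : 0 < w by apply: le_lt_trans alw.
pose p : {poly R} := al *: 'X^2 + be *: 'X.
have pE x : p.[x] = al * x ^+ 2 + be * x by rewrite hornerD !hornerZ hornerXn hornerX.
pose F J x := f x * (('X^k * exp_poly J p).[x] * gauss w x).
have FE J x : F J x = f x * (x ^+ k * gauss w x * exp_sum J (al * x ^+ 2 + be * x)).
  by rewrite /F hornerM hornerXn horner_exp_poly pE; ring.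
have F0 J : \int[mu]_x F J x = 0 by have [] := poly_gauss_orthogonal ('X^k * exp_poly J p) w0 fw.
pose h x := `|x| ^+ k * expR (`|be| * `|x|) * gauss (w - `|al|) x.
have mh : measurable_fun setT h.
  apply: measurable_funM; last exact: smooth_expr_measurable (smooth_gauss _).
  apply: measurable_funM; first by apply: measurable_funX.
  by apply: measurableT_comp => //; apply: measurable_funM.
have hL : h \in Lfun mu 2%:E.
  apply: (@poly_gauss_Lfun2 _ k (w - `|al|) `|be|) => // [|x]; first by rewrite subr_gt0.
  by rewrite ger0_norm// !mulr_ge0 ?exprn_ge0 ?expR_ge0 ?gauss_ge0.
have Fle J x : `|F J x| <= `|f x| * h x.
  rewrite FE normrM ler_wpM2l// normrM.
  apply: (@le_trans _ _ (`|x| ^+ k * gauss w x * expR (`|al| * x ^+ 2 + `|be| * `|x|))).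
    rewrite normrM normrX (ger0_norm (gauss_ge0 _ _)) ler_wpM2l//.
      by rewrite mulr_ge0 ?exprn_ge0 ?gauss_ge0.
    apply: le_trans (exp_sum_le _ _) _; rewrite ler_expR.
    apply: le_trans (ler_normD _ _) _.
    by rewrite (normrM al) (normrM be) (ger0_norm (sqr_ge0 x)).
  rewrite /h /gauss -!mulrA ler_wpM2l ?exprn_ge0// -!expRD ler_expR; lra.
have := @Rintegral_dominated_cvg R F
  (fun x => f x * (x ^+ k * gauss w x * expR (al * x ^+ 2 + be * x))) (fun x => `|f x| * h x).
move=> cv; apply: (cvg_const_eq (cv _ _ _ Fle) F0).
- move=> J; have [L _] := poly_gauss_orthogonal ('X^k * exp_poly J p) w0 fw.
  by have /integrableP[/measurable_EFinP] := Lfun2_mul_integrable fL L.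
- move=> x; rewrite (_ : (fun J => F J x) = (fun J => f x *
      (x ^+ k * gauss w x * exp_sum J (al * x ^+ 2 + be * x)))); last by apply/funext => J; rewrite FE.
  by apply: cvgM; [exact: cvg_cst|apply: cvgM; [exact: cvg_cst|exact: cvg_exp_sum]].
- apply: Lfun2_mul_integrable => //.
  apply: (Lfun2_dominated _ fL) => [|x]; last by rewrite normr_id.
  by apply: measurableT_comp => //; exact: Lfun2_measurable.
Qed.

Lemma moments_shift w w' : 0 < w' < 2 * w -> orthogonal_moments w -> orthogonal_moments w'.
Proof.
move=> /andP[w'0 ww'] fw k.
have alw : `|w - w'| < w by rewrite ltr_norml; apply/andP; split; lra.
rewrite -[RHS](moments_mul_exp 0 k alw fw); apply: eq_Rintegral => x _.
by rewrite -mulrA /gauss -expRD; congr (_ * (_ * expR _)); ring.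
Qed.

(* Expanding [expR (- (w' - w) * x ^+ 2)] under the integral requires
   [`|w' - w| < w], so that large [w'] are reached step by step. *)
Lemma moments_all w w' : 0 < w -> 0 < w' -> orthogonal_moments w -> orthogonal_moments w'.
Proof.
move=> w0 w'0 fw.
have fn n : orthogonal_moments ((3 / 2) ^+ n * w).
  elim: n => [|n IH]; first by rewrite expr0 mul1r.
  apply: moments_shift IH; have e0 : 0 < (3 / 2) ^+ n * w by rewrite mulr_gt0// exprn_gt0//; lra.
  by rewrite exprS; apply/andP; split; lra.
have grow n : 1 + n%:R / 2 <= (3 / 2) ^+ n :> R.
  elim: n => [|n IH]; first by rewrite expr0; lra.
  rewrite exprS -natr1; have : 0 <= n%:R :> R by []. lra.
pose n := Num.bound (w' / w).
have nP : w' / w < n%:R by apply: archi_boundP; rewrite divr_ge0 ?ltW.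
apply: moments_shift (fn n); rewrite w'0 /=.
rewrite ltr_pdivrMr// in nP; apply: (lt_le_trans nP).
by rewrite mulrA ler_wpM2r ?(ltW w0)//; have := grow n; lra.
Qed.

(** Expanding the square, the translated Gaussian is a constant times [exp(- w x^2) exp(2 w y x)]:
    the case [al = 0], [be = 2 w y] of the exponential multiplier. *)
Lemma gauss_translate_orthogonal w y : 0 < w -> orthogonal_moments w ->
  \int[mu]_x (f x * gauss w (x - y)) = 0.
Proof.
move=> w0 fw.
have aw : `|0 : R| < w by rewrite normr0.
have := moments_mul_exp (2 * w * y) 0 aw fw.
set I := Rintegral _ _ _ => I0.
have -> : \int[mu]_x (f x * gauss w (x - y)) = expR (- (w * y ^+ 2)) * I.
  rewrite /I -RintegralZl//.
    apply: eq_Rintegral => x _; rewrite expr0 mul1r mulrCA; congr (_ * _).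
    by rewrite /gauss -!expRD; congr expR; ring.
  apply: Lfun2_mul_integrable => //.
  apply: (@poly_gauss_Lfun2 _ 0 w `|2 * w * y|) => // [|x].
    apply: smooth_expr_measurable; apply: SE_mul.
      by apply: SE_mul; [exact: (SE_exprn 0 (@SE_id R))|exact: smooth_gauss].
    apply: SE_exp; apply: SE_add; apply: SE_mul; try exact: SE_cst; last exact: SE_id.
    exact: (SE_exprn 2 (@SE_id R)).
  rewrite !expr0 !mul1r mul0r add0r normrM (ger0_norm (gauss_ge0 _ _)) mulrC.
  by rewrite ler_wpM2r ?gauss_ge0// ger0_norm ?expR_ge0// ler_expR -normrM ler_norm.
by rewrite I0 mulr0.
Qed.

End GaussianMoments.

(** * Polynomial approximation of a threshold *)

Section GaussianDensity.
Variable R : realType.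

(* A polynomial in [s] without constant term, close to the indicator of
   [1/2 <= s] on [0 <= s <= 1]. *)
Definition step (n : nat) (s : R) : R := 1 - (1 - s ^+ n.+1) ^+ (n.+1 * 2 ^ n.+1)%N.

Lemma step_ge0_le1 n s : 0 <= s <= 1 -> 0 <= step n s <= 1.
Proof.
move=> /andP[s0 s1]; have sn0 : 0 <= s ^+ n.+1 by rewrite exprn_ge0.
have sn1 : s ^+ n.+1 <= 1 by rewrite exprn_ile1.
rewrite subr_ge0 gerBl exprn_ile1 ?subr_ge0//=; last by rewrite gerBl.
by rewrite exprn_ge0// subr_ge0.
Qed.

Lemma bernoulli (t : R) N : 0 <= t <= 1 -> 1 - N%:R * t <= (1 - t) ^+ N.
Proof.
move=> /andP[t0 t1]; elim: N => [|N IH]; first by rewrite mul0r subr0 expr0.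
have e1 : (1 - t) ^+ N <= 1 by rewrite exprn_ile1// ?subr_ge0// gerBl.
have e0 : 0 <= (1 - t) ^+ N by rewrite exprn_ge0// subr_ge0.
rewrite exprS -natr1; have N0 : 0 <= N%:R :> R by [].
nra.
Qed.

(** Bernoulli's inequality. The exponent in [step] is chosen so that its product with [s^(n+1)] is
    [(n+1) (2 s)^(n+1)], which tends to 0 for [s < 1/2] and to infinity for [s >= 1/2]; the factor
    [n + 1] decides the case [s = 1/2]. *)
Lemma step_le n s : 0 <= s <= 1 -> step n s <= n.+1%:R * (2 * s) ^+ n.+1.
Proof.
move=> /andP[s0 s1].
have sn : 0 <= s ^+ n.+1 <= 1 by rewrite exprn_ge0// exprn_ile1.
have := bernoulli (n.+1 * 2 ^ n.+1) sn; rewrite natrM natrX exprMn /step; lra.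
Qed.

Lemma succ_le_pow2 n : n.+1%:R <= 2 ^+ n :> R.
Proof. by rewrite -natrX ler_nat ltn_expl. Qed.

(** The domination, uniform in [n]: for [s] a Gaussian, [4 s] is square integrable, which the
    trivial bound 1 is not. *)
Lemma step_le_linear n s : 0 <= s <= 1 -> step n s <= 4 * s.
Proof.
move=> s01; have /andP[s0 s1] := s01.
have [s4|s4] := lerP (4^-1) s.
  have /andP[_ h] := step_ge0_le1 n s01; apply: (le_trans h); lra.
apply: (le_trans (step_le n s01)).
rewrite exprS.
have h : n.+1%:R * (2 * s) ^+ n <= 1.
  apply: (@le_trans _ _ (2 ^+ n * (2 * s) ^+ n)).
    by rewrite ler_wpM2r ?succ_le_pow2// exprn_ge0//; lra.
  by rewrite -exprMn exprn_ile1//; lra.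
have : 2 * s * (n.+1%:R * (2 * s) ^+ n) <= 2 * s * 1 by rewrite ler_wpM2l//; lra.
lra.
Qed.

Lemma cvg_step_ge s : 2^-1 <= s <= 1 -> step n s @[n --> \oo] --> (1 : R).
Proof.
move=> /andP[s0 s1].
have s01 : 0 <= s <= 1 by apply/andP; split; lra.
apply: (@squeeze_cvgr _ _ _ _ (fun n => 1 - n.+1%:R^-1) (fun=> 1)).
- near=> n; have /andP[_ ->] := step_ge0_le1 n s01; rewrite andbT lerD2l lerN2.
  have sn0 : 0 <= s ^+ n.+1 by rewrite exprn_ge0//; lra.
  have sn1 : s ^+ n.+1 <= 1 by rewrite exprn_ile1//; lra.
  apply: (@le_trans _ _ (expR (- s ^+ n.+1) ^+ (n.+1 * 2 ^ n.+1))).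
    by rewrite lerXn2r ?nnegrE ?subr_ge0 ?expR_ge0// expR_ge1Dx.
  rewrite -expRM_natl mulrN expRN lef_pV2 ?posrE ?expR_gt0 ?ltr0n//.
  apply: le_trans (expR_ge1Dx _); rewrite natrM natrX -mulrA -exprMn.
  have : 1 <= (2 * s) ^+ n.+1 by rewrite exprn_ege1//; lra.
  have : 1 <= n.+1%:R :> R by rewrite ler1n.
  nra.
- rewrite -[X in _ --> X]subr0; apply: cvgB; first exact: cvg_cst.
  exact: cvg_harmonic.
- exact: cvg_cst.
Unshelve. all: by end_near. Qed.

Lemma cvg_step_lt s : 0 <= s < 2^-1 -> step n s @[n --> \oo] --> (0 : R).
Proof.
move=> /andP[s0 s1].
have s01 : 0 <= s <= 1 by apply/andP; split; lra.
pose t := 2 * s.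
have t0 : 0 <= t by rewrite mulr_ge0.
have t1 : t < 1 by rewrite /t; lra.
have [->|tn0] := eqVneq s 0.
  rewrite (_ : (fun n => _) = cst 0); first exact: cvg_cst.
  by apply/funext => n; rewrite /step expr0n /= subr0 expr1n subrr.
have tp : 0 < t by rewrite mulr_gt0// lt_neqAle eq_sym tn0.
(* Half of the decay of [t^(n+1)] compensates the factor [n + 1], as [(n+1) r^(n+1)] is bounded by
   Bernoulli's inequality for [1 / r]; the other half tends to 0. *)
pose r := Num.sqrt t.
have r0 : 0 < r by rewrite sqrtr_gt0.
have r1 : r < 1 by rewrite -sqrtr1 ltr_sqrt.
have tE : t = r ^+ 2 by rewrite sqr_sqrtr.
pose b := r^-1 - 1.
have b0 : 0 < b by rewrite subr_gt0 invf_gt1.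
have bern N : N%:R * b <= r^-1 ^+ N.
  have -> : r^-1 = 1 + b by rewrite /b addrC subrK.
  suff : 1 + N%:R * b <= (1 + b) ^+ N by lra.
  elim: N => [|N IH]; first by rewrite mul0r expr0; lra.
  rewrite exprS -natr1; apply: (le_trans _ (ler_wpM2l _ IH)); last lra.
  have : 0 <= N%:R :> R by []. nra.
have key n : n.+1%:R * t ^+ n.+1 <= b^-1 * r ^+ n.
  have rn0 : 0 < r ^+ n.+1 by rewrite exprn_gt0.
  have -> : t ^+ n.+1 = r ^+ n.+1 * r ^+ n.+1 by rewrite tE -exprM mulnC exprM expr2.
  have h : n.+1%:R * r ^+ n.+1 <= b^-1.
    have h1 : n.+1%:R * b * r ^+ n.+1 <= 1 by rewrite -ler_pdivlMr// div1r -exprVn.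
    by rewrite -[leRHS]mul1r ler_pdivlMr// mulrAC.
  rewrite mulrA; apply: ler_pM => //; first by rewrite mulr_ge0// ltW.
    exact: ltW.
  by rewrite exprS ler_piMl// ?exprn_ge0// ltW.
apply: (@squeeze_cvgr _ _ _ _ (fun=> 0) (fun n => b^-1 * r ^+ n)).
- near=> n; have /andP[-> _] := step_ge0_le1 n s01 => /=.
  exact: le_trans (step_le n s01) (key n).
- exact: cvg_cst.
- rewrite -[X in _ --> X](mulr0 b^-1); apply: cvgM; first exact: cvg_cst.
  by apply: cvg_expr; rewrite ger0_norm// ltW.
Unshelve. all: by end_near. Qed.

End GaussianDensity.

(** * Orthogonality to all Gaussians forces vanishing *)

Section MomentsDetermine.
Variable R : realType.
Local Notation mu := (@lebesgue_measure R).
Variable f : R -> R.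
Hypothesis fL : f \in Lfun mu 2%:E.

Lemma gauss_translate_Lfun2 w y : 0 < w -> (fun x => gauss w (x - y)) \in Lfun mu 2%:E.
Proof.
move=> w0; apply: (@poly_gauss_Lfun2 _ 0 w `|2 * w * y|) => // [|x].
  apply: smooth_expr_measurable; apply: SE_exp; apply: SE_opp; apply: SE_mul.
    exact: SE_cst.
  apply: (SE_exprn 2 (f := fun x => x - y)).
  by apply: SE_add; [exact: SE_id|exact: SE_cst].
rewrite expr0 mul1r ger0_norm ?gauss_ge0// /gauss -expRD ler_expR -normrM.
have := ler_norm (2 * w * y * x); have := mulr_ge0 (ltW w0) (sqr_ge0 y).
rewrite sqrrB; lra.
Qed.

Section Translate.
Variables (w y : R).
Hypothesis w0 : 0 < w.
Hypothesis f_gauss : forall v, 0 < v -> \int[mu]_x (f x * gauss v (x - y)) = 0.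
Let s x := gauss w (x - y).

Let s01 x : 0 <= s x <= 1.
Proof.
rewrite gauss_ge0 /s /gauss -[leRHS]expR0 ler_expR oppr_le0.
by rewrite mulr_ge0 ?sqr_ge0// ltW.
Qed.

Let orth (g : R -> R) := g \in Lfun mu 2%:E /\ \int[mu]_x (f x * g x) = 0.

Let orthD g h : orth g -> orth h -> orth (fun x => g x + h x).
Proof.
move=> [gL g0] [hL h0]; split; first exact: Lfun2D.
under eq_Rintegral do rewrite mulrDr.
by rewrite RintegralD ?g0 ?h0 ?addr0//; exact: Lfun2_mul_integrable.
Qed.

Let orthZ a g : orth g -> orth (fun x => a * g x).
Proof.
move=> [gL g0]; split; first exact: Lfun2Z.
under eq_Rintegral do rewrite mulrCA.
by rewrite RintegralZl ?g0 ?mulr0//; exact: Lfun2_mul_integrable.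
Qed.

Let orth_ext g h : orth g -> g =1 h -> orth h.
Proof. by move=> og /funext <-. Qed.

(** Powers of a Gaussian are Gaussians with the same centre. *)
Let orth_pow n : orth (fun x => s x ^+ n.+1).
Proof.
have nw : 0 < n.+1%:R * w by rewrite mulr_gt0.
apply: (@orth_ext (fun x => gauss (n.+1%:R * w) (x - y))) => [|x].
  by split; [exact: gauss_translate_Lfun2|exact: f_gauss].
by rewrite /s /gauss -expRM_natl; congr expR; ring.
Qed.

(** The exponent [m.+1] keeps every term free of a constant, since constants are not square
    integrable. *)
Let orth_pow_mul N n m : orth (fun x => s x ^+ m.+1 * (1 - s x ^+ n.+1) ^+ N).
Proof.
elim: N m => [|N IH] m.
  by apply: (orth_ext (orth_pow m)) => x; rewrite expr0 mulr1.
apply: (orth_ext (orthD (IH m) (orthZ (-1) (IH (m + n.+1)%N)))) => x.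
rewrite (exprS _ N) -addSn exprD.
by move: ((1 - s x ^+ n.+1) ^+ N) (s x ^+ m.+1) (s x ^+ n.+1) => u v t; ring.
Qed.

Let orth_step n : orth (fun x => step n (s x)).
Proof.
rewrite /step; elim: (n.+1 * 2 ^ n.+1)%N => [|N IH].
  apply: (orth_ext (orthZ 0 (orth_pow 0))) => x.
  by rewrite mul0r expr0 subrr.
apply: (orth_ext (orthD IH (orth_pow_mul N n n))) => x.
by rewrite (exprS _ N); move: ((1 - s x ^+ n.+1) ^+ N) (s x ^+ n.+1) => u t; ring.
Qed.

Lemma integral_superlevel_eq0 :
  \int[mu]_x (f x * (2^-1 <= gauss w (x - y))%R%:R) = 0.
Proof.
have F0 n : \int[mu]_x (f x * step n (s x)) = 0 by have [] := orth_step n.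
have cv := @Rintegral_dominated_cvg R (fun n x => f x * step n (s x))
  (fun x => f x * (2^-1 <= s x)%R%:R) (fun x => `|f x| * (4 * s x)).
apply: (cvg_const_eq (cv _ _ _ _) F0).
- move=> n; have [L _] := orth_step n.
  by have /integrableP[/measurable_EFinP] := Lfun2_mul_integrable fL L.
- move=> x; apply: cvgM; first exact: cvg_cst.
  have /andP[s0 s1] := s01 x.
  by have [h|h] := lerP (2^-1) (s x); [apply: cvg_step_ge|apply: cvg_step_lt]; apply/andP.
- apply: Lfun2_mul_integrable; last exact/Lfun2Z/gauss_translate_Lfun2.
  apply: (Lfun2_dominated _ fL) => [|x]; last by rewrite normr_id.
  by apply: measurableT_comp => //; exact: Lfun2_measurable.
- move=> n x; rewrite normrM ler_wpM2l//.
  have /andP[h _] := step_ge0_le1 n (s01 x).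
  by rewrite ger0_norm// step_le_linear.
Qed.
End Translate.

Hypothesis f_gauss : forall w y, 0 < w -> \int[mu]_x (f x * gauss w (x - y)) = 0.

(** A segment is the set where a Gaussian centred at its midpoint is at least 1/2. *)
Lemma integral_segment_eq0 a b : a < b -> \int[mu]_(x in `[a, b]) f x = 0.
Proof.
move=> ab; pose y := (a + b) / 2; pose r := (b - a) / 2.
have r0 : 0 < r by rewrite /r; lra.
have l2 : 0 < ln 2 :> R by rewrite ln_gt0//; lra.
(* The parameter for which the Gaussian equals 1/2 at distance [r] from its centre. *)
have w0 : 0 < ln 2 / r ^+ 2 by rewrite divr_gt0// exprn_gt0.
rewrite Rintegral_mkcond -[RHS](integral_superlevel_eq0 w0 (fun v => @f_gauss v y)).
apply: eq_Rintegral => x _; rewrite patchE.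
suff -> : (2^-1 <= gauss (ln 2 / r ^+ 2) (x - y)) = (x \in `[a, b]%classic).
  by case: ifP; rewrite ?mulr1 ?mulr0.
rewrite /gauss -[2^-1 in LHS](@lnK R) ?posrE ?invr_gt0// ler_expR lnV ?posrE// lerN2.
rewrite mulrAC ler_pdivrMr ?exprn_gt0// ler_pM2l// -(real_normK (num_real (x - y))).
rewrite ler_pXn2r ?nnegrE ?(ltW r0)// ler_norml.
apply/idP/idP => [/andP[h1 h2]|].
  by rewrite inE /= in_itv /=; apply/andP; rewrite /y /r in h1 h2 *; split; lra.
by rewrite inE /= in_itv /= => /andP[h1 h2]; apply/andP; rewrite /y /r; split; lra.
Qed.

(** The primitive of [f] from [- n] vanishes to the right of [- n], and its derivative is [f] almost
    everywhere; the exceptional sets for all [n] are joined at the end. *)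
Lemma ae_eq0_of_gauss : ae_eq mu setT f (cst 0).
Proof.
have mf := Lfun2_measurable fL.
have int_bounded (A : set (measurableTypeR R)) : measurable A -> (mu A < +oo)%E ->
    mu.-integrable A (EFin \o f).
  move=> mA Afin.
  have A2 : \1_A \in Lfun mu 2%:E.
    apply/Lfun2P; split; first exact: measurable_indic.
    apply: (integrable_ext (f := \1_A)); last first.
      by move=> x; rewrite indicE; case: (_ \in _); rewrite ?expr1n ?expr0n.
    apply/integrableP; split; first by apply/measurable_EFinP; exact: measurable_indic.
    under eq_integral => x _ do rewrite /= ger0_norm//.
    by rewrite integral_indic// setIT.
  have [_ mk] := @integrable_mkcond _ _ _ mu A (EFin \o f) mA.
  apply: mk; rewrite restrict_EFin.
  apply: (integrable_ext (Lfun2_mul_integrable fL A2)) => x.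
  by rewrite patchE indicE; case: ifP => _; rewrite ?mulr1 ?mulr0.
have locf : locally_integrable setT f.
  split; [exact: mf|exact: openT|].
  move=> K _ cK.
  have /integrableP[_] := int_bounded K (compact_measurable cK) (compact_finite_measure cK).
  by [].
have H (n : nat) : \forall x \ae mu, - n%:R < x -> f x = 0.
  have inty z : mu.-integrable [set` Interval (BLeft (- n%:R)) (BRight z)] (EFin \o f).
    apply: int_bounded; first exact: measurable_itv.
    by apply: compact_finite_measure; exact: segment_compact.
  have := FTC1 inty locf; apply: filterS; first exact: (ae_filter_ringOfSetsType mu).
  move=> x H nx.
  have [|_ <-] := H; first by rewrite /= lte_fin.
  rewrite derive1E; apply: derive_val.
  apply: near_eq_is_derive (is_derive_cst (0 : R) x 1).
  near=> z; rewrite integral_segment_eq0//.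
  by near: z; exact: lt_nbhsr.
apply: (@filterS _ _ (ae_filter_ringOfSetsType mu) _ _ _ (ae_foralln H)).
move=> x Hx _; apply: (Hx (Num.bound `|x|)).
rewrite ltrNl; apply: le_lt_trans (ler_norm _) _; rewrite normrN.
exact: archi_boundP.
Unshelve. all: by end_near. Qed.

End MomentsDetermine.

(** * Removing the phase of the complex Gaussian *)

Section ComplexExponentialSeries.
Variable R : realType.

Definition cexp_sum (J : nat) (t : R) : R[i] :=
  \sum_(0 <= j < J) (j`!%:R^-1 : R)%:C * ('i * t%:C) ^+ j.

Lemma i_exp j : ('i : R[i]) ^+ j =
  ((~~ odd j)%:R * (-1) ^+ j./2) +i* ((odd j)%:R * (-1) ^+ j.-1./2).
Proof.
have ev m : ('i : R[i]) ^+ m.*2 = ((-1) ^+ m)%:C.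
  rewrite -mul2n exprM (_ : ('i : R[i]) ^+ 2 = (-1)%:C) ?rmorphXn//.
  by apply: complexP; rewrite expr2 /=; ring.
rewrite -{1}(odd_double_half j); case: (boolP (odd j)) => oj.
  rewrite add1n exprS ev (_ : j.-1./2 = j./2); last by case: j oj => //= j; rewrite uphalf_half => /negbTE ->.
  by apply: complexP => /=; ring.
by rewrite add0n ev; apply: complexP => /=; ring.
Qed.

Lemma Re_cexp_sum J t : Re (cexp_sum J t) = series (cos_coeff t) J.
Proof.
rewrite /series /= (big_morph _ (@ReD R) (erefl _)); apply: eq_bigr => j _.
by rewrite cos_coeffE exprMn -rmorphXn i_exp !ReImE /=; ring.
Qed.

Lemma Im_cexp_sum J t : Im (cexp_sum J t) = series (sin_coeff t) J.
Proof.
rewrite /series /= (big_morph _ (@ImD R) (erefl _)); apply: eq_bigr => j _.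
by rewrite /sin_coeff exprMn -rmorphXn i_exp !ReImE /=; ring.
Qed.

Lemma cvg_Re_cexp_sum t : Re (cexp_sum J t) @[J --> \oo] --> cos t.
Proof.
rewrite (_ : (fun J => _) = series (cos_coeff t)); last by apply/funext => J; rewrite Re_cexp_sum.
by rewrite cos.unlock; exact: is_cvg_series_cos_coeff.
Qed.

Lemma cvg_Im_cexp_sum t : Im (cexp_sum J t) @[J --> \oo] --> sin t.
Proof.
rewrite (_ : (fun J => _) = series (sin_coeff t)); last by apply/funext => J; rewrite Im_cexp_sum.
by rewrite sin.unlock; exact: is_cvg_series_sin_coeff.
Qed.

Lemma normc_exp (z : R[i]) n : normc (z ^+ n) = normc z ^+ n.
Proof.
elim: n => [|n IH]; first by rewrite !expr0 ComplexField.Normc.normc1.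
by rewrite !exprS ComplexField.Normc.normcM IH.
Qed.

Lemma normc_cexp_sum_le J t : normc (cexp_sum J t) <= expR `|t|.
Proof.
have normc_sum (F : nat -> R[i]) :
    normc (\sum_(0 <= j < J) F j) <= \sum_(0 <= j < J) normc (F j).
  elim/big_ind2 : _ => //; first by rewrite ComplexField.Normc.normc0.
  by move=> a b c d ab cd; apply: le_trans (le_normcD _ _) (lerD ab cd).
apply: le_trans (normc_sum _) _.
apply: (@le_trans _ _ (exp_sum J `|t|)); last first.
  by apply: le_trans (ler_norm _) _; rewrite -[in leRHS](normr_id t) exp_sum_le.
rewrite le_eqVlt; apply/orP; left; apply/eqP; rewrite /exp_sum /series /=.
apply: eq_bigr => j _.
rewrite ComplexField.Normc.normcM normc_exp ComplexField.Normc.normcM !normc_real.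
rewrite ger0_norm ?invr_ge0// mulrC; congr (_ ^+ _ / _).
by rewrite /= expr0n expr1n add0r sqrtr1 mul1r.
Qed.
End ComplexExponentialSeries.

Section CoreDensity.
Variable R : realType.
Local Notation mu := (@lebesgue_measure R).
Variables (q : R[i]) (u : R -> R[i]).
Hypothesis Re_q : 0 < Re q.
Hypothesis Im_q : `|Im q| < Re q.
Hypothesis uL : L2 u.
Hypothesis u_core : forall p, L2inner u (core q p) = 0.

Let be : R := Im q / 2.
Let phase_poly (k J : nat) : {poly R[i]} :=
  'X^k * \sum_(0 <= j < J) ((j`!%:R^-1 : R)%:C * ('i * be%:C) ^+ j) *: 'X^(2 * j).

Let horner_phase k J x : (phase_poly k J).[x%:C] = (x ^+ k)%:C * cexp_sum J (be * x ^+ 2).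
Proof.
rewrite hornerM hornerXn -rmorphXn; congr (_ * _); rewrite horner_sum.
apply: eq_bigr => j _; rewrite hornerZ hornerXn exprM -mulrA -exprMn.
by congr (_ * _ ^+ _); rewrite -rmorphXn -mulrA -rmorphM.
Qed.

(** Multiplication by [exp(i be x^2)] turns [cgauss q] into its modulus. Partial sums of this
    exponential only change the polynomial factor, and they are dominated by a Gaussian of parameter
    [Re q / 2 - |be|], positive because [|Im q| < Re q]. *)
Let Re_orthogonal k : L2inner u (fun x => (x ^+ k * gauss (Re q / 2) x)%:C) = 0.
Proof.
have bq : 0 < Re q / 2 - `|be|.
  rewrite /be normrM (@ger0_norm _ 2^-1) ?invr_ge0//; have := Im_q; lra.
pose h x := `|x| ^+ k * gauss (Re q / 2 - `|be|) x.
have mh : measurable_fun setT h.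
  apply: measurable_funM; last exact: smooth_expr_measurable (smooth_gauss _).
  by apply: measurable_funX.
have hL : h \in Lfun mu 2%:E.
  apply: (@poly_gauss_Lfun2 _ k _ 0 _ bq mh) => x.
  by rewrite mul0r expR0 mulr1 ger0_norm// mulr_ge0 ?exprn_ge0 ?gauss_ge0.
have E J x : core q (phase_poly k J) x = (x ^+ k)%:C * (cexp_sum J (be * x ^+ 2) * cgauss q x).
  by rewrite /core horner_phase mulrA.
apply: (L2inner_eq0_limit uL (fun J => L2_core Re_q (phase_poly k J)) _ hL _ (fun J => u_core _)).
- move=> x; pose t := be * x ^+ 2; pose g := gauss (Re q / 2) x.
  have cs : cos t * cos t + sin t * sin t = 1 by rewrite -!expr2 cos2Dsin2.
  have Eg : cgauss q x = (g * cos t) +i* (- (g * sin t)) by [].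
  split.
    rewrite (_ : (fun J => _) = (fun J => x ^+ k * (Re (cexp_sum J t) * (g * cos t)
        - Im (cexp_sum J t) * (- (g * sin t))))); last first.
      by apply/funext => J; rewrite E Eg -/t !ReImE /=; ring.
    have -> : Re (x ^+ k * gauss (Re q / 2) x)%:C =
        x ^+ k * (cos t * (g * cos t) - sin t * (- (g * sin t))).
      rewrite -[LHS]/(x ^+ k * g) -[g in LHS]mulr1 -cs; ring.
    apply: cvgM; first exact: cvg_cst.
    by apply: cvgB; apply: cvgM;
      [exact: cvg_Re_cexp_sum|exact: cvg_cst|exact: cvg_Im_cexp_sum|exact: cvg_cst].
  rewrite (_ : (fun J => _) = (fun J => x ^+ k * (Re (cexp_sum J t) * (- (g * sin t))
      + Im (cexp_sum J t) * (g * cos t)))); last first.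
    by apply/funext => J; rewrite E Eg -/t !ReImE /=; ring.
  have -> : Im (x ^+ k * gauss (Re q / 2) x)%:C =
      x ^+ k * (cos t * (- (g * sin t)) + sin t * (g * cos t)).
    by rewrite /=; ring.
  apply: cvgM; first exact: cvg_cst.
  by apply: cvgD; apply: cvgM;
    [exact: cvg_Re_cexp_sum|exact: cvg_cst|exact: cvg_Im_cexp_sum|exact: cvg_cst].
- move=> J x; rewrite E !ComplexField.Normc.normcM normc_real normrX normc_cgauss.
  rewrite /h ler_wpM2l ?exprn_ge0//.
  apply: (@le_trans _ _ (expR (`|be * x ^+ 2|) * gauss (Re q / 2) x)).
    by rewrite ler_wpM2r ?gauss_ge0 ?normc_cexp_sum_le.
  rewrite /gauss -expRD ler_expR normrM (ger0_norm (sqr_ge0 x)); lra.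
Qed.

Lemma core_orthogonal_ae_eq0 : ae_eq mu setT u (cst 0).
Proof.
have [u1 u2] := uL.
have q2 : 0 < Re q / 2 by rewrite divr_gt0.
have m1 : orthogonal_moments (fun x => Re (u x)) (Re q / 2).
  move=> k; have := congr1 (@complex.Re R) (Re_orthogonal k); rewrite /= => <-.
  by apply: eq_Rintegral => x _; rewrite ReM /= oppr0 mulr0 subr0.
have m2 : orthogonal_moments (fun x => Im (u x)) (Re q / 2).
  move=> k; have := congr1 (@complex.Im R) (Re_orthogonal k); rewrite /= => <-.
  by apply: eq_Rintegral => x _; rewrite ImM /= oppr0 mulr0 add0r.
have a1 := ae_eq0_of_gauss u1 (fun w y w0 =>
  gauss_translate_orthogonal u1 y w0 (moments_all u1 q2 w0 m1)).
have a2 := ae_eq0_of_gauss u2 (fun w y w0 =>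
  gauss_translate_orthogonal u2 y w0 (moments_all u2 q2 w0 m2)).
apply: (@filterS2 _ _ (ae_filter_ringOfSetsType mu) _ _ _ _ a1 a2) => x H1 H2 _.
by apply: complexP; [exact: H1|exact: H2].
Qed.
End CoreDensity.

(** * The harmonic oscillator on the core *)

Section PolynomialModel.
Variables (R : realType) (q : R[i]).
Hypothesis Re_q : 0 < Re q.
Local Notation V := {poly R[i]}.

Definition coreT (p : V) : L2T R := toL2 (L2_core Re_q p).

Fact coreT_linear : linear coreT.
Proof.
move=> a p r; apply: val_inj; apply/funext => x /=.
by rewrite /core hornerD hornerZ mulrDl -mulrA.
Qed.
HB.instance Definition _ := GRing.isLinear.Build R[i] V (L2T R) *:%R coreT coreT_linear.

Definition core_ip (p r : V) : R[i] := L2ip (coreT p) (coreT r).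

Lemma core_ipP : hermitian_form core_ip.
Proof.
have ipP := @L2ipP R; split.
- by move=> f g h; rewrite /core_ip linearD (ipDl ipP).
- by move=> a f g; rewrite /core_ip linearZ (ipZl ipP).
- by move=> f g; rewrite /core_ip (ipC ipP).
- by move=> f; exact: Re_L2inner_ge0.
Qed.

Lemma hnorm_core p : hnorm core_ip p = hnorm (@L2ip R) (coreT p).
Proof. by []. Qed.

Definition momentum (p : V) : V := - 'i *: pderiv q p.
Definition position (p : V) : V := 'X * p.

Fact pderiv_linear : linear (pderiv q).
Proof.
move=> a f g; rewrite /pderiv poly.derivD derivZ -!mul_polyC; ring.
Qed.
HB.instance Definition _ := GRing.isLinear.Build R[i] V V *:%R (pderiv q) pderiv_linear.

Fact momentum_linear : linear momentum.
Proof. by move=> a f g; rewrite /momentum linearP /= scalerDr !scalerA mulrC. Qed.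
HB.instance Definition _ := GRing.isLinear.Build R[i] V V *:%R momentum momentum_linear.

Fact position_linear : linear position.
Proof. by move=> a f g; rewrite /position mulrDr scalerAr. Qed.
HB.instance Definition _ := GRing.isLinear.Build R[i] V V *:%R position position_linear.

Lemma coreTB u v : coreT (u - v) = coreT u - coreT v.
Proof. exact (@raddfB _ _ coreT u v). Qed.

Lemma coreTZ a u : coreT (a *: u) = a *: coreT u.
Proof. exact (@linearZ_LR _ _ _ _ coreT a u). Qed.

Lemma pderivB u v : pderiv q (u - v) = pderiv q u - pderiv q v.
Proof. exact (@raddfB _ _ (pderiv q) u v). Qed.

Lemma momentumB u v : momentum (u - v) = momentum u - momentum v.
Proof. exact (@raddfB _ _ momentum u v). Qed.

Lemma positionB u v : position (u - v) = position u - position v.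
Proof. exact (@raddfB _ _ position u v). Qed.

Lemma pderiv_skew f g : core_ip (pderiv q f) g = - core_ip f (pderiv q g).
Proof.
rewrite [X in - X](core_integration_by_parts g Re_q (L2_core Re_q f) (L2_core Re_q (pderiv q f))).
  by rewrite opprK.
exact: core_weak_derivative.
Qed.

Lemma momentum_sym f g : core_ip (momentum f) g = core_ip f (momentum g).
Proof.
rewrite (ipZl core_ipP) (ipZr core_ipP) pderiv_skew mulrN -mulNr.
by congr (_ * _); apply: complexP; rewrite !ReImE /=; ring.
Qed.

Lemma position_sym f g : core_ip (position f) g = core_ip f (position g).
Proof.
have posE h x : core q (position h) x = x%:C * core q h x.
  by rewrite /core hornerM hornerX mulrA.
by apply: eq_Cintegral => x; rewrite /= !posE mul_realCJ.
Qed.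

Lemma pderiv_position f : pderiv q (position f) = f + position (pderiv q f).
Proof.
rewrite /pderiv /position poly.derivM derivX mul1r mulrBr -scalerAr.
by rewrite addrA.
Qed.

Lemma canonical_commutation f : position (momentum f) - momentum (position f) = 'i *: f.
Proof.
rewrite /momentum pderiv_position /position -scalerAr -scalerBr.
by rewrite addrC opprD subrK scalerN scaleNr opprK.
Qed.

Local Notation H := (oscillator momentum position (q ^+ 2)).

Lemma oscillator_shiftB z u v :
  H (u - v) - z *: (u - v) = (H u - z *: u) - (H v - z *: v).
Proof.
rewrite /oscillator /= !momentumB !positionB !scalerBr.
by rewrite !opprD !opprK; ring.
Qed.

Lemma momentum2 f : momentum (momentum f) = - pderiv q (pderiv q f).
Proof.
rewrite /momentum linearZ /= scalerA -[RHS]scaleN1r; congr (_ *: _).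
by apply: complexP; rewrite !ReImE /=; ring.
Qed.

(** Conjugation by the Gaussian cancels the quadratic potential and leaves Hermite's differential
    operator, which does not raise degrees. *)
Lemma oscillatorE f : H f = - f^`()^`() + q *: f + (q *+ 2) *: ('X * f^`()).
Proof.
rewrite /oscillator /= momentum2 /pderiv /position.
rewrite poly.derivB derivZ poly.derivM derivX -!mul_polyC rmorphMn rmorphXn /=.
by ring.
Qed.

Lemma lowerE f : 'i *: momentum f + q *: position f = f^`().
Proof.
rewrite /momentum scalerA (_ : 'i * - 'i = 1); first by rewrite scale1r subrK.
by apply: complexP; rewrite !ReImE /=; ring.
Qed.

Lemma raiseE f : - 'i *: momentum f + q *: position f = - f^`() + (q *+ 2) *: ('X * f).
Proof.
rewrite /momentum scalerA (_ : - 'i * - 'i = -1); last first.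
  by apply: complexP; rewrite !ReImE /=; ring.
by rewrite /pderiv /position -!mul_polyC rmorphMn rmorphN rmorph1; ring.
Qed.

Lemma lower_ground : 'i *: momentum 1 + q *: position 1 = 0.
Proof. by rewrite lowerE derivC. Qed.

Lemma oscillator_ground : H 1 = q *: 1.
Proof. by rewrite oscillatorE derivC deriv0 mulr0 scaler0 oppr0 add0r addr0. Qed.

Lemma lower_raise f : let g := - 'i *: momentum f + q *: position f in
  'i *: momentum g + q *: position g = H f + q *: f.
Proof.
rewrite /= lowerE raiseE oscillatorE poly.derivD derivN derivZ poly.derivM derivX.
by rewrite -!mul_polyC rmorphMn /=; ring.
Qed.

Lemma oscillator_raise f : let raise g := - 'i *: momentum g + q *: position g in
  H (raise f) = raise (H f + (q *+ 2) *: f).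
Proof.
rewrite /= !raiseE !oscillatorE.
rewrite ?(poly.derivD, derivN, derivZ, poly.derivM, derivX, derivMn, derivC).
rewrite -!mul_polyC ?rmorphMn /=.
rewrite ?(poly.derivD, derivN, derivZ, poly.derivM, derivX, derivMn, derivC).
by ring.
Qed.

Lemma q_neq0 : q != 0.
Proof. by apply: contraTneq Re_q => ->; rewrite ltxx. Qed.

(** On polynomials [raise k] is [2 q X k - k'], so [X p] equals [raise (p / (2 q))] plus
    [p' / (2 q)], and the recursion continues with [p'], of smaller degree. *)
Lemma ground_raise_decomposition f :
  exists b k, f = b *: (1 : V) + (- 'i *: momentum k + q *: position k).
Proof.
have [n] := ubnP (size f); elim: n f => // n IH f fn.
elim/poly_ind: f fn => [|p c _] fn.
  by exists 0, 0; rewrite raiseE deriv0 mulr0 scale0r !scaler0 oppr0 !addr0.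
have [->|p0] := eqVneq p 0.
  exists c, 0; rewrite raiseE deriv0 mulr0 mul0r add0r !scaler0 oppr0 !addr0.
  by rewrite -mul_polyC mulr1.
have q2 : q *+ 2 != 0 by rewrite mulrn_eq0 q_neq0.
have [|b [k bk]] := IH ((q *+ 2)^-1 *: p^`()).
  apply: leq_ltn_trans (size_scale_leq _ _) _.
  apply: (@leq_trans (size p)); first exact: lt_size_deriv.
  by move: fn; rewrite size_MXaddC (negbTE p0) /= ltnS => /ltnW.
exists (c + b), ((q *+ 2)^-1 *: p + k).
move: bk; rewrite !raiseE => bk.
rewrite poly.derivD derivZ mulrDr -scalerAr !scalerDr scalerA divff// scale1r.
rewrite opprD scalerDl -addrA [b *: 1 + _]addrC.
have -> : b *: 1 = (q *+ 2)^-1 *: p^`() - (- k^`() + (q *+ 2) *: ('X * k)).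
  by rewrite bk addrK.
rewrite -mul_polyC mulr1 (mulrC p).
move: ((q *+ 2)^-1 *: p^`()) (k^`()) ('X * k) => u v w; rewrite -!mul_polyC; ring.
Qed.

(** On monomials [H] is triangular: ['X^n] goes to [q (2 n + 1) 'X^n] minus a multiple of
    ['X^(n-2)]. Away from the eigenvalues the leading coefficient can be matched and the degree
    lowered. *)
Lemma oscillator_surjective (z : R[i]) f : (forall n, z != q * (2 * n + 1)%:R) ->
  exists g, H g - z *: g = f.
Proof.
move=> zn; have [n] := ubnP (size f); elim: n f => // -[|n] IH f fn.
  by exists 0; move: fn; rewrite ltnS leqn0 size_poly_eq0 oscillatorE deriv0 linear0
    mulr0 !scaler0 oppr0 !addr0 => /eqP ->.
pose d := f`_n / (q * (2 * n + 1)%:R - z).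
have [|g gP] := IH (H (d *: 'X^n) - z *: (d *: 'X^n) - f); last first.
  by exists (d *: 'X^n - g); rewrite oscillator_shiftB gP subKr.
rewrite -size_polyN opprB.
have fn' : (size f <= n.+1)%N by rewrite -ltnS.
have lam0 : q * (2 * n + 1)%:R - z != 0 by rewrite subr_eq0 eq_sym.
have XXn : 'X * ('X^n)^`() = n%:R *: 'X^n :> V.
  rewrite derivXn; case: (n) => [|k]; first by rewrite mulr0n mulr0 scale0r.
  by rewrite -mulr_natl mulrCA -exprS scaler_nat mulr_natl.
have -> : H (d *: 'X^n) - z *: (d *: 'X^n) = f`_n *: 'X^n - d *: ('X^n)^`()^`().
  rewrite oscillatorE !derivZ -scalerAr XXn !scalerA.
  have -> : f`_n = d * (q * (2 * n + 1)%:R - z) by rewrite divfK.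
  rewrite natrD natrM mulrBr !mulrDr !scalerBl !scalerDl mulr1.
  rewrite -!mul_polyC !rmorphM /= rmorphMn ?rmorph_nat; ring.
apply/leq_sizeP => j nj; rewrite !(coefB, coefZ, coefXn) !coef_deriv !coefXn.
rewrite (gtn_eqF (_ : n < j.+2)%N) ?ltnS ?(leq_trans nj)// ?mul0rn !mulr0 subr0.
have [->|jn] := eqVneq j n; first by rewrite mulr1 subrr.
rewrite mulr0 subr0; apply: (leq_sizeP _ _ fn'); by rewrite ltn_neqAle eq_sym jn.
Qed.
End PolynomialModel.

(** * The quadratic form and its values on the core *)

Section FormTheory.
Variable R : realType.
Local Notation mu := (@lebesgue_measure R).
Local Notation fct := (R -> R[i]).
Local Notation ip := (@L2ip R).
Local Notation nrm := (hnorm ip).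
Local Notation ipP := (@L2ipP R).

Lemma hnorm_eq0 (f : L2T R) : nrm f = 0 <-> ae_eq mu setT f (cst 0).
Proof.
have i2 := L2_sqr_integrable (L2TP f).
have /integrableP[m2 _] := i2.
have n2 : nrm f ^+ 2 = \int[mu]_x (normc (f x) ^+ 2) by rewrite (hnorm_sqr ipP) Re_L2inner_self.
have abs2 : (\int[mu]_x `|(normc (f x) ^+ 2)%:E| = (nrm f ^+ 2)%:E)%E.
  rewrite n2 /Rintegral fineK; last exact: integrable_fin_num.
  by apply: eq_integral => x _; rewrite gee0_abs// lee_fin sqr_ge0.
have [to_ae of_ae] := ae_eq_integral_abs mu measurableT m2.
split=> [f0|f0].
  have := to_ae; rewrite abs2 f0 expr0n => /(_ erefl).
  apply: (@filterS _ _ (ae_filter_ringOfSetsType mu)) => x /(_ I) [] /eqP.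
  by rewrite sqrf_eq0 normc_eq0' => /eqP.
apply/eqP; rewrite -sqrf_eq0; apply/eqP.
have : (nrm f ^+ 2)%:E = 0%E :> \bar R; last by case.
rewrite -abs2; apply: of_ae.
apply: (@filterS _ _ (ae_filter_ringOfSetsType mu) _ _ _ f0) => x H _.
by rewrite /= (H I) ComplexField.Normc.normc0 expr0n.
Qed.

Lemma ae_eqP (f g : L2T R) : ae_eq mu setT f g <-> nrm (f - g) = 0.
Proof.
rewrite hnorm_eq0; split; apply: (@filterS _ _ (ae_filter_ringOfSetsType mu)) => x H _.
  by rewrite -[LHS]/(L2val f x - L2val g x) (H I) subrr.
by apply/eqP; rewrite -subr_eq0; apply/eqP; exact: H.
Qed.

Lemma ip_eq0l (f g : L2T R) : nrm f = 0 -> ip f g = 0.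
Proof.
move=> f0; apply/eqP; rewrite -normc_eq0' eq_le normc_ge0 andbT.
by apply: le_trans (cauchy_schwarz ipP _ _) _; rewrite f0 mul0r.
Qed.

Lemma ip_congr (f f' g g' : L2T R) : nrm (f - f') = 0 -> nrm (g - g') = 0 ->
  ip f g = ip f' g'.
Proof.
move=> f0 g0; rewrite -(subrK f' f) (ipDl ipP) (ip_eq0l _ f0) add0r.
rewrite (ipC ipP g f') (ipC ipP g' f') -(subrK g' g) (ipDl ipP) (ip_eq0l _ g0) add0r//.
Qed.

Lemma weak_derivative_spec (f : fct) : W12 f ->
  L2 (weak_derivative f) /\ is_weak_derivative f (weak_derivative f).
Proof. by move=> [_ fd]; exact: (xgetPex (cst 0) fd). Qed.

Lemma core_total (q : R[i]) (Re_q : 0 < Re q) (f : L2T R) : `|Im q| < Re q ->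
  (forall p, ip f (coreT Re_q p) = 0) -> nrm f = 0.
Proof.
by move=> Im_q f0; apply/hnorm_eq0; exact: core_orthogonal_ae_eq0 Re_q Im_q (L2TP f) f0.
Qed.

Lemma Cintegral0 : Cintegral (fun _ : R => 0) = 0 :> R[i].
Proof. by rewrite /Cintegral /Rintegral /= !integral0. Qed.

Lemma ip0l (f : L2T R) : ip 0 f = 0.
Proof. by rewrite -(scale0r 0) (ipZl ipP) mul0r. Qed.

(** The difference is a weak derivative of 0, hence orthogonal to the core. Any admissible parameter
    would do; [q = 1] is taken. *)
Lemma weak_derivative_unique (f : fct) (g1 g2 : L2T R) :
  is_weak_derivative f g1 -> is_weak_derivative f g2 -> nrm (g1 - g2) = 0.
Proof.
move=> d1 d2.
have Re1 : 0 < Re (1 : R[i]) by exact: ltr01.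
apply: (core_total (Re_q := Re1)) => [|p]; first by rewrite /= normr0 ltr01.
have wd0 : is_weak_derivative (L2val (0 : L2T R)) (L2val (g1 - g2)).
  move=> phi tphi; have phiL := L2_real (test_function_Lfun2 tphi).
  have E1 := d1 _ tphi; have E2 := d2 _ tphi.
  have -> : Cintegral (fun x => L2val 0 x * (derive1 phi x)%:C) = 0.
    by rewrite -[RHS]Cintegral0; apply: eq_Cintegral => x; rewrite /= mul0r.
  have -> : Cintegral (fun x => L2val (g1 - g2) x * (phi x)%:C) =
      Cintegral (fun x => g1 x * (phi x)%:C - g2 x * (phi x)%:C).
    by apply: eq_Cintegral => x; rewrite /= mulrBl.
  rewrite CintegralB; [|exact: L2_mul (L2TP _) phiL|exact: L2_mul (L2TP _) phiL].
  by rewrite -[Cintegral (fun x => g1 x * _)]opprK -E1 E2 opprK subrr oppr0.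
have := core_integration_by_parts p Re1 (L2TP 0) (L2TP (g1 - g2)) wd0.
by move/eqP; rewrite -[L2inner (L2val 0) _]/(ip 0 (coreT Re1 (pderiv 1 p))) ip0l
  eq_sym oppr_eq0 => /eqP.
Qed.

Definition xmul (f : fct) : fct := fun x => x%:C * f x.

Lemma ho_domain_xmul (f : fct) : ho_form_domain f <-> W12 f /\ L2 (xmul f).
Proof.
split=> [[fW [fL ix]]|[fW xL]].
  split=> //; have [f1 f2] := fL.
  have [/Lfun2P[m1 _] /Lfun2P[m2 _]] := fL.
  have /integrableP[/measurable_EFinP mn _] := L2_sqr_integrable fL.
  have mx : measurable_fun setT (fun x : R => x ^+ 2 * normc (f x) ^+ 2).
    by apply: measurable_funM => //; exact: measurable_funX.
  have dom (u : R -> R) : measurable_fun setT u -> (forall x, `|u x| <= normc (f x)) ->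
      (fun x => x * u x) \in Lfun mu 2%:E.
    move=> mu_ ule; apply/Lfun2_sqint; split; first by apply: measurable_funM.
    apply: le_lt_trans ix; apply: ge0_le_integral => //.
    - by move=> x _; rewrite lee_fin sqr_ge0.
    - by apply/measurable_EFinP; apply: measurable_funX; exact: measurable_funM.
    - by apply/measurable_EFinP.
    - move=> x _; rewrite lee_fin exprMn ler_wpM2l ?sqr_ge0//.
      by rewrite -(real_normK (num_real (u x))) ler_pXn2r ?nnegrE ?normc_ge0.
  split; [apply: (Lfun2_ext (dom _ m1 _))|apply: (Lfun2_ext (dom _ m2 _))] => x.
  - exact: normr_Re_le.
  - by rewrite /= /xmul !ReImE /=; ring.
  - exact: normr_Im_le.
  - by rewrite /= /xmul !ReImE /=; ring.
split=> //; split; first by case: fW.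
have /integrableP[_] := L2_sqr_integrable xL; apply: le_lt_trans.
rewrite le_eqVlt; apply/orP; left; apply/eqP; apply: eq_integral => x _ /=.
rewrite ger0_norm ?sqr_ge0// /xmul ComplexField.Normc.normcM normc_real exprMn.
by rewrite real_normK// num_real.
Qed.

(** [weak_derivative] is a choice; by uniqueness the form can be computed with any weak derivatives
    at hand. *)
Lemma ho_formE (c : R[i]) (f g : fct) (f' g' xf xg : L2T R) :
  W12 f -> W12 g -> is_weak_derivative f f' -> is_weak_derivative g g' ->
  xmul f =1 xf -> xmul g =1 xg ->
  ho_form c f g = ip f' g' + c * ip xf xg.
Proof.
move=> fW gW df dg fx gx.
have [f'L f'd] := weak_derivative_spec fW; have [g'L g'd] := weak_derivative_spec gW.
congr (_ + c * _).
  rewrite -[LHS]/(ip (toL2 f'L) (toL2 g'L)); apply: ip_congr.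
    exact (@weak_derivative_unique f (toL2 f'L) f' f'd df).
  exact (@weak_derivative_unique g (toL2 g'L) g' g'd dg).
apply: eq_Cintegral => x; rewrite -fx -gx /xmul.
by rewrite rmorphXn; apply: complexP; rewrite !ReImE /=; ring.
Qed.

Section WithCore.
Variable q : R[i].
Hypothesis Re_q : 0 < Re q.
Local Notation coreT := (coreT Re_q).
Local Notation H := (@oscillator R {poly R[i]} (momentum q) (@position R) (q ^+ 2)).

Lemma core_W12 p : W12 (coreT p).
Proof.
split; first exact: L2TP.
by exists (coreT (pderiv q p)); split; [exact: L2TP|exact: core_weak_derivative].
Qed.

Lemma xmul_core p : xmul (coreT p) =1 coreT (position p).
Proof. by move=> x; rewrite /= /xmul /core hornerM hornerX mulrA. Qed.

Lemma core_domain p : ho_form_domain (coreT p).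
Proof.
apply/ho_domain_xmul; split; first exact: core_W12.
by rewrite (_ : xmul _ = coreT (position p)); [exact: L2TP|apply/funext/xmul_core].
Qed.

Lemma core_ip_pderiv p (g g' : L2T R) : is_weak_derivative g g' ->
  ip g' (coreT p) = - ip g (coreT (pderiv q p)).
Proof.
move=> dg; apply/eqP; rewrite -eqr_oppLR; apply/eqP.
exact: esym (core_integration_by_parts p Re_q (L2TP g) (L2TP g') dg).
Qed.

Lemma core_oscillator p :
  coreT (H p) = - coreT (pderiv q (pderiv q p)) + q ^+ 2 *: coreT (position (position p)).
Proof.
rewrite /oscillator /= momentum2.
move: (pderiv q (pderiv q p)) (position (position p)) => u v.
by rewrite linearD linearN linearZ.
Qed.

Lemma ho_form_core p (g : L2T R) : ho_form_domain g ->
  ho_form (q ^+ 2) (coreT p) g = ip (coreT (H p)) g.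
Proof.
move=> /ho_domain_xmul[gW xgL]; have [g'L dg] := weak_derivative_spec gW.
rewrite (@ho_formE _ _ _ (coreT (pderiv q p)) (toL2 g'L) (coreT (position p)) (toL2 xgL)) //;
  first last.
- exact: xmul_core.
- exact: core_weak_derivative.
- exact: core_W12.
rewrite core_oscillator (ipDl ipP) (ipNl ipP) (ipZl ipP); congr (_ + _ * _).
  by rewrite (ipC ipP (toL2 g'L)) (@core_ip_pderiv _ g (toL2 g'L) dg) (ipC ipP g) rmorphN.
by apply: eq_Cintegral => x; rewrite -(xmul_core (position p)) /xmul mul_realCJ.
Qed.

(** The inner product is conjugate linear on the right, whence the conjugate coefficient. Taken at
    [q^*], this is the form of the original oscillator against the core of its adjoint. *)
Lemma ho_form_core_r p (f : L2T R) : ho_form_domain f ->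
  ho_form ((q ^+ 2)^*) f (coreT p) = ip f (coreT (H p)).
Proof.
move=> /ho_domain_xmul[fW xfL]; have [f'L df] := weak_derivative_spec fW.
rewrite (@ho_formE _ _ _ (toL2 f'L) (coreT (pderiv q p)) (toL2 xfL) (coreT (position p))) //;
  first last.
- exact: xmul_core.
- exact: core_weak_derivative.
- exact: core_W12.
rewrite core_oscillator (ipDr ipP) (ipNr ipP) (ipZr ipP); congr (_ + _ * _).
  by rewrite (@core_ip_pderiv _ f (toL2 f'L) df).
by apply: eq_Cintegral => x; rewrite -(xmul_core (position p)) /xmul mul_realCJ.
Qed.
End WithCore.

End FormTheory.

(** * The resolvent *)

Section ResolventExistence.
Variable R : realType.
Local Notation fct := (R -> R[i]).
Local Notation ip := (@L2ip R).
Local Notation nrm := (hnorm ip).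
Local Notation ipP := (@L2ipP R).

Lemma eq_of_half_pow (a b : R[i]) (C : R) :
  (forall n, normc (a - b) <= C * 2^-1 ^+ n) -> a = b.
Proof.
move=> /le0_of_half_pow ab; apply/eqP; rewrite -subr_eq0 -normc_eq0'.
by rewrite eq_le ab normc_ge0.
Qed.

Lemma L2_multiplier (b f : fct) : measurable_fun setT (@complex.Re R \o b) ->
  measurable_fun setT (@complex.Im R \o b) -> (forall x, normc (b x) <= 1) ->
  L2 f -> L2 (fun x => b x * f x).
Proof.
move=> mRe mIm b1 fL; have [/Lfun2P[m1 _] /Lfun2P[m2 _]] := fL.
have bf x : normc (b x * f x) <= `|normc (f x)|.
  rewrite ger0_norm ?normc_ge0// ComplexField.Normc.normcM.
  by rewrite ler_piMl ?normc_ge0.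
split; apply: (Lfun2_dominated _ (normc_Lfun2 fL)) => [|x].
- rewrite (_ : _ \o _ = (fun x => Re (b x) * Re (f x) - Im (b x) * Im (f x))).
    by apply: measurable_funB; exact: measurable_funM.
  by apply/funext => x /=; rewrite ReM.
- exact: le_trans (normr_Re_le _) (bf x).
- rewrite (_ : _ \o _ = (fun x => Re (b x) * Im (f x) + Im (b x) * Re (f x))).
    by apply: measurable_funD; exact: measurable_funM.
  by apply/funext => x /=; rewrite ImM.
- exact: le_trans (normr_Im_le _) (bf x).
Qed.

Lemma hnorm_le_pointwise (f g : L2T R) : (forall x, normc (f x) <= normc (g x)) ->
  nrm f <= nrm g.
Proof.
move=> fg; rewrite /hnorm !Re_L2inner_self ler_wsqrtr//; apply: le_Rintegral => //.
- exact: L2_sqr_integrable (L2TP f).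
- exact: L2_sqr_integrable (L2TP g).
- by move=> x _; rewrite ler_pXn2r ?nnegrE ?normc_ge0.
Qed.

(** Both [1 / (x + i)] and [x / (x + i)] are bounded by 1, so a limit of [(x + i) f_n] yields
    compatible limits of [f_n] and of [x f_n]. *)
Definition inv_shift (x : R) : R[i] := (x%:C + 'i)^-1.

Lemma shift_neq0 (x : R) : x%:C + 'i != 0 :> R[i].
Proof.
apply/eqP => /(congr1 (@complex.Im R)); rewrite ImD /= add0r => /eqP.
by rewrite oner_eq0.
Qed.

Lemma normc_shift_sqr (x : R) : normc (x%:C + 'i) ^+ 2 = x ^+ 2 + 1.
Proof. by rewrite normc_sqr !ReImE /= addr0 add0r expr1n. Qed.

Lemma normc_inv_shift (x : R) : normc (inv_shift x) <= 1.
Proof.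
rewrite /inv_shift ComplexField.Normc.normcV ?shift_neq0//.
rewrite invf_le1 ?normc_gt0 ?shift_neq0//.
rewrite -(ler_pXn2r (_ : 0 < 2)%N) ?nnegrE ?normc_ge0 ?ler01//.
by rewrite normc_shift_sqr expr1n lerDr sqr_ge0.
Qed.

Lemma normc_mul_inv_shift (x : R) : normc (x%:C * inv_shift x) <= 1.
Proof.
rewrite /inv_shift ComplexField.Normc.normcM ComplexField.Normc.normcV ?shift_neq0//.
rewrite ler_pdivrMr ?normc_gt0 ?shift_neq0// mul1r normc_real.
rewrite -(ler_pXn2r (_ : 0 < 2)%N) ?nnegrE ?normc_ge0//.
by rewrite normc_shift_sqr real_normK ?num_real// lerDl ler01.
Qed.

Lemma measurable_sqr_shift : measurable_fun setT (fun x : R => (x ^+ 2 + 1)^-1).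
Proof.
apply: continuous_measurable_fun => x; apply: cvgV.
  by rewrite gt_eqF// ltr_wpDl ?sqr_ge0.
by apply: cvgD; [exact: exprn_continuous|exact: cvg_cst].
Qed.

Lemma inv_shiftE : inv_shift = (fun x => (x * (x ^+ 2 + 1)^-1) +i* (- (x ^+ 2 + 1)^-1)).
Proof.
apply/funext => x; apply: complexP; rewrite /inv_shift ?ReV ?ImV !ReImE /=.
  by rewrite addr0 add0r expr1n.
by rewrite addr0 add0r expr1n mulN1r.
Qed.

Lemma measurable_inv_shift : measurable_fun setT (@complex.Re R \o inv_shift) /\
  measurable_fun setT (@complex.Im R \o inv_shift).
Proof.
rewrite inv_shiftE; split.
  by apply: measurable_funM => //; exact: measurable_sqr_shift.
by apply: measurableT_comp => //; exact: measurable_sqr_shift.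
Qed.

Lemma L2_inv_shift (f : fct) : L2 f -> L2 (fun x => inv_shift x * f x).
Proof.
have [m1 m2] := measurable_inv_shift.
exact: L2_multiplier m1 m2 normc_inv_shift.
Qed.

Lemma L2_mul_inv_shift (f : fct) : L2 f -> L2 (xmul (fun x => inv_shift x * f x)).
Proof.
have [m1 m2] := measurable_inv_shift => fL.
rewrite (_ : xmul _ = (fun x => (x%:C * inv_shift x) * f x)); last first.
  by apply/funext => x; rewrite /xmul mulrA.
apply: L2_multiplier normc_mul_inv_shift fL.
- rewrite (_ : _ \o _ = (fun x => x * Re (inv_shift x))).
    exact: measurable_funM.
  by apply/funext => x; rewrite -[LHS]/(Re (x%:C * inv_shift x)) ReM [Im x%:C]/= mul0r subr0.
- rewrite (_ : _ \o _ = (fun x => x * Im (inv_shift x))).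
    exact: measurable_funM.
  by apply/funext => x; rewrite -[LHS]/(Im (x%:C * inv_shift x)) ImM [Im x%:C]/= mul0r addr0.
Qed.

(* The closedness of the form: the limit of [f_n] is recovered from the limit
   [K] of [(x + i) f_n] as [K / (x + i)]. *)
Lemma weighted_limit (f xf : nat -> L2T R) (K : L2T R) :
  (forall n x, xf n x = x%:C * f n x) ->
  (forall n, nrm (K - (xf n + 'i *: f n)) <= 2 * 2^-1 ^+ n) ->
  exists F xF : L2T R, [/\ xmul F =1 xF, forall n, nrm (F - f n) <= 2 * 2^-1 ^+ n &
    forall n, nrm (xF - xf n) <= 2 * 2^-1 ^+ n].
Proof.
move=> xfE Klim.
exists (toL2 (L2_inv_shift (L2TP K))), (toL2 (L2_mul_inv_shift (L2TP K))).
have KE n x : L2val (K - (xf n + 'i *: f n)) x = K x - (x%:C + 'i) * f n x.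
  by rewrite -[LHS]/(K x - (xf n x + 'i * f n x)) xfE mulrDl.
have fE n x : f n x = inv_shift x * ((x%:C + 'i) * f n x).
  by rewrite /inv_shift mulKf ?shift_neq0.
split=> // n; apply: le_trans (Klim n); apply: hnorm_le_pointwise => x; rewrite KE.
- rewrite -[L2val (_ - _) x]/(inv_shift x * K x - f n x) {1}fE -mulrBr.
  by rewrite ComplexField.Normc.normcM ler_piMl ?normc_ge0 ?normc_inv_shift.
- rewrite -[L2val (_ - _) x]/(xmul (fun x => inv_shift x * K x) x - xf n x).
  rewrite /xmul xfE {1}fE -!mulrBr mulrA.
  by rewrite ComplexField.Normc.normcM ler_piMl ?normc_ge0 ?normc_mul_inv_shift.
Qed.

(** Weak differentiation is closed: both sides of its definition are inner products with fixed
    square integrable functions. *)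
Lemma weak_derivative_limit (f f' : nat -> L2T R) (F F' : L2T R) (C : R) :
  (forall n, is_weak_derivative (f n) (f' n)) ->
  (forall n, nrm (F - f n) <= C * 2^-1 ^+ n) ->
  (forall n, nrm (F' - f' n) <= C * 2^-1 ^+ n) -> is_weak_derivative F F'.
Proof.
move=> fd Flim F'lim phi tphi.
pose u := toL2 (L2_real (test_function_Lfun2 tphi)).
pose u' := toL2 (L2_real (test_function_Lfun2 (test_function_derive1 tphi))).
have E (g : L2T R) : Cintegral (fun x => g x * (phi x)%:C) = ip g u.
  by apply: eq_Cintegral => x /=; apply: complexP; rewrite !ReImE /= oppr0.
have E' (g : L2T R) : Cintegral (fun x => g x * (derive1 phi x)%:C) = ip g u'.
  by apply: eq_Cintegral => x /=; apply: complexP; rewrite !ReImE /= oppr0.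
rewrite E E'; apply: (@eq_of_half_pow _ _ (C * nrm u' + C * nrm u)) => n.
have fdn : ip (f n) u' = - ip (f' n) u by rewrite -E -E'; exact: fd.
have -> : ip F u' - - ip F' u = ip (F - f n) u' + ip (F' - f' n) u.
  by rewrite !(ipBl ipP) fdn; ring.
apply: (le_trans (le_normcD _ _)); rewrite mulrDl.
apply: lerD; apply: (le_trans (cauchy_schwarz ipP _ _)).
  by rewrite mulrAC ler_wpM2r ?hnorm_ge0.
by rewrite mulrAC ler_wpM2r ?hnorm_ge0.
Qed.
End ResolventExistence.

Section Resolvent.
Variable R : realType.
Local Notation ip := (@L2ip R).
Local Notation nrm := (hnorm ip).
Local Notation ipP := (@L2ipP R).
Variables (q z : R[i]).
Hypothesis Re_q : 0 < Re q.
Hypothesis Im_q : `|Im q| < Re q.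
Hypothesis z_neq : forall n, z != q * (2 * n + 1)%:R.
Local Notation coreT := (coreT Re_q).
Local Notation H := (@oscillator R {poly R[i]} (momentum q) (@position R) (q ^+ 2)).
Variable M : R.
Hypothesis M_ge0 : 0 <= M.
Hypothesis M_bound : forall p, nrm (coreT p) <= M * nrm (coreT (H p - z *: p)).

Let Re_c : 0 < Re (q ^+ 2).
Proof.
rewrite expr2 ReM -!expr2 -[Im q ^+ 2]real_normK ?num_real//.
by rewrite subr_gt0 ltr_pXn2r ?nnegrE// ltW.
Qed.

Lemma hnorm_momentum p : nrm (coreT (momentum q p)) = nrm (coreT (pderiv q p)).
Proof.
rewrite /momentum linearZ /= (hnormZ ipP) normcN.
by rewrite /= expr0n expr1n add0r sqrtr1 mul1r.
Qed.

Lemma coreT_shift p : coreT (H p) = coreT (H p - z *: p) + z *: coreT p.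
Proof. by move: (H p) => u; rewrite coreTB coreTZ subrK. Qed.

Lemma energy_identity p :
  nrm (coreT (pderiv q p)) ^+ 2 + Re (q ^+ 2) * nrm (coreT (position p)) ^+ 2 <=
  nrm (coreT (H p - z *: p)) * nrm (coreT p) + normc z * nrm (coreT p) ^+ 2.
Proof.
have ReMr (a : R[i]) (t : R) : Re (a * t%:C) = Re a * t.
  by rewrite ReM /= mulr0 subr0.
have E : core_ip Re_q (H p) p = ip (coreT (H p - z *: p)) (coreT p) + z * ip (coreT p) (coreT p).
  by rewrite /core_ip {1}(coreT_shift p) (ipDl ipP) (ipZl ipP).
have := ip_oscillator (core_ipP Re_q) (momentum_sym Re_q) (position_sym Re_q) (q ^+ 2) p.
rewrite E (ip_self ipP) !(hnorm_core Re_q) hnorm_momentum => /(congr1 (@complex.Re R)).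
rewrite !ReD !ReMr => <-; apply: lerD; first exact: (Re_ip_le ipP).
rewrite ler_wpM2r ?sqr_ge0//.
exact: le_trans (ler_norm _) (normr_Re_le _).
Qed.

(** The real part of the form is coercive because [Re c > 0], so the bound on [f] extends to [f']
    and [x f], the norms in which limits must be taken. *)
Lemma energy_bound : exists B : R, 1 <= B /\ forall p,
  let N := nrm (coreT (H p - z *: p)) in
  [/\ nrm (coreT p) <= B * N, nrm (coreT (pderiv q p)) <= B * N &
      nrm (coreT (position p)) <= B * N].
Proof.
have [K KE] : exists K, K = M + normc z * M ^+ 2 by exists (M + normc z * M ^+ 2).
pose B := 1 + K + K / Re (q ^+ 2) + M.
have K0 : 0 <= K by rewrite KE addr_ge0// mulr_ge0 ?normc_ge0 ?sqr_ge0.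
have Kc : 0 <= K / Re (q ^+ 2) by rewrite divr_ge0// ltW.
have B1 : 1 <= B by rewrite /B -!addrA lerDl !addr_ge0.
have MB : M <= B by rewrite /B lerDr !addr_ge0 ?ler01.
have KB : K <= B by rewrite /B -!addrA addrCA lerDl !addr_ge0 ?ler01.
have KcB : K / Re (q ^+ 2) <= B by rewrite /B -addrA addrCA lerDl !addr_ge0 ?ler01.
exists B; split; first exact: B1.
move=> p N.
have N0 : 0 <= N by exact: hnorm_ge0.
have f0 : 0 <= nrm (coreT p) by exact: hnorm_ge0.
have fN : nrm (coreT p) <= M * N by exact: M_bound.
have E : nrm (coreT (pderiv q p)) ^+ 2 + Re (q ^+ 2) * nrm (coreT (position p)) ^+ 2 <=
    K * N ^+ 2.
  apply: (le_trans (energy_identity p)); rewrite KE mulrDl; apply: lerD.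
    by rewrite mulrC expr2 mulrA ler_wpM2r.
  rewrite -mulrA ler_wpM2l ?normc_ge0// -exprMn ler_pXn2r ?nnegrE//.
  exact: mulr_ge0.
have BN : 0 <= B * N by rewrite mulr_ge0// (le_trans _ B1).
have BB : B <= B ^+ 2 by rewrite expr2 ler_peMl// (le_trans _ B1).
have N2 := sqr_ge0 N.
split.
- by apply: (le_trans fN); rewrite ler_wpM2r.
- apply: le_of_sqr_le => //; rewrite exprMn.
  apply: (@le_trans _ _ (K * N ^+ 2)).
    by apply: le_trans E; rewrite lerDl mulr_ge0 ?sqr_ge0// ltW.
  by rewrite ler_wpM2r// (le_trans KB).
- apply: le_of_sqr_le => //; rewrite exprMn.
  rewrite -(ler_pM2l Re_c).
  apply: (@le_trans _ _ (K * N ^+ 2)).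
    by apply: le_trans E; rewrite lerDr sqr_ge0.
  rewrite [leRHS]mulrA ler_wpM2r// [leRHS]mulrC -ler_pdivrMr// (le_trans KcB)//.
Qed.

Lemma approximation (h : L2T R) (s : R) : 0 < s ->
  exists p : nat -> {poly R[i]}, forall n, nrm (h - coreT (p n)) <= s * 2^-1 ^+ n.
Proof.
move=> s0.
have tot (v : L2T R) : (forall p, ip v (coreT p) = 0) -> nrm v = 0.
  exact: core_total.
have D n : exists p, nrm (h - coreT p) <= s * 2^-1 ^+ n.
  apply: (dense_of_orthogonal ipP (@L2_rapidly_complete R) tot).
  by rewrite mulr_gt0// half_pow_gt0.
by exists (fun n => projT1 (cid (D n))) => n; exact: projT2 (cid (D n)).
Qed.
End Resolvent.

Section ResolventExists.
Variable R : realType.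
Local Notation ip := (@L2ip R).
Local Notation nrm := (hnorm ip).
Local Notation ipP := (@L2ipP R).

Lemma form_limit (c : R[i]) (f' xf k : nat -> L2T R) (F' xF K g' xg g : L2T R) (C : R) :
  (forall n, nrm (F' - f' n) <= C * 2^-1 ^+ n) ->
  (forall n, nrm (xF - xf n) <= C * 2^-1 ^+ n) ->
  (forall n, nrm (K - k n) <= C * 2^-1 ^+ n) ->
  (forall n, ip (f' n) g' + c * ip (xf n) xg = ip (k n) g) ->
  ip F' g' + c * ip xF xg = ip K g.
Proof.
move=> lim1 lim2 lim3 E.
apply: (@eq_of_half_pow _ _ _ (C * nrm g' + normc c * (C * nrm xg) + C * nrm g)) => n.
have -> : ip F' g' + c * ip xF xg - ip K g =
    ip (F' - f' n) g' + c * ip (xF - xf n) xg - ip (K - k n) g.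
  by rewrite !(ipBl ipP) -E; ring.
have bnd (a b : L2T R) : nrm a <= C * 2^-1 ^+ n ->
    normc (ip a b) <= C * nrm b * 2^-1 ^+ n.
  move=> aC; apply: (le_trans (cauchy_schwarz ipP _ _)).
  by rewrite mulrAC ler_wpM2r ?hnorm_ge0.
apply: (le_trans (le_normcD _ _)); rewrite normcN mulrDl; apply: lerD; last exact: bnd.
apply: (le_trans (le_normcD _ _)); rewrite mulrDl; apply: lerD; first exact: bnd.
rewrite ComplexField.Normc.normcM -mulrA ler_wpM2l ?normc_ge0//.
exact: bnd.
Qed.

Variables (q z : R[i]).
Hypothesis Re_q : 0 < Re q.
Hypothesis Im_q : `|Im q| < Re q.
Hypothesis z_neq : forall n, z != q * (2 * n + 1)%:R.
Local Notation coreT := (coreT Re_q).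
Local Notation H := (@oscillator R {poly R[i]} (momentum q) (@position R) (q ^+ 2)).
Variable M : R.
Hypothesis M_ge0 : 0 <= M.
Hypothesis M_bound : forall p, nrm (coreT p) <= M * nrm (coreT (H p - z *: p)).

(** The right-hand side is approximated by core functions and the equation is solved exactly on the
    core; the energy bound then makes the solutions rapidly Cauchy together with [f'] and [x f]. *)
Lemma core_solutions (h : L2T R) : exists r : nat -> {poly R[i]},
  [/\ forall n, nrm (h - coreT (H (r n) - z *: r n)) <= 2^-1 ^+ n,
      forall n, nrm (coreT (r n.+1 - r n)) <= 2^-1 * 2^-1 ^+ n,
      forall n, nrm (coreT (pderiv q (r n.+1 - r n))) <= 2^-1 * 2^-1 ^+ n &
      forall n, nrm (coreT (position (r n.+1 - r n))) <= 2^-1 * 2^-1 ^+ n].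
Proof.
have [B [B1 Bb]] := energy_bound Im_q M_ge0 M_bound.
have B0 : 0 < B by apply: lt_le_trans B1.
(* Two approximation errors and the factor [B] give increments [2^-1 * 2^-1 ^+ n]; the spare half
   lets the increments of [x f] and of [f] be added. *)
pose s := (4 * B)^-1.
have s0 : 0 < s by rewrite invr_gt0 mulr_gt0.
have s1 : s <= 1 by rewrite invf_le1 ?mulr_gt0//; lra.
have Bs : B * (2 * s) = 2^-1 by rewrite /s; field; rewrite gt_eqF.
have [p pP] := approximation Re_q Im_q h s0.
pose r n := projT1 (cid (oscillator_surjective (p n) z_neq)).
have rE n : H (r n) - z *: r n = p n by exact: (projT2 (cid (oscillator_surjective (p n) z_neq))).
have dE n : H (r n.+1 - r n) - z *: (r n.+1 - r n) = p n.+1 - p n.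
  by rewrite -!rE oscillator_shiftB.
have dN n : B * nrm (coreT (H (r n.+1 - r n) - z *: (r n.+1 - r n))) <= 2^-1 * 2^-1 ^+ n.
  rewrite dE -{1}Bs -mulrA ler_pM2l// coreTB.
  have -> : coreT (p n.+1) - coreT (p n) = (h - coreT (p n)) - (h - coreT (p n.+1)).
    by rewrite opprB [RHS]addrC [RHS]addrA subrK.
  apply: (le_trans (hnormD ipP _ _)); rewrite (hnormN ipP).
  apply: (le_trans (lerD (pP n) (pP n.+1))); rewrite exprS mulrCA -mulrA.
  have : 0 <= s * 2^-1 ^+ n by rewrite mulr_ge0 ?half_pow_ge0// ltW.
  by move: (s * _) => t; lra.
exists r; split=> n.
- by rewrite rE; apply: (le_trans (pP n)); rewrite ler_piMl ?half_pow_ge0.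
- by have [a _ _] := Bb (r n.+1 - r n); exact (le_trans a (dN n)).
- by have [_ a _] := Bb (r n.+1 - r n); exact (le_trans a (dN n)).
- by have [_ _ a] := Bb (r n.+1 - r n); exact (le_trans a (dN n)).
Qed.
End ResolventExists.

Section ResolventBound.
Variable R : realType.
Local Notation ip := (@L2ip R).
Local Notation nrm := (hnorm ip).
Local Notation ipP := (@L2ipP R).

Variables (q z : R[i]).
Hypothesis Re_q : 0 < Re q.
Hypothesis Im_q : `|Im q| < Re q.
Hypothesis z_neq : forall n, z != q * (2 * n + 1)%:R.
Local Notation coreT := (coreT Re_q).
Local Notation H := (@oscillator R {poly R[i]} (momentum q) (@position R) (q ^+ 2)).
Variable M : R.
Hypothesis M_ge0 : 0 <= M.
Hypothesis M_bound : forall p, nrm (coreT p) <= M * nrm (coreT (H p - z *: p)).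

(** A weak solution, obtained as the limit of exact core solutions in the form norm; the norm bound
    passes to the limit. *)
Lemma resolvent_exists (h : L2T R) : exists F : L2T R,
  [/\ ho_form_domain F,
      forall g : L2T R, ho_form_domain g -> ho_form (q ^+ 2) F g = ip (h + z *: F) g &
      nrm F <= M * nrm h].
Proof.
have [r [r_h r_d r_dd r_xd]] := core_solutions Im_q z_neq M_ge0 M_bound h.
pose f n := coreT (r n); pose f' n := coreT (pderiv q (r n)).
pose xf n := coreT (position (r n)); pose hn n := coreT (H (r n) - z *: r n).
have fE u v : coreT (pderiv q (u - v)) = coreT (pderiv q u) - coreT (pderiv q v).
  by rewrite pderivB coreTB.
have xfE u v : coreT (position (u - v)) = coreT (position u) - coreT (position v).
  by rewrite positionB coreTB.
have [F' F'lim] : exists F', forall n, nrm (F' - f' n) <= 2 * 2^-1 ^+ n.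
  apply: L2_rapidly_complete => n.
  rewrite /f' -fE.
  by apply: (le_trans (r_dd n)); rewrite ler_piMl ?half_pow_ge0//; lra.
have [K Klim] : exists K, forall n, nrm (K - (xf n + 'i *: f n)) <= 2 * 2^-1 ^+ n.
  apply: L2_rapidly_complete => n.
  have -> : xf n.+1 + 'i *: f n.+1 - (xf n + 'i *: f n) =
      coreT (position (r n.+1 - r n)) + 'i *: coreT (r n.+1 - r n).
    by rewrite xfE coreTB scalerBr opprD addrACA.
  apply: (le_trans (hnormD ipP _ _)); rewrite (hnormZ ipP).
  have -> : normc ('i : R[i]) = 1 by rewrite normcE' /= expr0n expr1n add0r sqrtr1.
  by have := lerD (r_xd n) (r_d n); rewrite mul1r; lra.
have [|F [xF [xFE Flim xFlim]]] := weighted_limit _ Klim.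
  by move=> n x; rewrite -[RHS]/(xmul (coreT (r n)) x) xmul_core.
have dF : is_weak_derivative F F'.
  by apply: weak_derivative_limit Flim F'lim => n; exact: core_weak_derivative.
have xFL : L2 (xmul F) by rewrite (_ : xmul F = xF); [exact: L2TP|apply/funext].
have FW : W12 F.
  by split; [exact: L2TP|exists F'; split => //; exact: L2TP].
exists F; split.
- exact/ho_domain_xmul.
- move=> g gD; have [gW xgL] := (ho_domain_xmul _).1 gD.
  have [g'L dg] := weak_derivative_spec gW.
  rewrite (@ho_formE _ _ _ _ F' (toL2 g'L) xF (toL2 xgL))//.
  (* A common constant for the rates of the derivatives, of [x f_n], and of [h_n + z f_n]; the last
     one is [1 + 2 |z|]. *)
  pose C : R := 1 + normc z * 2 + 2.
  have C2 : 2 <= C by rewrite /C lerDr addr_ge0 ?mulr_ge0 ?normc_ge0.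
  apply: (@form_limit _ _ f' xf (fun n => hn n + z *: f n) _ _ _ _ _ _ C) => n.
  + by apply: (le_trans (F'lim n)); rewrite ler_wpM2r ?half_pow_ge0.
  + by apply: (le_trans (xFlim n)); rewrite ler_wpM2r ?half_pow_ge0.
  + have -> : h + z *: F - (hn n + z *: f n) = (h - hn n) + z *: (F - f n).
      by rewrite scalerBr opprD addrACA.
    apply: (le_trans (hnormD ipP _ _)); rewrite (hnormZ ipP).
    apply: (@le_trans _ _ (2^-1 ^+ n + normc z * (2 * 2^-1 ^+ n))).
      by apply: lerD; [exact: r_h|rewrite ler_wpM2l ?normc_ge0].
    rewrite mulrA -{1}[2^-1 ^+ n]mul1r -mulrDl ler_wpM2r ?half_pow_ge0// /C lerDl.
    by [].
  + have := ho_form_core Re_q (r n) gD.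
    rewrite (@ho_formE _ _ _ _ (f' n) (toL2 g'L) (xf n) (toL2 xgL))//; last 3 first.
    * exact: core_W12.
    * exact: core_weak_derivative.
    * exact: xmul_core.
    by move=> ->; rewrite -coreT_shift.
- rewrite -subr_le0; apply: (@le0_of_half_pow _ _ (2 + M)) => n.
  have Fn : nrm F <= 2 * 2^-1 ^+ n + nrm (f n).
    rewrite -{1}(subrK (f n) F); apply: (le_trans (hnormD ipP _ _)).
    by rewrite lerD2r.
  have hn_le : nrm (hn n) <= nrm h + 2^-1 ^+ n.
    have -> : hn n = h - (h - hn n) by rewrite subKr.
    apply: (le_trans (hnormD ipP _ _)); rewrite (hnormN ipP) lerD2l; exact: r_h.
  have := ler_wpM2l M_ge0 hn_le; have := M_bound (r n); rewrite mulrDr mulrDl.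
  move: Fn; rewrite -/(f n) -/(hn n).
  lra.
Qed.
End ResolventBound.

Section HarmonicOscillatorResolvent.
Variable R : realType.
Local Notation mu := (@lebesgue_measure R).
Local Notation fct := (R -> R[i]).
Local Notation ip := (@L2ip R).
Local Notation nrm := (hnorm ip).
Local Notation ipP := (@L2ipP R).

Variables (q z : R[i]).
Hypothesis Re_q : 0 < Re q.
Hypothesis Im_q : `|Im q| < Re q.
Hypothesis z_neq : forall n, z != q * (2 * n + 1)%:R.

Let represents (f k : L2T R) := ho_form_domain f /\
  forall g : L2T R, ho_form_domain g -> ho_form (q ^+ 2) f g = ip k g.

Let Re_qJ : 0 < Re q^*. Proof. by rewrite ReJ. Qed.

(* Duality with the core functions of the adjoint oscillator, whose
   parameters are the conjugates of [q] and [z]. *)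
Lemma represents_adjoint (f k : L2T R) p : represents f k ->
  ip f (coreT Re_qJ (@oscillator R {poly R[i]} (momentum q^*) (@position R) (q^* ^+ 2) p
                     - z^* *: p)) = ip (k - z *: f) (coreT Re_qJ p).
Proof.
move=> [fD fk]; have := fk _ (core_domain Re_qJ p).
have {1}-> : q ^+ 2 = (q^* ^+ 2)^* by rewrite rmorphXn /= conjcK.
rewrite ho_form_core_r// => E.
rewrite (ipBl ipP) (ipZl ipP) -E (coreT_shift z^* Re_qJ) (ipDr ipP) (ipZr ipP).
apply/eqP; rewrite eq_sym subr_eq; apply/eqP; congr (_ + _ * _).
exact: conjcK.
Qed.

(** The adjoint operator shifted by [z^*] maps its core onto itself, so [f1 - f2] is orthogonal to
    all of that core, which is dense. *)
Lemma represents_unique (f1 f2 k1 k2 : L2T R) : represents f1 k1 -> represents f2 k2 ->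
  nrm ((k1 - z *: f1) - (k2 - z *: f2)) = 0 -> nrm (f1 - f2) = 0.
Proof.
move=> r1 r2 k12; apply: (core_total (Re_q := Re_qJ)); first by rewrite ImJ normrN ReJ.
move=> p.
have [|g <-] := @oscillator_surjective R q^* z^* p.
  move=> n; apply: contra (z_neq n) => /eqP zn; apply/eqP.
  by rewrite -[z]conjcK zn rmorphM /= conjcK rmorph_nat.
rewrite (ipBl ipP) !(represents_adjoint _ r1) !(represents_adjoint _ r2) -(ipBl ipP).
exact: ip_eq0l.
Qed.

Lemma represented_unique (f k1 k2 : L2T R) : represents f k1 -> represents f k2 ->
  nrm (k1 - k2) = 0.
Proof.
move=> [_ r1] [_ r2]; apply: (core_total (Re_q := Re_q)) => // p.
rewrite (ipBl ipP) -r1 ?r2 ?subrr//; exact: core_domain.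
Qed.

Local Notation T := (harmonic_oscillator (q ^+ 2)).

Lemma op_dom_represents (f : fct) : op_dom T f -> exists f' k : L2T R,
  [/\ L2val f' = f, L2val k = op_app T f & represents f' k].
Proof.
move=> [fD fk]; have [kL kP] := xgetPex (cst 0) fk.
have fL : L2 f by case: fD => [[]].
exists (toL2 fL), (toL2 kL); split=> //; split=> // g; exact: kP.
Qed.

Lemma represents_op_dom (f k : L2T R) : represents f k -> op_dom T f.
Proof.
move=> [fD fk]; split=> //; exists k; split=> [|g gD]; first exact: L2TP.
have gL : L2 g by case: gD => [[]].
exact: (fk (toL2 gL)).
Qed.

Variable M : R.
Hypothesis M_ge0 : 0 <= M.
Hypothesis M_bound : forall p, nrm (coreT Re_q p) <=
  M * nrm (coreT Re_q (@oscillator R {poly R[i]} (momentum q) (@position R) (q ^+ 2) p - z *: p)).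

(** [op_app] and [resolvent] pick unspecified representatives. Uniqueness almost everywhere, of the
    represented value and of the solution, carries the bound from the constructed solution to the
    chosen one. *)
Lemma harmonic_oscillator_resolvent :
  resolvent_set T z /\ (opnorm (resolvent T z) <= M%:E)%E.
Proof.
have unique f1 f2 : op_dom T f1 -> op_dom T f2 ->
    ae_eq mu setT (op_shift T z f1) (op_shift T z f2) -> ae_eq mu setT f1 f2.
  move=> /op_dom_represents[f1' [k1 [<- k1E r1]]] /op_dom_represents[f2' [k2 [<- k2E r2]]] h.
  apply/ae_eqP; apply: (represents_unique r1 r2); apply/ae_eqP.
  rewrite -[L2val (k1 - _)]/(fun x => k1 x - z * f1' x).
  by rewrite -[L2val (k2 - _)]/(fun x => k2 x - z * f2' x) k1E k2E.
have exist (h : L2T R) : exists F : L2T R, [/\ op_dom T F,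
    ae_eq mu setT (op_shift T z F) h & nrm F <= M * nrm h].
  have [F [FD FP FM]] := resolvent_exists Im_q z_neq M_ge0 M_bound h.
  have rF : represents F (h + z *: F) by [].
  exists F; split=> //; first exact: represents_op_dom rF.
  (* [k] is the value picked by [op_app] at [F]; density of the core identifies it with [h + z F]
     almost everywhere. *)
  have [F' [k [F'F kE rk]]] := op_dom_represents (represents_op_dom rF).
  have {}F'F : F' = F by exact: val_inj.
  rewrite F'F in rk.
  have /ae_eqP := represented_unique rk rF; rewrite kE.
  apply: (@filterS _ _ (ae_filter_ringOfSetsType mu)) => x E _.
  by rewrite /op_shift (E I) -[L2val _ x]/(h x + z * F x) addrK.
have resolvent_le h : L2 h -> L2norm (resolvent T z h) <= M * L2norm h.
  move=> hL; have [F [FD Fh FM]] := exist (toL2 hL).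
  have := @xgetPex _ (cst 0) [set f | op_dom T f /\ ae_eq mu setT (op_shift T z f) h].
  move=> /(_ (ex_intro _ _ (conj FD Fh))); rewrite -/(resolvent T z h) => -[rD rh].
  have rF : ae_eq mu setT (resolvent T z h) F.
    apply: unique => //; apply: ae_eq_trans rh _; exact: ae_eq_sym.
  have [r' [k [r'E _ _]]] := op_dom_represents rD.
  move: rF; rewrite -r'E => /ae_eqP rF.
  rewrite -[L2norm h]/(L2norm (toL2 hL)) !L2normT; apply: le_trans FM.
  have := hnormD ipP (r' - F) F; rewrite subrK rF add0r; exact.
have opM : (opnorm (resolvent T z) <= M%:E)%E.
  apply: ge_ereal_sup => _ [h [hL h1] <-]; rewrite lee_fin.
  by apply: (le_trans (resolvent_le h hL)); rewrite ler_piMr.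
split=> //; split=> //; last exact: le_lt_trans opM (ltry _).
by move=> h hL; have [F [FD Fh _]] := exist (toL2 hL); exists F.
Qed.
End HarmonicOscillatorResolvent.

(** * The sector *)

Section Sector.
Variable R : realType.

(** [Arg] is a choice, so its defining property has to be shown attainable; in the upper half-plane
    the arc cosine provides the angle. *)
Lemma polar_exists (u : R[i]) : 0 < Im u ->
  exists t, - pi < t <= pi /\ u = `|u| * (cos t +i* sin t).
Proof.
move=> Im_u; have n0 : 0 < normc u.
  by rewrite normc_gt0; apply: contraTneq Im_u => ->; rewrite ltxx.
pose a := Re u / normc u.
have a1 : -1 <= a <= 1.
  rewrite -ler_norml normrM normfV (ger0_norm (ltW n0)) ler_pdivrMr// mul1r.
  exact: normr_Re_le.
have sqrt1a : Num.sqrt (1 - a ^+ 2) = Im u / normc u.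
  rewrite -[RHS]ger0_norm ?divr_ge0 ?normc_ge0// ?(ltW Im_u)// -sqrtr_sqr; congr Num.sqrt.
  rewrite /a !expr_div_n; apply: (@mulIf _ (normc u ^+ 2)); first by rewrite expf_neq0// gt_eqF.
  rewrite mulrBl !divfK ?expf_neq0 ?gt_eqF// mul1r normc_sqr; ring.
exists (acos a); split.
  by rewrite acos_lepi// andbT (lt_le_trans _ (acos_ge0 a1))// oppr_lt0 pi_gt0.
rewrite acosK ?in_itv// sin_acos// sqrt1a normc_def -normcE'.
by apply: complexP; rewrite !ReImE /= mul0r ?subr0 ?addr0 mulrC divfK// gt_eqF.
Qed.

(** Any angle in []-pi, pi]] satisfying the polar equation has positive sine, hence lies in []0,
    pi[]. *)
Lemma Arg_upper (u : R[i]) : 0 < Im u ->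
  [/\ 0 < Arg u < pi, Re u = normc u * cos (Arg u) & Im u = normc u * sin (Arg u)].
Proof.
move=> Im_u; have [] := getPex (polar_exists Im_u); rewrite -/(Arg u).
move: (Arg u) => t /andP[tl tr] uE.
have n0 : 0 < normc u.
  by rewrite normc_gt0; apply: contraTneq Im_u => ->; rewrite ltxx.
have ReE : Re u = normc u * cos t.
  by rewrite {1}uE normc_def -normcE' ReM /= mul0r subr0.
have ImE : Im u = normc u * sin t.
  by rewrite {1}uE normc_def -normcE' ImM /= mul0r addr0.
split=> //; have st : 0 < sin t by move: Im_u; rewrite ImE pmulr_rgt0.
apply/andP; split.
  rewrite ltNge; apply/negP => t0; move: st; rewrite ltNge => /negP; apply.
  by rewrite -oppr_ge0 -sinN sin_ge0_pi// oppr_ge0 t0 lerNl ltW.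
by rewrite lt_neqAle tr andbT; apply: contraTneq st => ->; rewrite sinpi ltxx.
Qed.

(** [Im (v / c)] has the sign of [sin (Arg v - Arg c)]. If [Arg v >= Arg c], the difference lies in
    [[0, pi]] and this sine is nonnegative. *)
Lemma sectorP (c v : R[i]) : 0 < Im c -> 0 < Im v -> Im (v / c) < 0 ->
  sector 0 (Arg c) v.
Proof.
move=> Im_c Im_v Im_vc.
have [/andP[c0 c1] cR cI] := Arg_upper Im_c.
have [/andP[v0 v1] vR vI] := Arg_upper Im_v.
split; first by apply: contraTneq Im_v => ->; rewrite ltxx.
rewrite v0/= ltNge; apply/negP => cv.
move: Im_vc; rewrite ltNge => /negP; apply.
rewrite ImM ReV ImV.
have -> : Re v * (- Im c / (Re c ^+ 2 + Im c ^+ 2)) + Im v * (Re c / (Re c ^+ 2 + Im c ^+ 2)) =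
    normc v * normc c * sin (Arg v - Arg c) / (Re c ^+ 2 + Im c ^+ 2).
  by rewrite sinB; set D := _ ^+ 2 + _; rewrite cR cI vR vI; ring.
rewrite divr_ge0 ?addr_ge0 ?sqr_ge0// mulr_ge0 ?mulr_ge0 ?normc_ge0//.
apply: sin_ge0_pi; rewrite subr_ge0 cv /= lerBlDr.
by rewrite (le_trans (ltW v1))// lerDl ltW.
Qed.

Lemma sqrtc_upper (c : R[i]) : 0 < Re c -> 0 < Im c ->
  0 < Im (sqrtc c) < Re (sqrtc c).
Proof.
move=> Re_c Im_c; have q2 := sqr_sqrtc c.
have Re_q : 0 <= Re (sqrtc c) by case: (c) => a b /=; rewrite sqrtr_ge0.
move: (sqrtc c) q2 Re_q => q q2 Re_q.
have R2 : 0 < Re q ^+ 2 - Im q ^+ 2 by rewrite -q2 expr2 ReM -!expr2 in Re_c.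
have I2 : 0 < Re q * Im q.
  by rewrite -(pmulrn_lgt0 _ (_ : 0 < 2)%N)// mulr2n; move: Im_c;
    rewrite -q2 expr2 ImM [Im q * _]mulrC.
have Rq : 0 < Re q.
  by rewrite lt_neqAle Re_q andbT; apply: contraTneq I2 => <-; rewrite mul0r ltxx.
have Iq : 0 < Im q by rewrite -(pmulr_rgt0 _ Rq).
by rewrite Iq /= -(ltr_pXn2r (_ : 0 < 2)%N) ?nnegrE ?(ltW Rq) ?(ltW Iq)// -subr_gt0.
Qed.
End Sector.

(** * From the resolvent bound to the pseudospectrum *)

Lemma core_region_bound (R : realType) (q : R[i]) (delta : R) (m : nat) (Re_q : 0 < Re q) :
  0 < Im q -> 0 < Re (q ^+ 2) -> 0 < delta < 1 ->
  let w := q * (2 * m.+1 + 1)%:R - delta%:C * q in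
  exists M d : R, [/\ 0 <= M, 0 < d &
   forall z, Im z <= Im w \/ Im (w / q ^+ 2) <= Im (z / q ^+ 2) ->
    (forall n, (n <= m)%N -> delta <= normc (z - q * (2 * n + 1)%:R)) ->
    (forall n, d <= normc (z - q * (2 * n + 1)%:R)) /\
    forall p, hnorm (@L2ip R) (coreT Re_q p) <= M * hnorm (@L2ip R) (coreT Re_q
      (@oscillator R {poly R[i]} (momentum q) (@position R) (q ^+ 2) p - z *: p))].
Proof.
move=> Im_q Re_q2 hdelta.
exact (@region_bound R {poly R[i]} (core_ip Re_q) (core_ipP Re_q)
  (momentum q) (@position R) (momentum_sym Re_q) (position_sym Re_q) (canonical_commutation q)
  q 1 Re_q Im_q (lower_ground q) (oscillator_ground q) (lower_raise q) (oscillator_raise q)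
  (ground_raise_decomposition Re_q) Re_q2 delta m hdelta).
Qed.

Theorem theorem12 (R : realType) (c : R[i])
    (hRe : 0 < complex.Re c) (hIm : 0 < complex.Im c)
    (delta : R) (hdelta : 0 < delta < 1) (m : nat) :
  exists eps : R, 0 < eps /\
    pseudospectrum eps (harmonic_oscillator c) `<=`
      translate (sector 0 (Arg c))
                (ho_eigenvalue c m.+1 - delta%:C * sqrtc c)
      `|` \bigcup_(n in [set n | (n <= m)%N])
            [set z : R[i] | `|z - ho_eigenvalue c n| < delta%:C].
Proof.
rewrite /ho_eigenvalue; have := sqrtc_upper hRe hIm.
move qE : (sqrtc c) => q /andP[Im_q Im_lt].
have cE : c = q ^+ 2 by rewrite -qE sqr_sqrtc.
have Re_q : 0 < Re q by exact: lt_trans Im_lt.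
have Im_q' : `|Im q| < Re q by rewrite gtr0_norm.
have Re_q2 : 0 < Re (q ^+ 2) by rewrite -cE.
have [M [d [M0 d0 bound]]] := core_region_bound m Re_q Im_q Re_q2 hdelta.
set w := q * _ - _ in bound *.
(* [1 / eps] must exceed [M] strictly, because the pseudospectrum is defined by a non-strict
   inequality. *)
exists (M + 1)^-1; split; first by rewrite invr_gt0 ltr_wpDl.
move=> z z_spec; apply: contrapT => /not_orP[z_sector z_disc].
have far n : (n <= m)%N -> delta <= normc (z - q * (2 * n + 1)%:R).
  move=> nm; rewrite leNgt; apply/negP => zn; apply: z_disc; exists n => //=.
  by rewrite normc_def -normcE' ltcR.
(* A point in neither half-plane has [Im (z - w) > 0] and [Im ((z - w) / c) < 0], so it belongs to
   the translated sector. *)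
have half : Im z <= Im w \/ Im (w / q ^+ 2) <= Im (z / q ^+ 2).
  have [|wz] := leP (Im z) (Im w); first by left.
  right; rewrite leNgt; apply/negP => zw; apply: z_sector.
  exists (z - w); last by rewrite subrK.
  apply: sectorP => //; first by rewrite ReImE ReImE subr_gt0.
  by rewrite mulrBl cE !(ImD, ImN) subr_lt0.
have [zd zM] := bound z half far.
have z_neq n : z != q * (2 * n + 1)%:R.
  apply/eqP => zE; have := zd n; rewrite zE subrr ComplexField.Normc.normc0.
  by rewrite leNgt d0.
have [res op] := harmonic_oscillator_resolvent Im_q' z_neq M0 zM.
case: z_spec; rewrite cE; first by apply.
rewrite /= invrK => /le_trans/(_ op); rewrite lee_fin.
by rewrite gerDl ler10.
Qed.
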